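(* (1) The system $\mathsf{Z}_2^\omega+\mathsf{QF\text{-}AC}^{0,1}$ cannot prove $\mathsf{OC}^{0,0}$. (2) The system $\mathsf{Z}_2^\Omega$ proves $\mathsf{OC}^{0,0}$.
   Context: Framework: Kohlenbach's higher-order reverse mathematics; $\mathsf{RCA}_0^\omega$ is Kohlenbach's base theory (extensional primitive recursive arithmetic in all finite types with $\mathsf{QF\text{-}AC}^{1,0}$). $\mathsf{QF\text{-}AC}^{0,1}$: for all $Y^2$, if $(\forall n)(\exists f\in\mathbb{N}^\mathbb{N})(Y(f,n)=0)$ then there is $\Phi^{0\to1}$ with $(\forall n)(Y(\Phi(n),n)=0)$. $\mathsf{Z}_2^\omega$ is $\mathsf{RCA}_0^\omega$ plus, for each $k\ge1$, the existence of a functional $\mathsf{S}^2_k$ deciding $\Pi^1_k$-formulas in Kleene normal form; $\mathsf{Z}_2^\Omega$ is $\mathsf{RCA}_0^\omega$ plus Kleene's $(\exists^3)$: there is $E^3$ with $(\forall Y^2)[(\exists f)(Y(f)=0)\leftrightarrow E(Y)=0]$. An open set $U\subseteq\mathbb{R}$ is given by $h_U:\mathbb{R}\to\mathbb{R}$, with $x\in U$ meaning $h_U(x)>0$, such that $y\in U$ implies $(\exists N)(\forall z\in B(y,2^{-N}))(z\in U)$. $\mathsf{OC}^{0,0}$: for every increasing sequence $(O_n)$ of open sets in $\mathbb{R}$: if $(\forall n\in\mathbb{N})(\exists m\in\mathbb{N})([-n,n]\subseteq O_m)$ then $(\exists g\in\mathbb{N}^\mathbb{N})(\forall n)([-n,n]\subseteq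 O_{g(n)})$. *)

(* Defs.v *)
(** A deep embedding of Kohlenbach's higher-order arithmetic:
    intrinsically typed syntax with de Bruijn indices, classical natural
    deduction, and the systems RCA_0^omega, Z_2^omega and Z_2^Omega. *)

From Stdlib Require Import List.
Import ListNotations.

Set Implicit Arguments.
Unset Strict Implicit.
Unset Printing Implicit Defensive.

Declare Scope hoa_scope.
Delimit Scope hoa_scope with hoa.
Open Scope hoa_scope.

Inductive ty : Type := T0 | Arr (s t : ty).

Notation "s --> t" := (Arr s t) (at level 55, right associativity) : hoa_scope.

Notation T1 := (Arr T0 T0).
Notation T2 := (Arr T1 T0).
Notation T3 := (Arr T2 T0).

Definition ctx := list ty.

Inductive var : ctx -> ty -> Type :=
| VZ G s : var (s :: G) s
| VS G s t : var G t -> var (s :: G) t.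
Arguments VZ {G s}.
Arguments VS {G s t} _.

(** [Pi] and [Sigma] are the combinators K and S; [Rec] is the recursor of
    type 0 only. *)
Inductive tm (G : ctx) : ty -> Type :=
| Var s : var G s -> tm G s
| Zero : tm G T0
| Succ : tm G (T0 --> T0)
| Pi s t : tm G (s --> t --> s)
| Sigma r s t : tm G ((r --> s --> t) --> (r --> s) --> r --> t)
| Rec : tm G (T0 --> T0 --> (T0 --> T0 --> T0) --> T0)
| App s t : tm G (s --> t) -> tm G s -> tm G t.
Arguments Var {G s} _.
Arguments Zero {G}.
Arguments Succ {G}.
Arguments Pi {G s t}.
Arguments Sigma {G r s t}.
Arguments Rec {G}.
Arguments App {G s t} _ _.

Notation "f $ x" := (App f x) (at level 25, left associativity) : hoa_scope.

Notation v0 := (Var VZ).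
Notation v1 := (Var (VS VZ)).
Notation v2 := (Var (VS (VS VZ))).

(** Equality is primitive at type 0 only. *)
Inductive form : ctx -> Type :=
| Eq G : tm G T0 -> tm G T0 -> form G
| Bot G : form G
| And G : form G -> form G -> form G
| Or G : form G -> form G -> form G
| Imp G : form G -> form G -> form G
| All G s : form (s :: G) -> form G
| Ex G s : form (s :: G) -> form G.
Arguments Bot {G}.
Arguments All {G} s _.
Arguments Ex {G} s _.

Notation "a == b" := (Eq a b) (at level 70, no associativity) : hoa_scope.
Notation "A ∧ B" := (And A B) (at level 80, right associativity) : hoa_scope.
Notation "A ⊃ B" := (Imp A B) (at level 90, right associativity) : hoa_scope.
Definition Not G (A : form G) : form G := A ⊃ Bot.
Definition Iff G (A B : form G) : form G := (A ⊃ B) ∧ (B ⊃ A).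

Fixpoint quantifier_free G (A : form G) : bool :=
  match A with
  | Eq _ _ | Bot => true
  | And A B | Or A B | Imp A B =>
      andb (quantifier_free A) (quantifier_free B)
  | All _ _ | Ex _ _ => false
  end.

Definition subst (G D : ctx) : Type := forall s, var G s -> tm D s.

Fixpoint tsub G D (f : subst G D) s (a : tm G s) : tm D s :=
  match a with
  | Var x => f _ x
  | Zero => Zero
  | Succ => Succ
  | Pi => Pi
  | Sigma => Sigma
  | Rec => Rec
  | App a b => App (tsub f a) (tsub f b)
  end.

Definition scons G D s (a : tm D s) (f : subst G D) : subst (s :: G) D :=
  fun t x =>
    match x in var G' t'
      return match G' with
             | [] => unit
             | s' :: G'' => tm D s' -> subst G'' D -> tm D t'
             end
    with
    | VZ => fun a _ => a
    | VS y => fun _ f => f _ y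
    end a f.

Definition wk G s : subst G (s :: G) := fun _ x => Var (VS x).
Arguments wk {G s} _ _.

Definition up G s t (a : tm G t) : tm (s :: G) t := tsub wk a.
Arguments up {G s t} _.

Definition lift G D (f : subst G D) s : subst (s :: G) (s :: D) :=
  scons v0 (fun _ x => up (f _ x)).

Fixpoint fsub G (A : form G) : forall D, subst G D -> form D :=
  match A with
  | Eq a b => fun _ f => Eq (tsub f a) (tsub f b)
  | Bot => fun _ _ => Bot
  | And A B => fun _ f => And (fsub A f) (fsub B f)
  | Or A B => fun _ f => Or (fsub A f) (fsub B f)
  | Imp A B => fun _ f => Imp (fsub A f) (fsub B f)
  | All s A => fun _ f => All s (fsub A (lift f (s := s)))
  | Ex s A => fun _ f => Ex s (fsub A (lift f (s := s)))
  end.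

Definition fup G s (A : form G) : form (s :: G) := fsub A wk.
Arguments fup {G s} _.

Definition inst G s (A : form (s :: G)) (a : tm G s) : form G :=
  fsub A (scons a (fun _ x => Var x)).

(** A theory gives the axioms in every context of free variables. *)
Definition theory : Type := forall G, form G -> Prop.

Inductive derives (T : theory) : forall G, list (form G) -> form G -> Prop :=
| d_ax G (H : list (form G)) A : T G A -> derives T H A
| d_hyp G (H : list (form G)) A : In A H -> derives T H A
| d_impI G (H : list (form G)) A B :
    derives T (A :: H) B -> derives T H (A ⊃ B)
| d_impE G (H : list (form G)) A B :
    derives T H (A ⊃ B) -> derives T H A -> derives T H B
| d_andI G (H : list (form G)) A B :
    derives T H A -> derives T H B -> derives T H (A ∧ B)
| d_andE1 G (H : list (form G)) A B : derives T H (A ∧ B) -> derives T H A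
| d_andE2 G (H : list (form G)) A B : derives T H (A ∧ B) -> derives T H B
| d_orI1 G (H : list (form G)) A B : derives T H A -> derives T H (Or A B)
| d_orI2 G (H : list (form G)) A B : derives T H B -> derives T H (Or A B)
| d_orE G (H : list (form G)) A B C :
    derives T H (Or A B) -> derives T (A :: H) C -> derives T (B :: H) C ->
    derives T H C
| d_raa G (H : list (form G)) A : derives T (Not A :: H) Bot -> derives T H A
| d_allI G (H : list (form G)) s (A : form (s :: G)) :
    derives T (map (fup (s := s)) H) A -> derives T H (All s A)
| d_allE G (H : list (form G)) s (A : form (s :: G)) (a : tm G s) :
    derives T H (All s A) -> derives T H (inst A a)
| d_exI G (H : list (form G)) s (A : form (s :: G)) (a : tm G s) :
    derives T H (inst A a) -> derives T H (Ex s A)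
| d_exE G (H : list (form G)) s (A : form (s :: G)) C :
    derives T H (Ex s A) -> derives T (A :: map (fup (s := s)) H) (fup C) ->
    derives T H C.

Definition proves (T : theory) (A : form []) : Prop := derives T [] A.

Fixpoint eqt (s : ty) : forall G, tm G s -> tm G s -> form G :=
  match s with
  | T0 => fun _ a b => a == b
  | Arr s t => fun _ a b => All s (eqt (up a $ v0) (up b $ v0))
  end.

Inductive RCA0w : theory :=
| ax_refl G (a : tm G T0) : RCA0w (a == a)
| ax_sym G (a b : tm G T0) : RCA0w (a == b ⊃ b == a)
| ax_trans G (a b c : tm G T0) : RCA0w (a == b ⊃ b == c ⊃ a == c)
| ax_succ_zero G (a : tm G T0) : RCA0w (Not (Succ $ a == Zero))
| ax_succ_inj G (a b : tm G T0) : RCA0w (Succ $ a == Succ $ b ⊃ a == b)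
| ax_Pi G s t (a : tm G s) (b : tm G t) : RCA0w (eqt (Pi $ a $ b) a)
| ax_Sigma G r s t
    (a : tm G (r --> s --> t)) (b : tm G (r --> s)) (c : tm G r) :
    RCA0w (eqt (Sigma $ a $ b $ c) (a $ c $ (b $ c)))
| ax_Rec_zero G (y : tm G T0) (z : tm G (T0 --> T0 --> T0)) :
    RCA0w (Rec $ Zero $ y $ z == y)
| ax_Rec_succ G (x y : tm G T0) (z : tm G (T0 --> T0 --> T0)) :
    RCA0w (Rec $ (Succ $ x) $ y $ z == z $ (Rec $ x $ y $ z) $ x)
| ax_ext G s t (z : tm G (s --> t)) (a b : tm G s) :
    RCA0w (eqt a b ⊃ eqt (z $ a) (z $ b))
| ax_QF_IND G (A : form (T0 :: G)) :
    quantifier_free A = true ->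
    RCA0w (inst A Zero ∧ All T0 (A ⊃ fsub A (scons (Succ $ v0) wk)) ⊃
           All T0 A)
| ax_QF_AC10 G (A : form (T0 :: T1 :: G)) :
    (* forall f exists n A(f,n) -> exists F forall f A(f,F(f)) *)
    quantifier_free A = true ->
    RCA0w (All T1 (Ex T0 A) ⊃
           Ex T2 (All T1
             (fsub A (scons (v1 $ v0)
                     (scons v0 (fun _ x => Var (VS (VS x)))))))).

(** [lam] is bracket abstraction: the term language has no binder. *)
Definition lam_var G s t (x : var (s :: G) t) : tm G (s --> t) :=
  match x in var G' t'
    return match G' with [] => unit | s' :: G'' => tm G'' (s' --> t') end
  with
  | @VZ G s => Sigma $ Pi $ @Pi G s s
  | VS y => Pi $ Var y
  end.

Fixpoint lam G s t (a : tm (s :: G) t) : tm G (s --> t) :=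
  match a with
  | Var x => lam_var x
  | Zero => Pi $ Zero
  | Succ => Pi $ Succ
  | Pi => Pi $ Pi
  | Sigma => Pi $ Sigma
  | Rec => Pi $ Rec
  | App a b => Sigma $ lam a $ lam b
  end.

Section Arithmetic.
Variable G : ctx.
Implicit Types a b n : tm G T0.

(** In [rec n y b], [v1] is the previous value and [v0] the counter. *)
Definition rec n (y : tm G T0) (b : tm (T0 :: T0 :: G) T0) : tm G T0 :=
  Rec $ n $ y $ lam (lam b).

Definition one : tm G T0 := Succ $ Zero.
Definition addN a b : tm G T0 := rec b a (Succ $ v1).
Definition predN a : tm G T0 := rec a Zero v0.
End Arithmetic.
Arguments one {G}.

Definition mulN G (a b : tm G T0) : tm G T0 := rec b Zero (addN v1 (up (up a))).
Definition monus G (a b : tm G T0) : tm G T0 := rec b a (predN v1).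
Definition pow2 G (a : tm G T0) : tm G T0 := rec a one (addN v1 v1).

Definition leN G (a b : tm G T0) : form G := monus a b == Zero.
Definition ltN G (a b : tm G T0) : form G := leN (Succ $ a) b.

(** Cantor pairing [pairN a b = (a+b)(a+b+1)/2 + b]; [troot n] is the largest
    [w] with [tri w <= n]. *)
Definition tri G (n : tm G T0) : tm G T0 := rec n Zero (addN v1 (Succ $ v0)).
Definition pairN G (a b : tm G T0) : tm G T0 := addN (tri (addN a b)) b.
Definition troot G (n : tm G T0) : tm G T0 :=
  rec n Zero (addN v1 (monus one (monus (tri (Succ $ v1)) (Succ $ v0)))).
Definition sndN G (n : tm G T0) : tm G T0 := monus n (tri (troot n)).
Definition fstN G (n : tm G T0) : tm G T0 := monus (troot n) (sndN n).

(** The code of the finite sequence [g 0, ..., g (n-1)]. *)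
Definition bar G (g : tm G T1) (n : tm G T0) : tm G T0 :=
  rec n Zero (Succ $ pairN v1 (up (up g) $ v0)).

Fixpoint bar_tuple G (gs : list (tm G T1)) (n : tm G T0) : tm G T0 :=
  match gs with
  | [] => Zero
  | [g] => bar g n
  | g :: gs => pairN (bar g n) (bar_tuple gs n)
  end.

Definition quant (universal : bool) G s (A : form (s :: G)) : form G :=
  if universal then All s A else Ex s A.

(** [k] further alternating function quantifiers, starting with a universal
    one if [universal], followed by the number quantifier on [n] and the matrix
    [f(bar g_1 n, ..., bar g_m n) = 0]; [gs] lists the functions already
    quantified. *)
Fixpoint kleene_nf (universal : bool) (k : nat) G
    (f : tm G T1) (gs : list (tm G T1)) : form G :=
  match k with
  | O => quant universal (s := T0)
           (up f $ bar_tuple (map (fun g => up g) gs) v0 == Zero)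
  | S k => quant universal (s := T1)
             (kleene_nf (negb universal) k
                (up f) (map (fun g => up g) gs ++ [v0]))
  end.

Definition Pi1 (k : nat) G (f : tm G T1) : form G := kleene_nf true k f [].

Definition S2 (k : nat) G : form G :=
  Ex T2 (All T1 (Iff (v1 $ v0 == Zero) (Pi1 k v0))).

Definition E3 G : form G :=
  Ex T3 (All T2 (Iff (Ex T1 (v1 $ v0 == Zero)) (v1 $ v0 == Zero))).

Definition QF_AC01 G : form G :=
  All (T1 --> T0 --> T0)
    (All T0 (Ex T1 (v2 $ v0 $ v1 == Zero)) ⊃
     Ex (T0 --> T1) (All T0 (v2 $ (v1 $ v0) $ v0 == Zero))).

Inductive Z2w : theory :=
| Z2w_base G (A : form G) : RCA0w A -> Z2w A
| Z2w_S2 G k : 1 <= k -> Z2w (S2 k G).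

Inductive Z2w_QF_AC01 : theory :=
| Z2w_QF_AC01_base G (A : form G) : Z2w A -> Z2w_QF_AC01 A
| Z2w_QF_AC01_choice G : Z2w_QF_AC01 (QF_AC01 G).

Inductive Z2W : theory :=
| Z2W_base G (A : form G) : RCA0w A -> Z2W A
| Z2W_E3 G : Z2W (E3 G).

(** Every number codes a rational: [pairN (pairN a b) c] codes [(a-b)/(c+1)]. *)
Section Rationals.
Variable G : ctx.
Implicit Types p q : tm G T0.

Definition posQ q : tm G T0 := fstN (fstN q).
Definition negpartQ q : tm G T0 := sndN (fstN q).
Definition denQ q : tm G T0 := Succ $ sndN q.

Definition natQ (n : tm G T0) : tm G T0 := pairN (pairN n Zero) Zero.
(** [dyadicQ a n] codes [a / 2^n]. *)
Definition dyadicQ (a n : tm G T0) : tm G T0 :=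
  pairN (pairN a Zero) (predN (pow2 n)).
Definition oppQ q : tm G T0 := pairN (pairN (negpartQ q) (posQ q)) (sndN q).
Definition addQ p q : tm G T0 :=
  pairN (pairN (addN (mulN (posQ p) (denQ q)) (mulN (posQ q) (denQ p)))
             (addN (mulN (negpartQ p) (denQ q)) (mulN (negpartQ q) (denQ p))))
       (predN (mulN (denQ p) (denQ q))).
Definition subQ p q : tm G T0 := addQ p (oppQ q).
Definition absQ q : tm G T0 :=
  pairN (pairN (addN (monus (posQ q) (negpartQ q)) (monus (negpartQ q) (posQ q)))
             Zero)
       (sndN q).

Definition leQ p q : form G :=
  leN (addN (mulN (posQ p) (denQ q)) (mulN (negpartQ q) (denQ p)))
     (addN (mulN (posQ q) (denQ p)) (mulN (negpartQ p) (denQ q))).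
Definition ltQ p q : form G :=
  ltN (addN (mulN (posQ p) (denQ q)) (mulN (negpartQ q) (denQ p)))
     (addN (mulN (posQ q) (denQ p)) (mulN (negpartQ p) (denQ q))).
End Rationals.

(** A real is a sequence of rationals with [|x_n - x_(n+i)| < 2^-n]. *)
Definition isReal G (x : tm G T1) : form G :=
  All T0 (All T0 (ltQ (absQ (subQ (up (up x) $ v1) (up (up x) $ addN v1 v0)))
                    (dyadicQ one v1))).

(** As [x_n] is within [2^-n] of [x], the tolerance is [2^(1-n)]. *)
Definition eqR G (x y : tm G T1) : form G :=
  All T0 (leQ (absQ (subQ (up x $ v0) (up y $ v0))) (dyadicQ (Succ $ one) v0)).
Definition ltR G (x y : tm G T1) : form G :=
  Ex T0 (ltQ (addQ (up x $ v0) (dyadicQ (Succ $ one) v0)) (up y $ v0)).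
Definition leR G (x y : tm G T1) : form G := Not (ltR y x).

Definition ratR G (q : tm G T0) : tm G T1 := Pi $ q.
Definition subR G (x y : tm G T1) : tm G T1 :=
  lam (subQ (up x $ (Succ $ v0)) (up y $ (Succ $ v0))).
Definition absR G (x : tm G T1) : tm G T1 := lam (absQ (up x $ v0)).

Definition AllR G (A : form (T1 :: G)) : form G := All T1 (isReal v0 ⊃ A).

(** [h] maps (codes of) reals to reals and respects [eqR]. *)
Definition isFunR G (h : tm G (T1 --> T1)) : form G :=
  AllR (isReal (up h $ v0)) ∧
  AllR (AllR (eqR v1 v0 ⊃ eqR (up (up h) $ v1) (up (up h) $ v0))).

Definition mem G (x : tm G T1) (h : tm G (T1 --> T1)) : form G :=
  ltR (ratR (natQ Zero)) (h $ x).

(** [|z - y| < 2^-n]. *)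
Definition inBall G (z y : tm G T1) (n : tm G T0) : form G :=
  ltR (absR (subR z y)) (ratR (dyadicQ one n)).

Definition isOpen G (h : tm G (T1 --> T1)) : form G :=
  isFunR h ∧
  AllR (mem v0 (up h) ⊃
        Ex T0 (AllR (inBall v0 v2 v1 ⊃ mem v0 (up (up (up h)))))).

(** [[-n,n]] is included in the open set represented by [h]. *)
Definition covers G (h : tm G (T1 --> T1)) (n : tm G T0) : form G :=
  AllR (leR (ratR (oppQ (natQ (up n)))) v0 ∧ leR v0 (ratR (natQ (up n))) ⊃
        mem v0 (up h)).

(** The outermost variable is the sequence of representations [n => h_(O_n)]. *)
Definition OC00 : form [] :=
  All (T0 --> T1 --> T1)
    (All T0 (isOpen (v1 $ v0)) ∧
     All T0 (AllR (mem v0 (v2 $ v1) ⊃ mem v0 (v2 $ (Succ $ v1)))) ∧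
     All T0 (Ex T0 (covers (v2 $ v0) v1)) ⊃
     Ex T1 (All T0 (covers (v2 $ (v1 $ v0)) v0))).

(* Main.v *)
From Stdlib Require Import List Arith Lia Reals Lra ClassicalEpsilon Cantor.
From Stdlib Require Import FunctionalExtensionality PropExtensionality ProofIrrelevance.
Import ListNotations.
Require Import Defs.

(** For the positive part, [E3] turns every formula all of whose quantifiers
    range over numbers and functions into an equation [t = 0]. Applied to
    [[-n, n] included in O_m] this reduces the choice of [m] to [QF_AC10].

    For the negative part we build a model whose function space is a countable
    elementary substructure [A] of [N^N], equipped with a generic finite-to-one
    functional [Y : A -> N]. Forcing conditions are partial finite-to-one
    functionals together with a lower bound [N] for the values added later. The
    bound need not be raised to decide a fact witnessed by a single condition,
    so that countably many such facts can be collected in one condition: if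
    every [n] has a witness [q] below [Y] in the substructure, then one [p] below
    [Y] witnesses all [n]. Consequently the relations witnessed by parts of [Y]
    are closed under number quantifiers and existential function quantifiers,
    the total functionals with such graphs yield no function outside [A], and
    [QF_AC01] holds. The functionals [S2_k] belong to the model since [A] is
    elementary.

    Each binary sequence [b] of [A] codes a partial function on numbers. Remove
    from [R], for every [n >= Y b], a point of the interval from [n] to [n + 1]
    coding [(n, b)], as long as [m] is less than the value at [n] of the function
    coded by [b]. As [Y] is finite-to-one, only finitely many points of [[-n, n]]
    are removed, so that this gives open sets [O_m], and some [O_m] contains
    [[-n, n]]; but no function in [A] bounds such [m] in terms of [n]. *)

Set Implicit Arguments.
Unset Strict Implicit.
Unset Printing Implicit Defensive.

(** * The substitution calculus *)

(** No functional from all of [N^N] to [N] is finite-to-one, so the function space has to be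
    countable as seen from outside, while no object of the model may reveal this: [E3] must fail
    there, by the positive part. The delicate point is what [Y] computes together with the other
    functionals. A forcing relation for arbitrary formulas is avoided, because the matrices of
    [QF_AC10] and [QF_AC01] are quantifier-free and an inequality between values of total
    functionals is again witnessed positively. The objects of higher type are the functions that
    send admissible families to admissible families, as in a logical relation. Full function spaces
    will not do: an arbitrary type 2 functional, evaluated at constant functions, gives an arbitrary
    function, possibly outside [A]. The language of [A] has Hilbert's epsilon as its only binder, so
    that witnesses are named by terms and parameters from [A] can be eliminated. *)

Definition var_case G s (P : forall t, var (s :: G) t -> Type)
    (z : P s VZ) (w : forall t (y : var G t), P t (VS y)) :
    forall t (x : var (s :: G) t), P t x :=
  fun t x =>
    match x in var G' t'
      return match G' as G0 return var G0 t' -> Type with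
             | [] => fun _ => unit
             | s' :: G'' => fun x => forall P : forall t, var (s' :: G'') t -> Type,
                 P s' VZ -> (forall t (y : var G'' t), P t (VS y)) -> P t' x
             end x
    with
    | VZ => fun _ z _ => z
    | VS y => fun _ _ w => w _ y
    end P z w.

Lemma subst_ext G s D (f g : subst (s :: G) D) :
  f _ VZ = g _ VZ -> (forall t (y : var G t), f _ (VS y) = g _ (VS y)) -> f = g.
Proof.
  intros E1 E2. apply functional_extensionality_dep; intros t.
  apply functional_extensionality; intros x. revert t x.
  apply var_case; auto.
Qed.

Lemma tsub_comp G D K (f : subst G D) (g : subst D K) s (a : tm G s) :
  tsub g (tsub f a) = tsub (fun _ x => tsub g (f _ x)) a.
Proof. induction a; simpl; congruence. Qed.

Lemma tsub_id G s (a : tm G s) : tsub (fun _ x => Var x) a = a.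
Proof. induction a; simpl; congruence. Qed.

Lemma tsub_up G D s (f : subst (s :: G) D) t (a : tm G t) :
  tsub f (up a) = tsub (fun _ x => f _ (VS x)) a.
Proof. unfold up. rewrite tsub_comp. reflexivity. Qed.

Lemma tsub_scons_up G s (b : tm G s) t (a : tm G t) :
  tsub (scons b (fun _ x => Var x)) (up a) = a.
Proof. rewrite tsub_up. apply tsub_id. Qed.

Lemma up_tsub G D s (f : subst G D) t (a : tm G t) :
  up (s := s) (tsub f a) = tsub (lift f (s := s)) (up a).
Proof. rewrite tsub_up. unfold up. rewrite tsub_comp. reflexivity. Qed.

Lemma lift_comp G D K s (f : subst G D) (g : subst D K) :
  (fun _ x => tsub (lift g (s := s)) (lift f (s := s) x))
  = lift (fun _ x => tsub g (f _ x)) (s := s).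
Proof.
  apply subst_ext; [reflexivity|]. intros t y. simpl.
  symmetry; apply up_tsub.
Qed.

Lemma lift_id G s : lift (fun _ x => Var x) (s := s) = fun _ (x : var (s :: G) _) => Var x.
Proof. apply subst_ext; reflexivity. Qed.

Lemma fsub_comp G (A : form G) : forall D K (f : subst G D) (g : subst D K),
  fsub (fsub A f) g = fsub A (fun _ x => tsub g (f _ x)).
Proof.
  induction A; intros; simpl; rewrite ?tsub_comp, ?IHA, ?IHA1, ?IHA2, ?lift_comp;
    reflexivity.
Qed.

Lemma fsub_id G (A : form G) : fsub A (fun _ x => Var x) = A.
Proof. induction A; simpl; rewrite ?tsub_id, ?lift_id; congruence. Qed.

(** This undoes the weakening of a quantified formula that is moved into the scope of a fresh
    variable of the same type. It is needed to use a universal hypothesis, or to prove a weakened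
    existential goal, at that variable. *)
Lemma inst_lift_wk G s (A : form (s :: G)) :
  inst (fsub A (lift wk (s := s))) v0 = A.
Proof.
  unfold inst. rewrite fsub_comp. rewrite <- (fsub_id A) at 2. f_equal.
  apply subst_ext; reflexivity.
Qed.

Lemma inst_fup G s (A : form G) (a : tm G s) : inst (fup A) a = A.
Proof. unfold inst, fup. rewrite fsub_comp. apply fsub_id. Qed.

Lemma fsub_eqt s : forall G D (f : subst G D) (a b : tm G s),
  fsub (eqt a b) f = eqt (tsub f a) (tsub f b).
Proof.
  induction s; intros; cbn [eqt fsub]; [reflexivity|].
  rewrite IHs2. cbn [tsub]. rewrite !up_tsub. reflexivity.
Qed.

Lemma inst_eqt_arr G s t (a b : tm G (s --> t)) (c : tm G s) :
  inst (eqt (up a $ v0) (up b $ v0)) c = eqt (a $ c) (b $ c).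
Proof.
  unfold inst. rewrite fsub_eqt. cbn [tsub]. rewrite !tsub_scons_up. reflexivity.
Qed.

(** * Derived rules *)

Lemma weaken T G (H : list (form G)) A :
  derives T H A -> forall H', incl H H' -> derives T H' A.
Proof.
  induction 1; intros H' I.
  - apply d_ax; auto.
  - apply d_hyp; auto.
  - apply d_impI, IHderives. intros x [<-|X]; [left|right]; auto.
  - eapply d_impE; eauto.
  - apply d_andI; auto.
  - eapply d_andE1; eauto.
  - eapply d_andE2; eauto.
  - apply d_orI1; auto.
  - apply d_orI2; auto.
  - eapply d_orE; [apply IHderives1|apply IHderives2|apply IHderives3]; auto;
      intros x [<-|X]; [left|right|left|right]; auto.
  - apply d_raa, IHderives. intros x [<-|X]; [left|right]; auto.
  - apply d_allI, IHderives. apply incl_map; auto.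
  - apply d_allE; auto.
  - eapply d_exI; auto.
  - eapply d_exE; [apply IHderives1; auto|apply IHderives2].
    intros x [<-|X]; [left|right]; auto.
    revert X; apply incl_map; auto.
Qed.

Section Derivations.
Variables (T : theory) (base : forall G (A : form G), RCA0w A -> @T G A).

Local Notation "H ⊢ A" := (derives T H A) (at level 95, no associativity).

Lemma wk1 G (H : list (form G)) A B : H ⊢ A -> B :: H ⊢ A.
Proof. intros D. apply (weaken D). intros x X; right; exact X. Qed.

Arguments wk1 {G H A B} _.

Lemma hyp0 G (H : list (form G)) A : A :: H ⊢ A.
Proof. apply d_hyp. left; reflexivity. Qed.

Lemma cut G (H : list (form G)) A B : H ⊢ A -> A :: H ⊢ B -> H ⊢ B.
Proof. intros D1 D2. exact (d_impE (d_impI D2) D1). Qed.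

Lemma all_here G (H : list (form G)) s (A : form (s :: G)) :
  In (All s A) H -> map (fup (s := s)) H ⊢ A.
Proof.
  intros I. rewrite <- (inst_lift_wk A). apply d_allE.
  apply d_hyp. apply (in_map (fup (s := s)) _ _ I).
Qed.

Lemma ex_here G s (H : list (form (s :: G))) (A : form (s :: G)) :
  H ⊢ A -> H ⊢ fup (Ex s A).
Proof.
  intros D. apply (d_exI (a := v0)).   rewrite inst_lift_wk. exact D.
Qed.

Lemma bot_elim G (H : list (form G)) A : H ⊢ Bot -> H ⊢ A.
Proof. intros D. apply d_raa, wk1, D. Qed.

Lemma excluded_middle G (H : list (form G)) A : H ⊢ Or A (Not A).
Proof.
  apply d_raa. eapply d_impE; [apply hyp0|]. apply d_orI2, d_impI.
  eapply d_impE; [apply wk1, hyp0|]. apply d_orI1, hyp0.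
Qed.

Lemma eqt_refl s : forall G (H : list (form G)) (a : tm G s), H ⊢ eqt a a.
Proof.
  induction s; intros; cbn [eqt]; [apply d_ax, base; constructor|].
  apply d_allI, IHs2.
Qed.

Lemma eqt_sym_imp s : forall G (H : list (form G)) (a b : tm G s),
  H ⊢ eqt a b ⊃ eqt b a.
Proof.
  induction s; intros; [apply d_ax, base; constructor|].
  cbn [eqt]. apply d_impI, d_allI.
  eapply d_impE; [apply IHs2|]. apply all_here. left; reflexivity.
Qed.

Lemma eqt_sym G (H : list (form G)) s (a b : tm G s) : H ⊢ eqt a b -> H ⊢ eqt b a.
Proof. apply d_impE, eqt_sym_imp. Qed.

Lemma eqt_trans_imp s : forall G (H : list (form G)) (a b c : tm G s),
  H ⊢ eqt a b ⊃ eqt b c ⊃ eqt a c.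
Proof.
  induction s; intros; [apply d_ax, base; constructor|].
  cbn [eqt]. apply d_impI, d_impI, d_allI.
  eapply d_impE; [eapply d_impE; [apply IHs2|]|]; apply all_here; cbn; eauto.
Qed.

Lemma eqt_trans G (H : list (form G)) s (a b c : tm G s) :
  H ⊢ eqt a b -> H ⊢ eqt b c -> H ⊢ eqt a c.
Proof. intros D. apply d_impE. revert D. apply d_impE, eqt_trans_imp. Qed.

Lemma eqt_app G (H : list (form G)) s t (f g : tm G (s --> t)) (a : tm G s) :
  H ⊢ eqt f g -> H ⊢ eqt (f $ a) (g $ a).
Proof. intros D. rewrite <- inst_eqt_arr. apply d_allE. exact D. Qed.

Lemma eqt_congr G (H : list (form G)) s t (f g : tm G (s --> t)) (a b : tm G s) :
  H ⊢ eqt f g -> H ⊢ eqt a b -> H ⊢ eqt (f $ a) (g $ b).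
Proof.
  intros D1 D2. apply eqt_trans with (f $ b).
  - eapply d_impE; [apply d_ax, base; constructor|exact D2].
  - apply eqt_app, D1.
Qed.

Lemma tsub_congr G D (H : list (form D)) (f g : subst G D) s (a : tm G s) :
  (forall t x, H ⊢ eqt (f t x) (g t x)) -> H ⊢ eqt (tsub f a) (tsub g a).
Proof.
  intros E. induction a; cbn [tsub]; auto using eqt_refl, eqt_congr.
Qed.

(** Bracket abstraction does not commute with substitution, so a redex whose [lam a] has already
    been substituted into is not an instance of [beta0]. Carrying [f] through the induction covers
    it. *)
Lemma beta G D (H : list (form D)) s t (f : subst G D) (a : tm (s :: G) t) (b : tm D s) :
  H ⊢ eqt (tsub f (lam a) $ b) (tsub (scons b f) a).
Proof.
  induction a as [t x| | | | | |t u a1 IH1 a2 IH2]; cbn [lam tsub];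
    try (apply d_ax, base; constructor).
  - revert t x. apply var_case.
    + eapply eqt_trans; [apply d_ax, base; constructor|].
      apply d_ax, base. constructor.
    + intros t y. apply d_ax, base. constructor.
  - eapply eqt_trans; [apply d_ax, base; constructor|].
    apply eqt_congr; assumption.
Qed.

Lemma beta0 G (H : list (form G)) s t (a : tm (s :: G) t) (b : tm G s) :
  H ⊢ eqt (lam a $ b) (tsub (scons b (fun _ x => Var x)) a).
Proof. rewrite <- (tsub_id (lam a)). apply beta. Qed.

Lemma beta_up G s (H : list (form (s :: G))) t (a : tm (s :: G) t) :
  H ⊢ eqt (up (lam a) $ v0) a.
Proof.
  rewrite <- (tsub_id a) at 2.
  replace (fun _ x => Var x) with (scons v0 wk : subst (s :: G) (s :: G));
    [apply beta|]. apply subst_ext; reflexivity.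
Qed.

Lemma iff_refl G (H : list (form G)) A : H ⊢ Iff A A.
Proof. apply d_andI; apply d_impI, hyp0. Qed.

Lemma iff_sym G (H : list (form G)) A B : H ⊢ Iff A B -> H ⊢ Iff B A.
Proof. intros D. apply d_andI; [eapply d_andE2|eapply d_andE1]; exact D. Qed.

Lemma iff_l G (H : list (form G)) A B : H ⊢ Iff A B -> H ⊢ A -> H ⊢ B.
Proof. intros D. apply d_impE. eapply d_andE1, D. Qed.

Lemma iff_r G (H : list (form G)) A B : H ⊢ Iff A B -> H ⊢ B -> H ⊢ A.
Proof. intros D. apply d_impE. eapply d_andE2, D. Qed.

Lemma iff_intro G (H : list (form G)) A B : A :: H ⊢ B -> B :: H ⊢ A -> H ⊢ Iff A B.
Proof. intros D1 D2. apply d_andI; apply d_impI; assumption. Qed.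

Lemma iff_trans G (H : list (form G)) A B C :
  H ⊢ Iff A B -> H ⊢ Iff B C -> H ⊢ Iff A C.
Proof.
  intros D1 D2. apply iff_intro.
  - apply (iff_l (wk1 D2)), (iff_l (wk1 D1)), hyp0.
  - apply (iff_r (wk1 D1)), (iff_r (wk1 D2)), hyp0.
Qed.

Lemma iff_imp G (H : list (form G)) A A' B B' :
  H ⊢ Iff A A' -> H ⊢ Iff B B' -> H ⊢ Iff (A ⊃ B) (A' ⊃ B').
Proof.
  intros D1 D2. apply iff_intro; apply d_impI.
  - apply (iff_l (wk1 (wk1 D2))). eapply d_impE; [apply wk1, hyp0|].
    apply (iff_r (wk1 (wk1 D1))), hyp0.
  - apply (iff_r (wk1 (wk1 D2))). eapply d_impE; [apply wk1, hyp0|].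
    apply (iff_l (wk1 (wk1 D1))), hyp0.
Qed.

Lemma iff_and G (H : list (form G)) A A' B B' :
  H ⊢ Iff A A' -> H ⊢ Iff B B' -> H ⊢ Iff (A ∧ B) (A' ∧ B').
Proof.
  assert (K : forall A A' B B', H ⊢ Iff A A' -> H ⊢ Iff B B' -> (A ∧ B) :: H ⊢ A' ∧ B').
  { intros C C' D D' D1 D2. apply d_andI.
    - apply (iff_l (wk1 D1)). eapply d_andE1, hyp0.
    - apply (iff_l (wk1 D2)). eapply d_andE2, hyp0. }
  intros D1 D2. apply iff_intro; apply K; auto using iff_sym.
Qed.

Lemma iff_ex G (H : list (form G)) s (A B : form (s :: G)) :
  map (fup (s := s)) H ⊢ Iff A B -> H ⊢ Iff (Ex s A) (Ex s B).
Proof.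
  assert (K : forall A B : form (s :: G),
             map (fup (s := s)) H ⊢ Iff A B -> Ex s A :: H ⊢ Ex s B).
  { intros A1 B1 D. eapply d_exE; [apply hyp0|]. apply ex_here.
    cbn [map]. eapply iff_l; [|apply hyp0]. apply wk1, wk1, D. }
  intros D. apply iff_intro; apply K; auto using iff_sym.
Qed.

Lemma iff_all G (H : list (form G)) s (A B : form (s :: G)) :
  map (fup (s := s)) H ⊢ Iff A B -> H ⊢ Iff (All s A) (All s B).
Proof.
  assert (K : forall A B : form (s :: G),
             map (fup (s := s)) H ⊢ Iff A B -> All s A :: H ⊢ All s B).
  { intros A1 B1 D. apply d_allI. cbn [map]. eapply iff_l; [apply wk1, D|].
    change (fup (All s A1) :: map (fup (s := s)) H) with (map (fup (s := s)) (All s A1 :: H)).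
    apply all_here. left; reflexivity. }
  intros D. apply iff_intro; apply K; auto using iff_sym.
Qed.

Lemma iff_eq G (H : list (form G)) (a a' b b' : tm G T0) :
  H ⊢ a == a' -> H ⊢ b == b' -> H ⊢ Iff (a == b) (a' == b').
Proof.
  intros D1 D2. apply iff_intro.
  - apply (eqt_trans (s := T0) (b := a)).
    + apply wk1, (eqt_sym (s := T0)), D1.
    + apply (eqt_trans (s := T0) (b := b)); [apply hyp0|apply wk1, D2].
  - apply (eqt_trans (s := T0) (b := a')).
    + apply wk1, D1.
    + apply (eqt_trans (s := T0) (b := b')); [apply hyp0|].
      apply wk1, (eqt_sym (s := T0)), D2.
Qed.

(** With this and the next two equivalences, [dec] has to treat only equations, falsity, implication
    and [Ex]. *)
Lemma iff_and_not_imp G (H : list (form G)) A B : H ⊢ Iff (A ∧ B) (Not (A ⊃ Not B)).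
Proof.
  apply iff_intro.
  - apply d_impI. eapply d_impE; [eapply d_impE; [apply hyp0|]|]; apply wk1.
    + eapply d_andE1, hyp0.
    + eapply d_andE2, hyp0.
  - apply d_andI; apply d_raa; (eapply d_impE; [apply wk1, hyp0|]); apply d_impI.
    + apply bot_elim. eapply d_impE; [apply wk1, hyp0|apply hyp0].
    + apply wk1, hyp0.
Qed.

Lemma iff_or_not_imp G (H : list (form G)) A B : H ⊢ Iff (Or A B) (Not A ⊃ B).
Proof.
  apply iff_intro.
  - apply d_impI. eapply d_orE; [apply wk1, hyp0| |apply hyp0].
    apply bot_elim. eapply d_impE; [apply wk1, hyp0|apply hyp0].
  - eapply d_orE; [apply (excluded_middle _ A)| |].
    + apply d_orI1, hyp0.
    + apply d_orI2. eapply d_impE; [apply wk1, hyp0|apply hyp0].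
Qed.

Lemma iff_all_not_ex G (H : list (form G)) s (A : form (s :: G)) :
  H ⊢ Iff (All s A) (Not (Ex s (Not A))).
Proof.
  apply iff_intro.
  - apply d_impI. eapply d_exE; [apply hyp0|]. cbn [map].
    eapply d_impE; [apply hyp0|]. apply wk1.
    change (fup (Ex s (Not A)) :: fup (All s A) :: map (fup (s := s)) H)
      with (map (fup (s := s)) (Ex s (Not A) :: All s A :: H)).
    apply all_here. right; left; reflexivity.
  - apply d_allI, d_raa. cbn [map]. eapply d_impE; [apply wk1, hyp0|].
    apply ex_here, hyp0.
Qed.

Lemma quantifier_free_fsub G (A : form G) : forall D (f : subst G D),
  quantifier_free (fsub A f) = quantifier_free A.
Proof. induction A; intros; cbn; rewrite ?IHA1, ?IHA2; reflexivity. Qed.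

(** [QF_AC10] applied to [(Q /\ n = 0) \/ (~ Q /\ n = 1)]. *)
Lemma qf_comprehension G (H : list (form G)) (Q : form (T1 :: G)) :
  quantifier_free Q = true ->
  H ⊢ Ex T2 (All T1 (Iff (v1 $ v0 == Zero)
                         (fsub Q (scons v0 (fun _ x => Var (VS (VS x))))))).
Proof.
  intros QF.
  pose (A := Or (fup Q ∧ v0 == Zero) (Not (fup Q) ∧ v0 == one) : form (T0 :: T1 :: G)).
  assert (QA : quantifier_free A = true).
  { cbn. unfold fup. rewrite quantifier_free_fsub, QF. reflexivity. }
  eapply d_exE.
  - eapply d_impE; [apply d_ax, base, (ax_QF_AC10 QA)|].
    apply d_allI. eapply d_orE; [apply (excluded_middle _ Q)| |].
    + apply (d_exI (a := Zero)). apply d_orI1, d_andI.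
      * change (Q :: map (fup (s := T1)) H ⊢ inst (fup Q) Zero).
        rewrite inst_fup. apply hyp0.
      * apply (eqt_refl (s := T0)).
    + apply (d_exI (a := one)). apply d_orI2, d_andI.
      * change (Not Q :: map (fup (s := T1)) H ⊢ Not (inst (fup Q) one)).
        rewrite inst_fup. apply hyp0.
      * apply (eqt_refl (s := T0)).
  - apply ex_here, d_allI. cbn [map].
    set (B := fsub A _).
    apply cut with B.
    { change (fup (All T1 B) :: map (fup (s := T1)) (map (fup (s := T2)) H))
        with (map (fup (s := T1)) (All T1 B :: map (fup (s := T2)) H)).
      apply all_here. left; reflexivity. }
    set (Q' := fsub Q _).
    assert (EB : B = Or (Q' ∧ v1 $ v0 == Zero) (Not Q' ∧ v1 $ v0 == one)).
    { unfold B, A. cbn [fsub tsub]. unfold fup, Not. cbn [fsub]. rewrite !fsub_comp.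
      replace (fsub Q _) with Q' by (unfold Q'; f_equal; apply subst_ext; reflexivity).
      reflexivity. }
    rewrite EB.
    eapply d_orE; [apply hyp0| |]; apply iff_intro.
    + eapply d_andE1, wk1, hyp0.
    + eapply d_andE2, wk1, hyp0.
    + apply bot_elim. eapply d_impE; [apply d_ax, base, (ax_succ_zero Zero)|].
      apply (eqt_trans (s := T0) (b := v1 $ v0)); [|apply hyp0].
      apply (eqt_sym (s := T0)). eapply d_andE2, wk1, hyp0.
    + apply bot_elim. eapply d_impE; [eapply d_andE1, wk1, hyp0|apply hyp0].
Qed.
End Derivations.

(** * Deciding formulas with number and function quantifiers *)

Section DecisionTerms.
Variables (T : theory) (base : forall G (A : form G), RCA0w A -> @T G A).

Local Notation "H ⊢ A" := (derives T H A) (at level 95, no associativity).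

(** Comprehension from [QF_AC10] yields functionals of type 2, so two numbers are passed to them as
    the values of one function at 0 and 1. Deciding equality and implication by such functionals,
    and not by arithmetic terms, avoids deriving arithmetic laws inside the calculus. *)
Definition pair01 G (a b : tm G T0) : tm G T1 :=
  lam (Rec $ v0 $ up a $ (Pi $ (Pi $ up b))).

Lemma pair01_zero G (H : list (form G)) (a b : tm G T0) : H ⊢ pair01 a b $ Zero == a.
Proof.
  eapply (eqt_trans base (s := T0)); [apply (beta0 base _ (t := T0))|].
  cbn [tsub scons]. rewrite !tsub_scons_up. apply d_ax, base. constructor.
Qed.

Lemma pair01_one G (H : list (form G)) (a b : tm G T0) : H ⊢ pair01 a b $ one == b.
Proof.
  eapply (eqt_trans base (s := T0)); [apply (beta0 base _ (t := T0))|].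
  cbn [tsub scons]. rewrite !tsub_scons_up.
  eapply (eqt_trans base (s := T0)); [apply d_ax, base, ax_Rec_succ|].
  eapply (eqt_trans base (s := T0)).
  - apply (eqt_app (s := T0) (t := T0)).
    apply d_ax, base, (ax_Pi (s := Arr T0 T0) (t := T0)).
  - apply d_ax, base, (ax_Pi (s := T0) (t := T0)).
Qed.

Definition eq_spec G (Q : tm G T2) : form G :=
  All T1 (Iff (up Q $ v0 == Zero) (v0 $ Zero == v0 $ one)).
Definition imp_spec G (I : tm G T2) : form G :=
  All T1 (Iff (up I $ v0 == Zero) (v0 $ Zero == Zero ⊃ v0 $ one == Zero)).
Definition ex_spec G (E : tm G T3) : form G :=
  All T2 (Iff (Ex T1 (v1 $ v0 == Zero)) (up E $ v0 == Zero)).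

(** The three functionals arise from existential eliminations. Their specifications are therefore
    hypotheses, which [specs_up] carries under each quantifier. *)
Definition specs G (H : list (form G)) (E : tm G T3) (I Q : tm G T2) : Prop :=
  In (ex_spec E) H /\ In (imp_spec I) H /\ In (eq_spec Q) H.

Lemma specs_up G (H : list (form G)) E I Q s :
  specs H E I Q -> specs (map (fup (s := s)) H) (up E) (up I) (up Q).
Proof.
  intros (h1 & h2 & h3).
  apply (in_map (fup (s := s))) in h1, h2, h3.
  revert h1 h2 h3. unfold ex_spec, imp_spec, eq_spec, fup, Iff. cbn [fsub tsub].
  unfold specs, ex_spec, imp_spec, eq_spec, fup, Iff.
  rewrite <- !up_tsub. auto.
Qed.

Definition imp01 G (I : tm G T2) (a b : tm G T0) : tm G T0 := I $ pair01 a b.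
Definition not01 G (I : tm G T2) (a : tm G T0) : tm G T0 := imp01 I a one.
(** A number [n] is represented by the functions [f] with [f 0 = n]. *)
Definition ex01 G (E : tm G T3) (s : ty) : tm (s :: G) T0 -> tm G T0 :=
  match s with
  | T0 => fun a => E $ lam (up (lam a) $ (v0 $ Zero))
  | T1 => fun a => E $ lam a
  | _ => fun _ => Zero
  end.

Fixpoint dec G (A : form G) : tm G T3 -> tm G T2 -> tm G T2 -> tm G T0 :=
  match A with
  | Eq a b => fun E I Q => Q $ pair01 a b
  | Bot => fun E I Q => one
  | And A B => fun E I Q => not01 I (imp01 I (dec A E I Q) (not01 I (dec B E I Q)))
  | Or A B => fun E I Q => imp01 I (not01 I (dec A E I Q)) (dec B E I Q)
  | Imp A B => fun E I Q => imp01 I (dec A E I Q) (dec B E I Q)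
  | Ex s A => fun E I Q => ex01 E (dec A (up E) (up I) (up Q))
  | All s A => fun E I Q =>
      not01 I (ex01 E (not01 (up I) (dec A (up E) (up I) (up Q))))
  end.

Definition low (s : ty) : bool := match s with T0 | T1 => true | _ => false end.

Fixpoint low_quantifiers G (A : form G) : bool :=
  match A with
  | Eq _ _ | Bot => true
  | And A B | Or A B | Imp A B => andb (low_quantifiers A) (low_quantifiers B)
  | All s A | Ex s A => andb (low s) (low_quantifiers A)
  end.

Lemma one_neq_zero G (H : list (form G)) : H ⊢ Iff (one == Zero) Bot.
Proof.
  apply iff_intro; [|apply bot_elim, hyp0].
  eapply d_impE; [apply d_ax, base, (ax_succ_zero Zero)|apply hyp0].
Qed.

Lemma iff_imp01 G (H : list (form G)) E I Q a b :
  specs H E I Q -> H ⊢ Iff (imp01 I a b == Zero) (a == Zero ⊃ b == Zero).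
Proof.
  intros (_ & h & _). apply d_hyp with (T := T) in h.
  apply d_allE with (a := pair01 a b) in h. unfold inst in h. cbn [fsub tsub] in h.
  eapply iff_trans; [|apply iff_imp; apply (iff_eq base)].
  - unfold Iff in h. cbn [fsub tsub] in h. rewrite tsub_scons_up in h. exact h.
  - apply pair01_zero.
  - apply (eqt_refl base (s := T0)).
  - apply pair01_one.
  - apply (eqt_refl base (s := T0)).
Qed.

Lemma iff_not01 G (H : list (form G)) E I Q a :
  specs H E I Q -> H ⊢ Iff (not01 I a == Zero) (Not (a == Zero)).
Proof.
  intros h. eapply iff_trans; [eapply iff_imp01, h|].
  apply iff_imp; [apply iff_refl|apply one_neq_zero].
Qed.

Lemma iff_eq01 G (H : list (form G)) E I Q a b :
  specs H E I Q -> H ⊢ Iff (Q $ pair01 a b == Zero) (a == b).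
Proof.
  intros (_ & _ & h). apply d_hyp with (T := T) in h.
  apply d_allE with (a := pair01 a b) in h. unfold inst in h. cbn [fsub tsub] in h.
  eapply iff_trans; [|apply (iff_eq base)].
  - unfold Iff in h. cbn [fsub tsub] in h. rewrite tsub_scons_up in h. exact h.
  - apply pair01_zero.
  - apply pair01_one.
Qed.

Lemma ex_spec_at G (H : list (form G)) E I Q (F : tm G T2) :
  specs H E I Q -> H ⊢ Iff (Ex T1 (up F $ v0 == Zero)) (E $ F == Zero).
Proof.
  intros (h & _ & _). apply d_hyp with (T := T) in h.
  apply d_allE with (a := F) in h. unfold inst in h. cbn [fsub tsub] in h.
  unfold Iff in h. cbn [fsub tsub] in h. rewrite tsub_scons_up in h. exact h.
Qed.

Lemma iff_ex01 G (H : list (form G)) E I Q s (a : tm (s :: G) T0) :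
  specs H E I Q -> low s = true -> H ⊢ Iff (Ex s (a == Zero)) (ex01 E a == Zero).
Proof.
  intros h. destruct s as [|[|] [|]]; try discriminate; intros _; cbn [ex01].
  - eapply iff_trans; [|eapply ex_spec_at, h].
    apply iff_intro.
    + apply d_exE with (A := a == Zero); [apply hyp0|].
      change (fup ?A) with (fsub A (wk (s := T0))). cbn [fsub map tsub].
      rewrite <- up_tsub. apply (d_exI (a := Pi $ v0)).
      unfold inst. cbn [fsub tsub scons].
      rewrite !tsub_scons_up.
      eapply (eqt_trans base (s := T0)).
      * eapply (eqt_trans base (s := T0)); [apply (beta base _ (t := T0))|].
        cbn [tsub scons]. rewrite tsub_up. cbn [scons].
        apply (eqt_congr base (s := T0) (t := T0)); [apply (eqt_refl base)|].
        apply d_ax, base, (ax_Pi (s := T0) (t := T0)).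
      * eapply (eqt_trans base (s := T0)); [apply (beta_up base _ (t := T0))|apply hyp0].
    + apply d_exE with (A := up (lam (up (lam a) $ (v0 $ Zero))) $ v0 == Zero); [apply hyp0|].
      change (fup ?A) with (fsub A (wk (s := T1))). cbn [fsub map].
      apply (d_exI (a := v0 $ Zero)).
      unfold inst. cbn [fsub tsub scons]. rewrite tsub_comp.
      eapply (eqt_trans base (s := T0)); [|apply hyp0].
      apply (eqt_sym base (s := T0)).
      eapply (eqt_trans base (s := T0)); [apply (beta_up base _ (t := T0))|].
      eapply (eqt_trans base (s := T0)); [apply (beta base _ (t := T0))|].
      match goal with |- _ ⊢ eqt (tsub ?f a) (tsub ?g a) =>
        replace g with f; [apply (eqt_refl base (s := T0))|]
      end.
      apply subst_ext; reflexivity.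
  - eapply iff_trans; [|eapply ex_spec_at, h].
    apply iff_ex. apply (iff_eq base); [|apply (eqt_refl base (s := T0))].
    apply (eqt_sym base (s := T0)), (beta_up base _ (t := T0)).
Qed.

Lemma iff_dec G (A : form G) : forall H E I Q,
  low_quantifiers A = true -> specs H E I Q -> H ⊢ Iff A (dec A E I Q == Zero).
Proof.
  induction A as [G a b|G|G A IHA B IHB|G A IHA B IHB|G A IHA B IHB|G s A IHA|G s A IHA];
    intros H E I Q L h; cbn [dec low_quantifiers] in *;
    try (apply andb_prop in L; destruct L as [L1 L2]).
  - apply iff_sym. eapply iff_eq01, h.
  - apply iff_sym, one_neq_zero.
  - eapply iff_trans; [apply iff_and_not_imp|].
    apply iff_sym. eapply iff_trans; [eapply iff_not01, h|].
    apply iff_imp; [|apply iff_refl].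
    eapply iff_trans; [eapply iff_imp01, h|].
    apply iff_imp; [apply iff_sym; auto|].
    eapply iff_trans; [eapply iff_not01, h|].
    apply iff_imp; [apply iff_sym; auto|apply iff_refl].
  - eapply iff_trans; [apply iff_or_not_imp|].
    apply iff_sym. eapply iff_trans; [eapply iff_imp01, h|].
    apply iff_imp; [|apply iff_sym; auto].
    eapply iff_trans; [eapply iff_not01, h|].
    apply iff_imp; [apply iff_sym; auto|apply iff_refl].
  - apply iff_sym. eapply iff_trans; [eapply iff_imp01, h|].
    apply iff_imp; apply iff_sym; auto.
  - eapply iff_trans; [apply iff_all_not_ex|].
    apply iff_sym. eapply iff_trans; [eapply iff_not01, h|].
    apply iff_imp; [|apply iff_refl].
    apply iff_sym. eapply iff_trans; [|eapply iff_ex01; eassumption].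
    apply iff_ex. pose proof (specs_up s h) as h'.
    apply iff_sym. eapply iff_trans; [eapply iff_not01, h'|].
    apply iff_imp; [apply iff_sym; auto|apply iff_refl].
  - eapply iff_trans; [|eapply iff_ex01; eassumption].
    apply iff_ex, IHA; [assumption|]. apply specs_up, h.
Qed.
End DecisionTerms.

(** * Choice of numbers for formulas with number and function quantifiers *)

Section NumberChoice.
Variables (T : theory) (base : forall G (A : form G), RCA0w A -> @T G A).

Local Notation "H ⊢ A" := (derives T H A) (at level 95, no associativity).

Lemma inst_fsub_lift G D s (A : form (s :: G)) (f : subst G D) (a : tm D s) :
  inst (fsub A (lift f (s := s))) a = fsub A (scons a f).
Proof.
  unfold inst. rewrite fsub_comp. f_equal. apply subst_ext; [reflexivity|].
  intros t y. cbn [lift scons]. apply tsub_scons_up.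
Qed.

Lemma allE_fsub G D (H : list (form D)) s (A : form (s :: G)) (f : subst G D) (a : tm D s) :
  H ⊢ fsub (All s A) f -> H ⊢ fsub A (scons a f).
Proof. intros h. rewrite <- inst_fsub_lift. apply d_allE, h. Qed.

(** [iff_dec] turns [A] into an equation. [QF_AC10] chooses a number for a function, so the given
    number is read as the value at 0 of a function; the resulting functional is finally applied to
    constant functions. *)
Lemma number_choice G (H : list (form G)) E I Q (A : form (T0 :: T0 :: G)) :
  low_quantifiers A = true -> specs H E I Q ->
  H ⊢ All T0 (Ex T0 A) ⊃
      Ex T1 (All T0 (fsub A (scons (v1 $ v0)
                            (scons v0 (fun _ x => Var (VS (VS x))))))).
Proof.
  intros L h.
  set (t := dec A (up (up E)) (up (up I)) (up (up Q))).
  pose (Z := All T0 (All T0 (Iff A (t == Zero)))).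
  apply cut with Z.
  { apply d_allI, d_allI, (iff_dec base L), specs_up, specs_up, h. }
  apply d_impI.
  pose (B := fsub (t == Zero)
               (scons v0 (scons (v1 $ Zero) (fun _ x => Var (VS (VS x)))))
             : form (T0 :: T1 :: G)).
  assert (QB : quantifier_free B = true) by reflexivity.
  eapply d_exE.
  - eapply d_impE; [apply d_ax, base, (ax_QF_AC10 QB)|].
    apply d_allI. cbn [map].
    eapply iff_l.
    2:{ apply (allE_fsub (f := wk) (A := Ex T0 A) (v0 $ Zero)), hyp0. }
    cbn [fsub]. apply iff_ex. unfold B. cbn [map].
    match goal with |- _ ⊢ Iff (fsub A ?f) _ =>
      replace f with (scons v0 (scons (v1 $ Zero)
                        (fun s (x : var G s) => @Var (T0 :: T1 :: G) _ (VS (VS x)))))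
    end.
    2:{ apply subst_ext; [reflexivity|]. intros s y. revert s y.
        apply var_case; reflexivity. }
    apply (allE_fsub (A := Iff A (t == Zero))), (allE_fsub (A := All T0 (Iff A (t == Zero)))).
    apply wk1. unfold fup. rewrite fsub_comp. apply hyp0.
  - match goal with |- _ ⊢ fup (Ex T1 ?X) =>
      change (fup (Ex T1 X)) with (Ex T1 (fsub X (lift (wk (s := T2)) (s := T1))))
    end.
    apply (d_exI (a := lam (v1 $ (Pi $ v0)))). rewrite inst_fsub_lift.
    apply d_allI. rewrite fsub_comp. cbn [map].
    match goal with |- _ ⊢ fsub A ?f =>
      replace f with (scons (up (lam (v1 $ (Pi $ v0))) $ v0) (scons v0
                        (fun s (x : var G s) => @Var (T0 :: T2 :: G) _ (VS (VS x)))))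
    end.
    2:{ apply subst_ext; [reflexivity|]. intros s y. revert s y.
        apply var_case; reflexivity. }
    eapply iff_r.
    { apply (allE_fsub (A := Iff A (t == Zero))), (allE_fsub (A := All T0 (Iff A (t == Zero)))).
      do 2 apply wk1. unfold fup. rewrite fsub_comp. apply hyp0. }
    match goal with |- ?K ⊢ _ => set (K0 := K) end.
    assert (C : K0 ⊢ fsub (fsub B
      (scons (v1 $ v0) (scons v0 (fun s x => Var (VS (VS x)))))) (scons (Pi $ v0) wk)).
    { apply (allE_fsub (A := fsub B _)). apply hyp0. }
    unfold B in C. rewrite !fsub_comp in C. cbn [fsub tsub] in C |- *.
    eapply (eqt_trans base (s := T0)); [|exact C].
    apply tsub_congr; [exact base|]. intros s x. revert s x.
    apply var_case; [|apply var_case].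
    + apply (beta_up base _ (t := T0)).
    + apply (eqt_sym base (s := T0)).
      apply d_ax, base, (ax_Pi (s := T0) (t := T0)).
    + intros s y. apply (eqt_refl base).
Qed.

Lemma lam_tsub G D (H : list (form D)) (f : subst G D) s t (a : tm (s :: G) t) :
  H ⊢ eqt (tsub f (lam a)) (lam (tsub (lift f (s := s)) a)).
Proof.
  cbn [eqt]. apply d_allI.
  eapply (eqt_trans base); [|apply (eqt_sym base), (beta_up base)].
  unfold up. rewrite tsub_comp. eapply (eqt_trans base); [apply (beta base)|].
  match goal with |- _ ⊢ eqt (tsub ?f _) (tsub ?g _) => replace g with f end.
  - apply (eqt_refl base).
  - apply subst_ext; reflexivity.
Qed.

Lemma lam_congr G (H : list (form G)) s t (a b : tm (s :: G) t) :
  map (fup (s := s)) H ⊢ eqt a b -> H ⊢ eqt (lam a) (lam b).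
Proof.
  intros h. cbn [eqt]. apply d_allI.
  eapply (eqt_trans base); [apply (beta_up base)|].
  eapply (eqt_trans base); [exact h|]. apply (eqt_sym base), (beta_up base).
Qed.

Lemma rec_congr G (H : list (form G)) (n n' y y' : tm G T0) b b' :
  H ⊢ n == n' -> H ⊢ y == y' ->
  map (fup (s := T0)) (map (fup (s := T0)) H) ⊢ b == b' ->
  H ⊢ rec n y b == rec n' y' b'.
Proof.
  intros h1 h2 h3. unfold rec.
  repeat apply (eqt_congr base (t := T0)) || apply (eqt_congr base (t := Arr _ _));
    try apply (eqt_refl base); try assumption.
  apply lam_congr, lam_congr, h3.
Qed.
End NumberChoice.

(** * Stability of the coded notions under substitution *)

Section Substitution.
Variables (T : theory) (base : forall G (A : form G), RCA0w A -> @T G A).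

Local Notation "H ⊢ A" := (derives T H A) (at level 95, no associativity).

(** [lam] commutes with a substitution only up to provable equality, e.g.
    [lam (Var (VS x))] is [Pi $ Var x], while
    [lam (up (a $ b))] is [Sigma $ lam (up a) $ lam (up b)]. *)
Definition stable1 (op : forall G, tm G T0 -> tm G T0) : Prop :=
  forall G D (H : list (form D)) (f : subst G D) a,
    H ⊢ tsub f (op G a) == op D (tsub f a).
Definition stable2 (op : forall G, tm G T0 -> tm G T0 -> tm G T0) : Prop :=
  forall G D (H : list (form D)) (f : subst G D) a b,
    H ⊢ tsub f (op G a b) == op D (tsub f a) (tsub f b).

(** Up to provable equality, a stable operation is a substitution instance of the one term [op v0],
    so its congruence is inherited from that of substitution. *)
Lemma stable1_congr op G (H : list (form G)) a a' :
  stable1 op -> H ⊢ a == a' -> H ⊢ op G a == op G a'.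
Proof.
  intros S h.
  assert (E : forall c, H ⊢ tsub (scons c (fun _ x => Var x)) (op _ v0) == op G c).
  { intros c. apply (S _ _ H (scons c (fun _ x => Var x)) v0). }
  eapply (eqt_trans base (s := T0)); [apply (eqt_sym base (s := T0)), E|].
  eapply (eqt_trans base (s := T0)); [|apply E].
  apply (tsub_congr base). intros s x. revert s x.
  apply var_case; [exact h|]. intros; apply (eqt_refl base).
Qed.

Lemma stable2_congr op G (H : list (form G)) a a' b b' :
  stable2 op -> H ⊢ a == a' -> H ⊢ b == b' -> H ⊢ op G a b == op G a' b'.
Proof.
  intros S h1 h2.
  assert (E : forall c d,
    H ⊢ tsub (scons c (scons d (fun _ x => Var x))) (op _ v0 v1) == op G c d).
  { intros c d. apply (S _ _ H (scons c (scons d (fun _ x => Var x))) v0 v1). }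
  eapply (eqt_trans base (s := T0)); [apply (eqt_sym base (s := T0)), E|].
  eapply (eqt_trans base (s := T0)); [|apply E].
  apply (tsub_congr base). intros s x. revert s x.
  apply var_case; [exact h1|]. apply var_case; [exact h2|].
  intros; apply (eqt_refl base).
Qed.

Lemma rec_tsub G D (H : list (form D)) (f : subst G D) n y b b' :
  map (fup (s := T0)) (map (fup (s := T0)) H)
    ⊢ tsub (lift (lift f (s := T0)) (s := T0)) b == b' ->
  H ⊢ tsub f (rec n y b) == rec (tsub f n) (tsub f y) b'.
Proof.
  intros h. eapply (eqt_trans base (s := T0)).
  2:{ apply (rec_congr base); [apply (eqt_refl base (s := T0))..|exact h]. }
  unfold rec. cbn [tsub].
  apply (eqt_congr base (s := T0 --> T0 --> T0) (t := T0)); [apply (eqt_refl base)|].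
  eapply (eqt_trans base); [apply (lam_tsub base)|]. apply (lam_congr base), (lam_tsub base).
Qed.

Lemma tsub_lift2_up2 G D (f : subst G D) s t r (a : tm G r) :
  tsub (lift (lift f (s := s)) (s := t)) (up (up a)) = up (up (tsub f a)).
Proof. rewrite !up_tsub. reflexivity. Qed.

Local Ltac refl := apply (eqt_refl base (s := T0)).
Local Ltac st h := eapply (eqt_trans base (s := T0)); [apply h|].

Lemma addN_stable : stable2 addN.
Proof. intros G D H f a b. apply rec_tsub. refl. Qed.

Lemma predN_stable : stable1 predN.
Proof. intros G D H f a. apply rec_tsub. refl. Qed.

Lemma mulN_stable : stable2 mulN.
Proof.
  intros G D H f a b. apply rec_tsub. st addN_stable.
  rewrite tsub_lift2_up2. refl.
Qed.

Lemma monus_stable : stable2 monus.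
Proof. intros G D H f a b. apply rec_tsub. st predN_stable. refl. Qed.

Lemma pow2_stable : stable1 pow2.
Proof. intros G D H f a. apply rec_tsub. st addN_stable. refl. Qed.

Lemma tri_stable : stable1 tri.
Proof. intros G D H f a. apply rec_tsub. st addN_stable. refl. Qed.

Lemma troot_stable : stable1 troot.
Proof.
  intros G D H f a. apply rec_tsub. st addN_stable.
  apply (stable2_congr addN_stable); [refl|]. st monus_stable.
  apply (stable2_congr monus_stable); [refl|]. st monus_stable.
  apply (stable2_congr monus_stable); [|refl]. st tri_stable. refl.
Qed.

Lemma sndN_stable : stable1 sndN.
Proof.
  intros G D H f a. st monus_stable.
  apply (stable2_congr monus_stable); [refl|]. st tri_stable.
  apply (stable1_congr tri_stable). st troot_stable. refl.
Qed.

Lemma fstN_stable : stable1 fstN.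
Proof.
  intros G D H f a. st monus_stable.
  apply (stable2_congr monus_stable); [st troot_stable|st sndN_stable]; refl.
Qed.

Lemma pairN_stable : stable2 pairN.
Proof.
  intros G D H f a b. st addN_stable.
  apply (stable2_congr addN_stable); [|refl]. st tri_stable.
  apply (stable1_congr tri_stable). st addN_stable. refl.
Qed.

Lemma posQ_stable : stable1 posQ.
Proof.
  intros G D H f a. st fstN_stable.
  apply (stable1_congr fstN_stable). st fstN_stable. refl.
Qed.

Lemma negpartQ_stable : stable1 negpartQ.
Proof.
  intros G D H f a. st sndN_stable.
  apply (stable1_congr sndN_stable). st fstN_stable. refl.
Qed.

Lemma denQ_stable : stable1 denQ.
Proof.
  intros G D H f a. apply (eqt_congr base (s := T0) (t := T0)).
  - apply (eqt_refl base).
  - st sndN_stable. refl.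
Qed.

Local Ltac step :=
  match goal with
  | |- _ ⊢ tsub _ (addN _ _) == _ => st addN_stable; apply (stable2_congr addN_stable)
  | |- _ ⊢ tsub _ (mulN _ _) == _ => st mulN_stable; apply (stable2_congr mulN_stable)
  | |- _ ⊢ tsub _ (monus _ _) == _ => st monus_stable; apply (stable2_congr monus_stable)
  | |- _ ⊢ tsub _ (pairN _ _) == _ => st pairN_stable; apply (stable2_congr pairN_stable)
  | |- _ ⊢ tsub _ (predN _) == _ => st predN_stable; apply (stable1_congr predN_stable)
  | |- _ ⊢ tsub _ (pow2 _) == _ => st pow2_stable; apply (stable1_congr pow2_stable)
  | |- _ ⊢ tsub _ (sndN _) == _ => st sndN_stable; apply (stable1_congr sndN_stable)
  | |- _ ⊢ tsub _ (posQ _) == _ => st posQ_stable; apply (stable1_congr posQ_stable)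
  | |- _ ⊢ tsub _ (negpartQ _) == _ =>
      st negpartQ_stable; apply (stable1_congr negpartQ_stable)
  | |- _ ⊢ tsub _ (denQ _) == _ => st denQ_stable; apply (stable1_congr denQ_stable)
  | |- _ => refl
  end.

Lemma natQ_stable : stable1 natQ.
Proof. intros G D H f a. unfold natQ. repeat step. Qed.

Lemma dyadicQ_stable : stable2 dyadicQ.
Proof. intros G D H f a b. unfold dyadicQ. repeat step. Qed.

Lemma oppQ_stable : stable1 oppQ.
Proof. intros G D H f a. unfold oppQ. repeat step. Qed.

Lemma addQ_stable : stable2 addQ.
Proof. intros G D H f a b. unfold addQ. repeat step. Qed.

Lemma subQ_stable : stable2 subQ.
Proof.
  intros G D H f a b. st addQ_stable.
  apply (stable2_congr addQ_stable); [refl|]. st oppQ_stable. refl.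
Qed.

Lemma absQ_stable : stable1 absQ.
Proof. intros G D H f a. unfold absQ. repeat step. Qed.

Lemma ltQ_fsub G D (H : list (form D)) (f : subst G D) a b a' b' :
  H ⊢ tsub f a == a' -> H ⊢ tsub f b == b' -> H ⊢ Iff (fsub (ltQ a b) f) (ltQ a' b').
Proof.
  intros h1 h2.
  pose (lhs := fun G (p q : tm G T0) =>
    Succ $ addN (mulN (posQ p) (denQ q)) (mulN (negpartQ q) (denQ p))).
  pose (rhs := fun G (p q : tm G T0) =>
    addN (mulN (posQ q) (denQ p)) (mulN (negpartQ p) (denQ q))).
  assert (L : stable2 lhs).
  { intros K K' H' g p q. unfold lhs. cbn [tsub].
    apply (eqt_congr base (s := T0) (t := T0)).
    - apply (eqt_refl base).
    - cbn [eqt]. repeat step. }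
  assert (R : stable2 rhs) by (intros K K' H' g p q; unfold rhs; repeat step).
  change (H ⊢ Iff (tsub f (monus (lhs _ a b) (rhs _ a b)) == Zero)
                  (monus (lhs _ a' b') (rhs _ a' b') == Zero)).
  apply (iff_eq base); [|refl]. st monus_stable.
  apply (stable2_congr monus_stable); [st L; apply (stable2_congr L)|st R; apply (stable2_congr R)];
    assumption.
Qed.

Lemma isReal_fsub G D (H : list (form D)) (f : subst G D) x :
  H ⊢ Iff (fsub (isReal x) f) (isReal (tsub f x)).
Proof.
  apply iff_all, iff_all, ltQ_fsub; rewrite <- ?tsub_lift2_up2.
  - st absQ_stable. apply (stable1_congr absQ_stable). st subQ_stable.
    apply (stable2_congr subQ_stable); [refl|].
    apply (eqt_congr base (s := T0) (t := T0)); [apply (eqt_refl base)|].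
    st addN_stable. refl.
  - st dyadicQ_stable. refl.
Qed.

Lemma ltR_fsub G D (H : list (form D)) (f : subst G D) x y x' y' :
  map (fup (s := T0)) H ⊢ up (tsub f x) $ v0 == up x' $ v0 ->
  map (fup (s := T0)) H ⊢ up (tsub f y) $ v0 == up y' $ v0 ->
  H ⊢ Iff (fsub (ltR x y) f) (ltR x' y').
Proof.
  intros h1 h2.
  apply iff_ex, ltQ_fsub; cbn [tsub]; rewrite <- ?up_tsub; [|exact h2].
  st addQ_stable. apply (stable2_congr addQ_stable); cbn [tsub]; rewrite <- ?up_tsub;
    [exact h1|]. st dyadicQ_stable. refl.
Qed.

Lemma ratR_tsub op G D (H : list (form (T0 :: D))) (f : subst G D) a b :
  stable1 op -> tsub f a = b -> H ⊢ up (tsub f (ratR (op G a))) $ v0 == up (ratR (op D b)) $ v0.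
Proof.
  intros S <-. apply (eqt_app (s := T0) (t := T0)).
  cbn [ratR tsub up].
  apply (eqt_congr base (s := T0) (t := T0 --> T0)); [apply (eqt_refl base)|].
  unfold up. rewrite tsub_comp. st S. apply (eqt_sym base (s := T0)). st S.
  rewrite tsub_comp. refl.
Qed.

(** [number_choice] concludes with a substituted copy of [covers], while [OC00] speaks of [covers]
    at substituted terms. The two differ syntactically, because of [lam], and are only provably
    equivalent. *)
Lemma covers_fsub G D (H : list (form D)) (f : subst G D) h n :
  H ⊢ Iff (fsub (covers h n) f) (covers (tsub f h) (tsub f n)).
Proof.
  assert (S : stable1 (fun G a => oppQ (natQ a))).
  { intros K K' H' g a. st oppQ_stable. apply (stable1_congr oppQ_stable).
    st natQ_stable. refl. }
  apply iff_all, iff_imp; [apply isReal_fsub|].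
  apply iff_imp.
  - apply iff_and; (apply iff_imp; [|apply iff_refl]); apply ltR_fsub.
    + refl.
    + apply (ratR_tsub (op := fun G a => oppQ (natQ a))); [exact S|].
      symmetry; apply up_tsub.
    + apply (ratR_tsub _ natQ_stable). symmetry; apply up_tsub.
    + refl.
  - apply ltR_fsub.
    + apply (ratR_tsub _ natQ_stable). reflexivity.
    + cbn [tsub]. rewrite <- up_tsub. refl.
Qed.
End Substitution.

(** * The positive part *)

Lemma low_quantifiers_fsub G (A : form G) : forall D (f : subst G D),
  low_quantifiers (fsub A f) = low_quantifiers A.
Proof. induction A; intros; cbn; rewrite ?IHA, ?IHA1, ?IHA2; reflexivity. Qed.

Lemma Z2W_number_choice G (H : list (form G)) (A : form (T0 :: T0 :: G)) :
  low_quantifiers A = true ->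
  derives Z2W H (All T0 (Ex T0 A) ⊃
      Ex T1 (All T0 (fsub A (scons (v1 $ v0)
                            (scons v0 (fun _ x => Var (VS (VS x)))))))).
Proof.
  intros L.
  assert (base : forall G (A : form G), RCA0w A -> Z2W A) by (intros; constructor; assumption).
  (* Only [ex_spec] requires [E3]; the functionals for implication and equality come from
     quantifier-free comprehension. *)
  eapply d_exE; [apply d_ax, Z2W_E3|]. cbn [map].
  eapply d_exE; [apply (qf_comprehension base) with
    (Q := v0 $ Zero == Zero ⊃ v0 $ one == Zero); reflexivity|]. cbn [map].
  eapply d_exE; [apply (qf_comprehension base) with
    (Q := v0 $ Zero == v0 $ one); reflexivity|]. cbn [map].
  match goal with |- derives _ ?K _ => set (K0 := K) end.
  assert (h : specs K0 v2 v1 v0).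
  { split; [|split]; [right; right; left|right; left|left]; reflexivity. }
  clearbody K0.
  unfold fup. rewrite !fsub_comp.
  match goal with |- derives _ _ (fsub _ ?g) => set (r := g) end.
  pose proof (number_choice base (A := fsub A (lift (lift r (s := T0)) (s := T0)))
                (eq_trans (low_quantifiers_fsub _ _) L) h) as N.
  rewrite fsub_comp in N.
  match goal with |- derives _ _ (fsub (_ ⊃ Ex T1 (All T0 (fsub A ?g))) _) =>
    change (derives Z2W K0 (All T0 (Ex T0 (fsub A (lift (lift r (s := T0)) (s := T0)))) ⊃
      Ex T1 (All T0 (fsub (fsub A g) (lift (lift r (s := T1)) (s := T0))))))
  end.
  rewrite fsub_comp.
  match type of N with derives _ _ (_ ⊃ Ex T1 (All T0 (fsub _ ?g))) =>
    match goal with |- derives _ _ (_ ⊃ Ex T1 (All T0 (fsub _ ?g'))) =>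
      replace g' with g
    end
  end; [exact N|].
  apply subst_ext; [reflexivity|]. intros s x. revert s x.
  apply var_case; reflexivity.
Qed.

Lemma Z2W_proves_OC00 : proves Z2W OC00.
Proof.
  assert (base : forall G (A : form G), RCA0w A -> Z2W A) by (intros; constructor; assumption).
  apply d_allI, d_impI.
  eapply iff_l.
  (* The sequence of representations has higher type but enters only as a parameter, so [covers]
     quantifies over numbers and functions alone. *)
  2:{ eapply d_impE; [apply (Z2W_number_choice _ (A := covers (v2 $ v0) v1)); reflexivity|].
      eapply d_andE2, d_andE2, hyp0. }
  apply iff_ex, iff_all, (covers_fsub base).
Qed.

(** * Coded reals *)

Definition real := nat -> nat.

(** [tri_nat], ..., [fst_nat] are the functions denoted by [tri], ..., [fstN]. *)
Definition tri_nat (n : nat) : nat := nat_rec _ 0 (fun k r => r + S k) n.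
Definition pair_nat (a b : nat) : nat := tri_nat (a + b) + b.
Definition troot_nat (n : nat) : nat :=
  nat_rec _ 0 (fun k r => r + (1 - (tri_nat (S r) - S k))) n.
Definition snd_nat (n : nat) : nat := n - tri_nat (troot_nat n).
Definition fst_nat (n : nat) : nat := troot_nat n - snd_nat n.

Lemma tri_nat_S n : tri_nat (S n) = tri_nat n + S n.
Proof. reflexivity. Qed.

Lemma tri_nat_mono n m : n <= m -> tri_nat n <= tri_nat m.
Proof. induction 1; rewrite ?tri_nat_S; lia. Qed.

Lemma troot_spec n : tri_nat (troot_nat n) <= n < tri_nat (S (troot_nat n)).
Proof.
  induction n as [|n IH]; [cbn; lia|].
  change (troot_nat (S n))
    with (troot_nat n + (1 - (tri_nat (S (troot_nat n)) - S n))).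
  (* The increment [1 - (tri_nat (S w) - S n)] is 1 exactly when the next triangular number has been
     reached. *)
  destruct (le_lt_dec (tri_nat (S (troot_nat n))) (S n)) as [h|h].
  - replace (1 - _) with 1 by lia. rewrite Nat.add_1_r.
    rewrite (tri_nat_S (S _)). lia.
  - replace (1 - _) with 0 by lia. rewrite Nat.add_0_r. lia.
Qed.

Lemma troot_pair a b : troot_nat (pair_nat a b) = a + b.
Proof.
  pose proof (troot_spec (pair_nat a b)) as [h1 h2].
  set (w := troot_nat _) in *. unfold pair_nat in h1, h2.
  destruct (lt_eq_lt_dec w (a + b)) as [[h|h]|h]; [|exact h|].
  - pose proof (@tri_nat_mono (S w) (a + b) h). lia.
  - pose proof (@tri_nat_mono (S (a + b)) w h) as h3. rewrite tri_nat_S in h3. lia.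
Qed.

Lemma snd_pair a b : snd_nat (pair_nat a b) = b.
Proof. unfold snd_nat. rewrite troot_pair. unfold pair_nat. lia. Qed.

Lemma fst_pair a b : fst_nat (pair_nat a b) = a.
Proof. unfold fst_nat. rewrite troot_pair, snd_pair. lia. Qed.

Open Scope R_scope.

Definition frac (c : nat) : R :=
  (INR (fst_nat (fst_nat c)) - INR (snd_nat (fst_nat c))) / INR (S (snd_nat c)).

Lemma frac_pair a b c : frac (pair_nat (pair_nat a b) c) = (INR a - INR b) / INR (S c).
Proof. unfold frac. rewrite !fst_pair, !snd_pair. reflexivity. Qed.

Lemma half_pow_pos k : 0 < (/ 2) ^ k.
Proof. apply pow_lt. lra. Qed.

Lemma half_pow_S k : (/ 2) ^ S k = (/ 2) ^ k / 2.
Proof. simpl. lra. Qed.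

Lemma half_pow_small e : 0 < e -> exists k, (/ 2) ^ k < e.
Proof.
  intros h. destruct (pow_lt_1_zero (/ 2)) with (y := e) as [k hk]; [|exact h|].
  - rewrite Rabs_pos_eq; lra.
  - exists k. specialize (hk k (Nat.le_refl k)).
    rewrite Rabs_pos_eq in hk; [exact hk|]. apply Rlt_le, half_pow_pos.
Qed.

Lemma half_pow_le k m : (k <= m)%nat -> (/ 2) ^ m <= (/ 2) ^ k.
Proof.
  induction 1 as [|m h IH]; [lra|]. rewrite half_pow_S. pose proof (half_pow_pos m). lra.
Qed.

Definition cauchy (x : real) : Prop :=
  forall k i, Rabs (frac (x k) - frac (x (k + i)%nat)) < (/ 2) ^ k.
Definition limit_of (x : real) (r : R) : Prop :=
  forall k, Rabs (frac (x k) - r) <= (/ 2) ^ k.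
Definition val (x : real) : R := epsilon (inhabits 0) (limit_of x).

(** The factor 4 is made up of the tolerance [2 * (/ 2) ^ k] of [eqR] and one error [(/ 2) ^ k] for
    each of the two approximations. *)
Lemma small_eq a b : (forall k, Rabs (a - b) <= 4 * (/ 2) ^ k) -> a = b.
Proof.
  intros h. destruct (Req_dec a b) as [e|e]; [exact e|].
  assert (p : 0 < Rabs (a - b) / 4) by (pose proof (Rabs_pos_lt (a - b)); lra).
  destruct (half_pow_small p) as [k hk]. specialize (h k). lra.
Qed.

Lemma val_spec x : cauchy x -> limit_of x (val x).
Proof.
  intros hx. unfold val. apply (epsilon_spec (inhabits 0) (limit_of x)).
  destruct (R_complete (fun k => frac (x k))) as [r hr].
  - intros e he. destruct (half_pow_small (e := e / 2)) as [N hN]; [lra|].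
    exists N. intros n m hn hm. unfold Rdist.
    pose proof (hx N (n - N)%nat) as h1. pose proof (hx N (m - N)%nat) as h2.
    replace (N + (n - N))%nat with n in h1 by lia.
    replace (N + (m - N))%nat with m in h2 by lia.
    apply Rabs_def2 in h1, h2. apply Rabs_def1; lra.
  - exists r. intros k. apply Rnot_lt_le. intros h.
    destruct (hr (Rabs (frac (x k) - r) - (/ 2) ^ k)) as [N hN]; [lra|].
    specialize (hN (k + N)%nat ltac:(lia)). unfold Rdist in hN.
    pose proof (hx k N) as h1.
    pose proof (Rabs_triang (frac (x k) - frac (x (k + N)%nat)) (frac (x (k + N)%nat) - r)).
    replace (frac (x k) - frac (x (k + N)%nat) + (frac (x (k + N)%nat) - r))
      with (frac (x k) - r) in * by ring. lra.
Qed.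

Lemma val_unique x r : cauchy x -> limit_of x r -> val x = r.
Proof.
  intros hx hr. apply small_eq. intros k.
  pose proof (val_spec hx k) as h1. specialize (hr k).
  pose proof (half_pow_pos k).
  apply Rabs_le. split_Rabs; lra.
Qed.

Lemma cauchy_const c : cauchy (fun _ => c).
Proof. intros k i. rewrite Rminus_diag, Rabs_R0. apply half_pow_pos. Qed.

Lemma val_const c : val (fun _ => c) = frac c.
Proof.
  apply val_unique; [apply cauchy_const|]. intros k.
  rewrite Rminus_diag, Rabs_R0. apply Rlt_le, half_pow_pos.
Qed.

Lemma val_lt x y : cauchy x -> cauchy y ->
  ((exists k, frac (x k) + 2 * (/ 2) ^ k < frac (y k)) <-> val x < val y).
Proof.
  intros hx hy. split.
  - intros [k h]. pose proof (val_spec hx k). pose proof (val_spec hy k). split_Rabs; lra.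
  (* A quarter of the gap, since it must absorb the tolerance [2 * (/ 2) ^ k] and an error
     [(/ 2) ^ k] on either side. *)
  - intros h. destruct (half_pow_small (e := (val y - val x) / 4)) as [k hk]; [lra|].
    exists k. pose proof (val_spec hx k). pose proof (val_spec hy k). split_Rabs; lra.
Qed.

Lemma val_eq x y : cauchy x -> cauchy y ->
  ((forall k, Rabs (frac (x k) - frac (y k)) <= 2 * (/ 2) ^ k) <-> val x = val y).
Proof.
  intros hx hy. split.
  - intros h. apply small_eq. intros k.
    pose proof (val_spec hx k). pose proof (val_spec hy k). specialize (h k).
    pose proof (half_pow_pos k). split_Rabs; lra.
  - intros E k. pose proof (val_spec hx k). pose proof (val_spec hy k). rewrite E in *.
    split_Rabs; lra.
Qed.

(** [point n b] is [n + sum_k (1 + b_k) / 4^(k+1)] for a binary sequence [b]. *)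
Fixpoint digits (n : nat) (b : real) (k : nat) : nat :=
  match k with 0 => n | S k => 4 * digits n b k + 1 + Nat.min 1 (b k) end%nat.
Definition point (n : nat) (b : real) : real :=
  fun k => pair_nat (pair_nat (digits n b k) 0) (Nat.pred (4 ^ k)).

Definition pt_approx n b k : R := INR (digits n b k) * (/ 4) ^ k.

Lemma INR_4_pow k : INR (4 ^ k) = 4 ^ k.
Proof. rewrite pow_INR. f_equal. simpl. lra. Qed.

Lemma frac_point n b k : frac (point n b k) = pt_approx n b k.
Proof.
  unfold point. rewrite frac_pair, Nat.succ_pred by (apply Nat.pow_nonzero; lia).
  rewrite INR_4_pow. unfold pt_approx. rewrite pow_inv. simpl (INR 0). unfold Rdiv. ring.
Qed.

Lemma quarter_pow_pos k : 0 < (/ 4) ^ k.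
Proof. apply pow_lt. lra. Qed.

Lemma pt_approx_step n b k :
  pt_approx n b k + (/ 4) ^ k / 4 <= pt_approx n b (S k) <= pt_approx n b k + (/ 4) ^ k / 2.
Proof.
  unfold pt_approx. cbn [digits]. rewrite !plus_INR, mult_INR. simpl ((/ 4) ^ S k).
  assert (h : 0 <= INR (Nat.min 1 (b k)) <= 1).
  { split; [apply pos_INR|]. apply (le_INR _ 1). lia. }
  replace (INR 4) with 4 by (simpl; lra). simpl (INR 1).
  pose proof (quarter_pow_pos k).
  set (q := (/ 4) ^ k) in *. set (d := INR (digits n b k)). set (t := INR (Nat.min 1 (b k))) in *.
  nra.
Qed.

(** All digits in base 4 are 1 or 2, so the tail after [k] digits lies between [4^-k / 3], the sum
    of [1 / 4^(j+1)] over [j >= k], and twice this amount. The intervals so obtained are nested and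
    stay away from the next multiple of [4^-k]; hence no carry occurs and the digits can be read off
    the real. *)
Lemma pt_approx_bounds n b k i :
  pt_approx n b k + (/ 4) ^ k / 3 <= pt_approx n b (k + i) + (/ 4) ^ (k + i) / 3 /\
  pt_approx n b (k + i) + (/ 4) ^ (k + i) * 2 / 3 <= pt_approx n b k + (/ 4) ^ k * 2 / 3.
Proof.
  induction i as [|i IH]; [rewrite Nat.add_0_r; lra|].
  rewrite Nat.add_succ_r. pose proof (pt_approx_step n b (k + i)).
  simpl ((/ 4) ^ S (k + i)). lra.
Qed.

Lemma quarter_le_half k : (/ 4) ^ k <= (/ 2) ^ k.
Proof. apply pow_incr. lra. Qed.

Lemma cauchy_point n b : cauchy (point n b).
Proof.
  intros k i. rewrite !frac_point. pose proof (pt_approx_bounds n b k i).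
  pose proof (quarter_pow_pos (k + i)). pose proof (quarter_pow_pos k).
  pose proof (quarter_le_half k). apply Rabs_def1; lra.
Qed.

Lemma val_point n b k :
  pt_approx n b k + (/ 4) ^ k / 3 <= val (point n b) <= pt_approx n b k + (/ 4) ^ k * 2 / 3.
Proof.
  assert (H : forall j, exists i, Rabs (pt_approx n b (k + i) - val (point n b)) <= (/ 2) ^ j
                 /\ (/ 4) ^ (k + i) <= (/ 2) ^ j).
  { intros j. exists j. pose proof (val_spec (cauchy_point n b) (k + j)%nat) as h.
    rewrite frac_point in h.
    pose proof (half_pow_le (k := j) (m := (k + j)%nat) ltac:(lia)).
    pose proof (quarter_le_half (k + j)). lra. }
  split; apply Rnot_lt_le; intros h.
  - destruct (half_pow_small (e := (pt_approx n b k + (/ 4) ^ k / 3 - val (point n b)) / 4))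
      as [j hj]; [lra|].
    destruct (H j) as (i & h1 & h2). destruct (pt_approx_bounds n b k i) as [h3 h4].
    pose proof (quarter_pow_pos (k + i)). split_Rabs; lra.
  - destruct (half_pow_small (e := (val (point n b) - (pt_approx n b k + (/ 4) ^ k * 2 / 3)) / 4))
      as [j hj]; [lra|].
    destruct (H j) as (i & h1 & h2). destruct (pt_approx_bounds n b k i) as [h3 h4].
    pose proof (quarter_pow_pos (k + i)). split_Rabs; lra.
Qed.

Lemma val_point_bounds n b : INR n < val (point n b) < INR n + 1.
Proof.
  pose proof (val_point n b 0) as h. unfold pt_approx in h. cbn [digits] in h. simpl in h. lra.
Qed.

(** [digits n b k] is the integer part of [4^k * val (point n b)]. *)
Lemma digits_unique n b n' b' k :
  val (point n b) = val (point n' b') -> digits n b k = digits n' b' k.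
Proof.
  intros E. pose proof (val_point n b k) as h. pose proof (val_point n' b' k) as h'.
  rewrite E in h. unfold pt_approx in *. pose proof (quarter_pow_pos k) as hq.
  set (q := (/ 4) ^ k) in *.
  assert (H : forall a c : nat, INR a * q + q / 3 <= INR c * q + q * 2 / 3 -> (a <= c)%nat).
  { intros a c hac. apply Nat.nlt_ge. intros hlt. apply (le_INR (S c) a) in hlt.
    rewrite S_INR in hlt. nra. }
  apply Nat.le_antisymm; apply H; lra.
Qed.

Lemma point_inj n b n' b' :
  (forall k, b k <= 1)%nat -> (forall k, b' k <= 1)%nat ->
  val (point n b) = val (point n' b') -> n = n' /\ b = b'.
Proof.
  intros hb hb' E. split; [exact (digits_unique 0 E)|].
  apply functional_extensionality. intros k.
  pose proof (digits_unique k E) as h. pose proof (digits_unique (S k) E) as h'.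
  cbn [digits] in h'. specialize (hb k). specialize (hb' k). lia.
Qed.

Close Scope R_scope.

(** Only the value of [x] matters, so the notion respects equality of reals. As [digits] sees
    [Nat.min 1 (b k)], the sequence must be binary in order to be determined by the real. *)
Definition is_point (x : real) (n : nat) (b : real) : Prop :=
  cauchy x /\ (forall k, b k <= 1) /\ val x = val (point n b).

(** A binary sequence [b] codes the partial function sending [n] to the least
    [j] with [b (n, j) = 1]. *)
Definition above (b : real) (n m : nat) : Prop :=
  exists j, m < j /\ b (to_nat (n, j)) = 1 /\ forall i, i < j -> b (to_nat (n, i)) = 0.
Definition graph (b g : real) : Prop :=
  forall n j, b (to_nat (n, j)) = if j =? g n then 1 else 0.

Lemma above_mono b n m m' : m <= m' -> above b n m' -> above b n m.
Proof. intros h (j & h1 & h2). exists j. split; [lia|exact h2]. Qed.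

Lemma above_bounded b n : exists M, forall m, M <= m -> ~ above b n m.
Proof.
  destruct (classic (exists m, above b n m)) as [(m & j & h1 & h2 & h3)|h].
  - exists j. intros m' hm (j' & h4 & h5 & h6).
    specialize (h6 j ltac:(lia)). congruence.
  - exists 0. intros m _ h'. eauto.
Qed.

(** * A language with choice and its definable elements *)

Definition cond := real -> option nat.

Inductive U := uN (n : nat) | uB (f : real) | uP (p : cond).

Definition getN (u : U) : nat := match u with uN n => n | _ => 0 end.
Definition getB (u : U) : real := match u with uB f => f | _ => fun _ => 0 end.
Definition getP (u : U) : cond := match u with uP p => p | _ => fun _ => None end.

Notation at_ i e := (nth i e (uN 0)).

Definition sub (p q : cond) : Prop := forall b v, p b = Some v -> q b = Some v.
Definition finite_to_one (p : cond) : Prop :=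
  forall v, exists l, forall b, p b = Some v -> In b l.
(** A pair [(p, N)] is a forcing condition: [p] approximates the generic
    functional and all values added later are at least [N]. *)
Definition extends (q : cond) (M : nat) (p : cond) (N : nat) : Prop :=
  finite_to_one q /\ sub p q /\ N <= M /\
  forall b v, p b = None -> q b = Some v -> N <= v.

Fixpoint enc_list (l : list nat) : nat :=
  match l with [] => 0 | x :: l => S (to_nat (x, enc_list l)) end.
Definition dec_list (n : nat) : list nat :=
  epsilon (inhabits []) (fun l => enc_list l = n).

Lemma to_nat_inj x y : to_nat x = to_nat y -> x = y.
Proof. intros E. rewrite <- (cancel_of_to x), <- (cancel_of_to y), E. reflexivity. Qed.

Lemma enc_list_inj l : forall l', enc_list l = enc_list l' -> l = l'.
Proof.
  induction l as [|x l IH]; intros [|y l'] E; try discriminate; [reflexivity|].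
  cbn [enc_list] in E. apply eq_add_S, to_nat_inj in E. injection E as -> E.
  f_equal; auto.
Qed.

Lemma dec_enc_list l : dec_list (enc_list l) = l.
Proof.
  apply enc_list_inj. unfold dec_list.
  exact (epsilon_spec (inhabits []) (fun l' => enc_list l' = enc_list l) (ex_intro _ l eq_refl)).
Qed.

Definition bar_nat (g : real) (n : nat) : nat :=
  nat_rec _ 0 (fun k r => S (pair_nat r (g k))) n.
Fixpoint bar_tuple_nat (gs : list real) (n : nat) : nat :=
  match gs with
  | [] => 0
  | [g] => bar_nat g n
  | g :: gs => pair_nat (bar_nat g n) (bar_tuple_nat gs n)
  end.
Definition kleene_matrix (universal : bool) (f : real) (gs : list real) : Prop :=
  if universal then forall n, f (bar_tuple_nat gs n) = 0
  else exists n, f (bar_tuple_nat gs n) = 0.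

(** Any fixed relation on [U] may be made atomic, since what matters is that the language is
    countable. The notions needed later are therefore atoms and do not have to be written out as
    formulas. The constants [aNum n] bring every number into the hull. *)
Variant atom :=
| aNum (n : nat) | aIsN | aIsB | aIsP
| aEqN | aLe | aSucc | aPair | aSub | aExtends | aVal | aApp | aNth | aUnion | aSingle | aSlice
| aPoint | aIsPoint | aAbove | aGraph
| aKleene (universal : bool).

(** Missing entries and entries of the wrong sort are read as 0, the zero function or the empty
    condition. In [aKleene] the environment has the most recently quantified function in front and
    the parameter [f] at the end, hence the reversal. *)
Definition atom_holds (a : atom) (e : list U) : Prop :=
  let N i := getN (at_ i e) in
  let B i := getB (at_ i e) in
  let P i := getP (at_ i e) in
  match a with
  | aNum n => at_ 0 e = uN n
  | aIsN => at_ 0 e = uN (N 0)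
  | aIsB => at_ 0 e = uB (B 0)
  | aIsP => at_ 0 e = uP (P 0)
  | aEqN => N 0 = N 1
  | aLe => N 0 <= N 1
  | aSucc => N 0 = S (N 1)
  | aPair => N 0 = to_nat (N 1, N 2)
  | aSub => sub (P 0) (P 1)
  | aExtends => extends (P 0) (N 1) (P 2) (N 3)
  | aVal => P 0 (B 1) = Some (N 2)
  | aApp => B 0 (N 1) = N 2
  | aNth => N 0 = nth (N 2) (dec_list (N 1)) 0
  | aUnion => forall b v, P 0 b = Some v <-> P 1 b = Some v \/ P 2 b = Some v
  | aSingle => forall b v, P 0 b = Some v <-> b = B 1 /\ v = N 2
  | aSlice => forall k, B 0 k = B 1 (to_nat (N 2, k))
  | aPoint => B 0 = point (N 1) (B 2)
  | aIsPoint => is_point (B 0) (N 1) (B 2)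
  | aAbove => above (B 0) (N 1) (N 2)
  | aGraph => graph (B 0) (fun n => S (B 1 (S n)))
  | aKleene u =>
      match rev (map getB e) with [] => False | f :: gs => kleene_matrix u f gs end
  end.

Inductive fm :=
| At (a : atom)
| Ng (A : fm)
| Cj (A B : fm)
| Lt (A B : fm)
| Rn (l : list nat) (k : nat) (A : fm).

(** [k = 0] discards the remaining entries, [k = S k'] keeps those from [k'] on. *)
Definition rearrange (l : list nat) (k : nat) (e : list U) : list U :=
  map (fun i => at_ i e) l ++ match k with 0 => [] | S k => skipn k e end.

(** [Lt A B] is [let x := epsilon x, A x in B x]. *)
Fixpoint sat (A : fm) (e : list U) : Prop :=
  match A with
  | At a => atom_holds a e
  | Ng A => ~ sat A e
  | Cj A B => sat A e /\ sat B e
  | Lt A B => sat B (epsilon (inhabits (uN 0)) (fun u => sat A (u :: e)) :: e)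
  | Rn l k A => sat A (rearrange l k e)
  end.

Definition enc_atom (a : atom) : nat :=
  match a with
  | aNum n => to_nat (0, n)
  | aIsN => to_nat (1, 0) | aIsB => to_nat (1, 1) | aIsP => to_nat (1, 2)
  | aEqN => to_nat (1, 3) | aSub => to_nat (1, 4) | aExtends => to_nat (1, 5)
  | aVal => to_nat (1, 6) | aApp => to_nat (1, 7) | aNth => to_nat (1, 8)
  | aUnion => to_nat (1, 9) | aSingle => to_nat (1, 10) | aSlice => to_nat (1, 11)
  | aLe => to_nat (1, 14) | aSucc => to_nat (1, 15) | aPair => to_nat (1, 16)
  | aPoint => to_nat (1, 17) | aIsPoint => to_nat (1, 18)
  | aAbove => to_nat (1, 19) | aGraph => to_nat (1, 20)
  | aKleene true => to_nat (1, 12) | aKleene false => to_nat (1, 13)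
  end.

Lemma enc_atom_inj a b : enc_atom a = enc_atom b -> a = b.
Proof.
  destruct a as [n| | | | | | | | | | | | | | | | | | | |[|]], b as [m| | | | | | | | | | | | | | | | | | | |[|]];
    intros E; unfold enc_atom in E; apply to_nat_inj in E; congruence.
Qed.

Fixpoint enc (A : fm) : nat :=
  match A with
  | At a => to_nat (0, enc_atom a)
  | Ng A => to_nat (1, enc A)
  | Cj A B => to_nat (2, to_nat (enc A, enc B))
  | Lt A B => to_nat (3, to_nat (enc A, enc B))
  | Rn l k A => to_nat (4, to_nat (enc_list l, to_nat (k, enc A)))
  end.

Lemma enc_inj A : forall B, enc A = enc B -> A = B.
Proof.
  induction A; intros [] E; cbn [enc] in E; apply to_nat_inj in E; try discriminate;
    apply (f_equal snd) in E; cbn [snd] in E;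
    repeat match goal with
           | h : to_nat _ = to_nat _ |- _ => apply to_nat_inj, pair_equal_spec in h; destruct h
           end; f_equal; auto using enc_atom_inj, enc_list_inj.
Qed.

Definition fm_nth (n : nat) : fm := epsilon (inhabits (At aIsN)) (fun A => enc A = n).

Lemma fm_nth_enc A : fm_nth (enc A) = A.
Proof.
  apply enc_inj. unfold fm_nth.
  exact (epsilon_spec (inhabits (At aIsN)) (fun B => enc B = enc A) (ex_intro _ A eq_refl)).
Qed.

Definition definable (R : list U -> Prop) : Prop := exists A, forall e, sat A e <-> R e.

Definition eps (R : U -> Prop) : U := epsilon (inhabits (uN 0)) R.

Lemma eps_spec (R : U -> Prop) : (exists u, R u) -> R (eps R).
Proof. apply epsilon_spec. Qed.

(** By extensionality the chosen element depends on the relation and not on the formula that defines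
    it. This permits working with definable relations semantically, without mentioning formulas. *)
Lemma eps_ext (R S : U -> Prop) : (forall u, R u <-> S u) -> eps R = eps S.
Proof.
  intros E. f_equal. apply functional_extensionality; intros u.
  apply propositional_extensionality, E.
Qed.

Lemma def_ext R S : definable R -> (forall e, R e <-> S e) -> definable S.
Proof. intros [A h] E. exists A. intros e. rewrite h. apply E. Qed.

Lemma def_atom a : definable (atom_holds a).
Proof. exists (At a). reflexivity. Qed.

Lemma def_not R : definable R -> definable (fun e => ~ R e).
Proof. intros [A h]. exists (Ng A). intros e. cbn. rewrite h. reflexivity. Qed.

Lemma def_and R S : definable R -> definable S -> definable (fun e => R e /\ S e).
Proof. intros [A h] [B h']. exists (Cj A B). intros e. cbn. rewrite h, h'. reflexivity. Qed.

Lemma def_or R S : definable R -> definable S -> definable (fun e => R e \/ S e).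
Proof.
  intros h h'. eapply def_ext; [apply (def_not (def_and (def_not h) (def_not h')))|].
  intros e; cbn. tauto.
Qed.

Lemma def_imp R S : definable R -> definable S -> definable (fun e => R e -> S e).
Proof.
  intros h h'. eapply def_ext; [apply (def_or (def_not h) h')|].
  intros e; cbn. tauto.
Qed.

Lemma def_eps R S :
  definable R -> definable S -> definable (fun e => S (eps (fun u => R (u :: e)) :: e)).
Proof.
  intros [A h] [B h']. exists (Lt A B). intros e. cbn. rewrite h'.
  replace (epsilon _ _) with (eps (fun u => R (u :: e))); [reflexivity|].
  apply eps_ext. intros u. symmetry; apply h.
Qed.

Lemma def_rearrange l k R : definable R -> definable (fun e => R (rearrange l k e)).
Proof. intros [A h]. exists (Rn l k A). intros e. apply h. Qed.

(** Hilbert's elimination of the quantifier: a relation that has an instance holds of its own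
    epsilon term. *)
Lemma def_ex R : definable R -> definable (fun e => exists u, R (u :: e)).
Proof.
  intros h. eapply def_ext; [apply (def_eps h h)|].
  intros e; split; [eauto|]. apply eps_spec.
Qed.

Lemma def_exN R : definable R -> definable (fun e => exists n, R (uN n :: e)).
Proof.
  intros h. eapply def_ext; [apply (def_ex (def_and (def_atom aIsN) h))|].
  intros e; split; cbn.
  - intros (u & E & H). rewrite E in H. eauto.
  - intros (n & H). exists (uN n). split; [reflexivity|exact H].
Qed.

Lemma def_exB R : definable R -> definable (fun e => exists b, R (uB b :: e)).
Proof.
  intros h. eapply def_ext; [apply (def_ex (def_and (def_atom aIsB) h))|].
  intros e; split; cbn.
  - intros (u & E & H). rewrite E in H. eauto.
  - intros (n & H). exists (uB n). split; [reflexivity|exact H].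
Qed.

Lemma def_exP R : definable R -> definable (fun e => exists p, R (uP p :: e)).
Proof.
  intros h. eapply def_ext; [apply (def_ex (def_and (def_atom aIsP) h))|].
  intros e; split; cbn.
  - intros (u & E & H). rewrite E in H. eauto.
  - intros (n & H). exists (uP n). split; [reflexivity|exact H].
Qed.

Lemma def_allN R : definable R -> definable (fun e => forall n, R (uN n :: e)).
Proof.
  intros h. eapply def_ext; [apply (def_not (def_exN (def_not h)))|].
  intros e; cbn; split.
  - intros H u. apply NNPP. intros H'. apply H. eauto.
  - intros H [u H']. auto.
Qed.

Lemma def_allB R : definable R -> definable (fun e => forall b, R (uB b :: e)).
Proof.
  intros h. eapply def_ext; [apply (def_not (def_exB (def_not h)))|].
  intros e; cbn; split.
  - intros H u. apply NNPP. intros H'. apply H. eauto.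
  - intros H [u H']. auto.
Qed.

Lemma def_allP R : definable R -> definable (fun e => forall p, R (uP p :: e)).
Proof.
  intros h. eapply def_ext; [apply (def_not (def_exP (def_not h)))|].
  intros e; cbn; split.
  - intros H u. apply NNPP. intros H'. apply H. eauto.
  - intros H [u H']. auto.
Qed.

(** The elements definable without parameters; the [epsilon] in the language
    makes them an elementary substructure. *)
Definition hull (u : U) : Prop := exists R, definable R /\ u = eps (fun u => R [u]).
Definition hulls (e : list U) : Prop := Forall hull e.

(** The parameter [u] is replaced by its defining epsilon term. Entry 0 is kept in front, because it
    is the variable that a later [eps] binds. *)
Lemma def_subst_hull R u :
  definable R -> hull u -> definable (fun e => R (at_ 0 e :: u :: skipn 1 e)).
Proof.
  intros h (S & hS & ->).
  exact (def_eps (def_rearrange [0] 0 hS) (def_rearrange [1; 0] 3 h)).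
Qed.

Lemma def_subst_hulls e : forall R,
  definable R -> hulls e -> definable (fun e' => R (at_ 0 e' :: e)).
Proof.
  induction e as [|u e IH]; intros R h he.
  - exact (def_rearrange [0] 0 h).
  - apply Forall_cons_iff in he as [hu he].
    exact (IH _ (def_subst_hull h hu) he).
Qed.

(** The Tarski-Vaught criterion: the epsilon witness is definable from the parameters [e], and these
    can be eliminated. *)
Lemma elementary R e :
  definable R -> hulls e -> (exists u, R (u :: e)) -> exists u, hull u /\ R (u :: e).
Proof.
  intros h he H. exists (eps (fun u => R (u :: e))). split.
  - exists (fun e' => R (at_ 0 e' :: e)). split; [apply def_subst_hulls; assumption|].
    reflexivity.
  - apply eps_spec, H.
Qed.

Lemma hull_N n : hull (uN n).
Proof.
  exists (atom_holds (aNum n)). split; [apply def_atom|].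
  symmetry. apply (eps_spec (R := fun u => atom_holds (aNum n) [u])).
  exists (uN n). reflexivity.
Qed.

Lemma elementaryB R e :
  definable R -> hulls e -> (exists b, R (uB b :: e)) -> exists b, hull (uB b) /\ R (uB b :: e).
Proof.
  intros h he [b H].
  destruct (elementary (def_and (def_atom aIsB) h) he) as (u & hu & E & H').
  - exists (uB b). split; [reflexivity|exact H].
  - cbn in E. rewrite E in hu, H'. eauto.
Qed.

Lemma elementaryP R e :
  definable R -> hulls e -> (exists p, R (uP p :: e)) -> exists p, hull (uP p) /\ R (uP p :: e).
Proof.
  intros h he [b H].
  destruct (elementary (def_and (def_atom aIsP) h) he) as (u & hu & E & H').
  - exists (uP b). split; [reflexivity|exact H].
  - cbn in E. rewrite E in hu, H'. eauto.
Qed.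

(** Codes of formulas enumerate the hull. The same enumeration lists the relations that the generic
    functional has to decide. *)
Definition hull_nth (n : nat) : U := eps (fun u => sat (fm_nth n) [u]).

Lemma hull_nth_surj u : hull u -> exists n, u = hull_nth n.
Proof.
  intros (R & [A h] & ->). exists (enc A). unfold hull_nth. rewrite fm_nth_enc.
  apply eps_ext. intros u. symmetry. apply h.
Qed.

Lemma def_subst_hulls2 e : forall R,
  definable R -> hulls e -> definable (fun e' => R (at_ 0 e' :: at_ 1 e' :: e)).
Proof.
  induction e as [|u e IH]; intros R h he.
  - exact (def_rearrange [0; 1] 0 h).
  - apply Forall_cons_iff in he as [hu he].
    assert (D : definable (fun e => R (at_ 0 e :: at_ 1 e :: u :: skipn 2 e))).
    { destruct hu as (S & hS & ->).
      exact (def_eps (def_rearrange [0] 0 hS) (def_rearrange [1; 2; 0] 4 h)). }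
    exact (IH _ D he).
Qed.

(** * The generic functional *)

Lemma sub_refl p : sub p p.
Proof. intros b v h; exact h. Qed.

Lemma sub_trans p q r : sub p q -> sub q r -> sub p r.
Proof. intros h1 h2 b v h. auto. Qed.

Lemma extends_refl p N : finite_to_one p -> extends p N p N.
Proof.
  intros h. split; [exact h|]. split; [apply sub_refl|]. split; [lia|]. congruence.
Qed.

Lemma extends_trans r K q M p N :
  extends r K q M -> extends q M p N -> extends r K p N.
Proof.
  intros (f1 & s1 & l1 & n1) (f2 & s2 & l2 & n2).
  split; [exact f1|]. split; [eapply sub_trans; eassumption|]. split; [lia|].
  intros b v hp hr. destruct (q b) as [w|] eqn:hq.
  - pose proof (s1 _ _ hq). assert (v = w) as -> by congruence. eauto.
  - specialize (n1 _ _ hq hr). lia.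
Qed.

(** A value [v] can be added only up to step [v], so its fibre in the union is already its fibre in
    [P (S v)]. *)
Lemma chain_union (P : nat -> cond) :
  (forall n, finite_to_one (P n)) -> (forall n, sub (P n) (P (S n))) ->
  (forall n b v, P n b = None -> P (S n) b = Some v -> n <= v) ->
  exists Q, (forall b v, Q b = Some v <-> exists n, P n b = Some v) /\ finite_to_one Q.
Proof.
  intros fin inc new.
  assert (inc' : forall n m, n <= m -> sub (P n) (P m)).
  { intros n m h. induction h; [apply sub_refl|eapply sub_trans; eauto]. }
  set (Q := fun b => epsilon (inhabits None) (fun o => match o with
              | Some v => exists n, P n b = Some v
              | None => forall n, P n b = None end)).
  assert (HQ : forall b v, Q b = Some v <-> exists n, P n b = Some v).
  { intros b v.
    assert (E : match Q b with
                | Some v => exists n, P n b = Some v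
                | None => forall n, P n b = None end).
    { apply (epsilon_spec (inhabits None) (fun o => match o with
              | Some v => exists n, P n b = Some v
              | None => forall n, P n b = None end)).
      destruct (classic (exists n w, P n b = Some w)) as [(n & w & h)|h].
      - exists (Some w). eauto.
      - exists None. intros n. destruct (P n b) eqn:h'; [|reflexivity].
        exfalso; eauto. }
    destruct (Q b) as [w|].
    - split; [intros [= <-]; exact E|]. intros [n h]. destruct E as [m h'].
      apply (inc' n (max n m) ltac:(lia)) in h. apply (inc' m (max n m) ltac:(lia)) in h'.
      congruence.
    - split; [discriminate|]. intros [n h]. congruence. }
  exists Q. split; [exact HQ|].
  intros v. destruct (fin (S v) v) as [l hl]. exists l. intros b h. apply hl.
  apply HQ in h as [n h].
  destruct (le_lt_dec n (S v)) as [h'|h']; [exact (inc' _ _ h' _ _ h)|].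
  apply Nat.lt_le_incl in h'. revert h. induction h' as [|m h' IH]; [auto|]. intros h.
  apply IH. destruct (P m b) as [w|] eqn:E.
  - apply (inc m) in E. congruence.
  - specialize (new _ _ _ E h). lia.
Qed.

(** Negation in the sense of forcing: no extension contains a witness. Witnesses are parts [q'] of a
    condition and not whole conditions, because [R] need not be monotone. *)
Definition refutes (R : list U -> Prop) (p : cond) (N n : nat) : Prop :=
  forall q M, extends q M p N -> forall q', sub q' q -> ~ R [uP q'; uN n].
Definition collects (R : list U -> Prop) (p : cond) : Prop :=
  forall n, exists q, sub q p /\ R [uP q; uN n].
Definition decides (R : list U -> Prop) (p : cond) (N : nat) : Prop :=
  (exists n, refutes R p N n) \/ collects R p.

(** In step [n] of the fusion the values are kept above [N + n], so that the
    union is again finite-to-one. *)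
Lemma decides_dense R p N :
  finite_to_one p -> exists q M, extends q M p N /\ decides R q M.
Proof.
  intros fin. destruct (classic (exists q M, extends q M p N /\ exists n, refutes R q M n))
    as [(q & M & h1 & h2)|h].
  { exists q, M. split; [exact h1|left; exact h2]. }
  assert (step : forall n (P : {P : cond | extends P (N + n) p N}),
    exists Q : {Q : cond | extends Q (N + S n) p N},
      extends (proj1_sig Q) (N + S n) (proj1_sig P) (N + n) /\
      exists q, sub q (proj1_sig Q) /\ R [uP q; uN n]).
  { intros n [P hP]. cbn.
    apply NNPP. intros H. apply h. exists P, (N + n). split; [exact hP|].
    exists n. intros q M hq q' hq' hR. apply H.
    assert (hq2 : extends q (N + S n) P (N + n)).
    { destruct hq as (a & b & c & d). split; [exact a|]. split; [exact b|].
      split; [lia|exact d]. }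
    exists (exist _ q (extends_trans hq2 hP)). split; [exact hq2|]. eauto. }
  set (next := fun n P => proj1_sig (constructive_indefinite_description _ (step n P))).
  assert (ini : extends p (N + 0) p N) by (rewrite Nat.add_0_r; apply extends_refl, fin).
  set (S' := nat_rect (fun n => {P : cond | extends P (N + n) p N}) (exist _ p ini) next).
  assert (HS : forall n, extends (proj1_sig (S' (S n))) (N + S n) (proj1_sig (S' n)) (N + n) /\
      exists q, sub q (proj1_sig (S' (S n))) /\ R [uP q; uN n]).
  { intros n. exact (proj2_sig (constructive_indefinite_description _ (step n (S' n)))). }
  destruct (@chain_union (fun n => proj1_sig (S' n))) as (Q & HQ & fQ).
  - intros n. apply (proj2_sig (S' n)).
  - intros n. apply (HS n).
  - intros n b v h1 h2. destruct (HS n) as ((_ & _ & _ & h3) & _).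
    specialize (h3 _ _ h1 h2). lia.
  - exists Q, N. split.
    + split; [exact fQ|]. split; [|split; [lia|]].
      * intros b v hb. apply HQ. exists 0. exact hb.
      * intros b v h1 h2. apply HQ in h2 as [n h2].
        destruct (proj2_sig (S' n)) as (_ & _ & _ & h3). eauto.
    + right. intros n. destruct (HS n) as (_ & q & h1 & h2). exists q. split; [|exact h2].
      intros b v hb. apply HQ. exists (S n). auto.
Qed.

Lemma value_dense b p N :
  finite_to_one p -> exists q M, extends q M p N /\ exists v, q b = Some v.
Proof.
  intros fin. destruct (p b) as [v|] eqn:E.
  { exists p, N. split; [apply extends_refl, fin|eauto]. }
  set (q := fun a => if excluded_middle_informative (a = b) then Some N else p a).
  exists q, N. split; [split; [|split; [|split; [lia|]]]|].
  - intros v. destruct (fin v) as [l hl]. exists (b :: l). intros a h. unfold q in h.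
    destruct excluded_middle_informative; [left; congruence|right; auto].
  - intros a v h. unfold q. destruct excluded_middle_informative; congruence.
  - intros a v h1 h2. unfold q in h2.
    destruct excluded_middle_informative; [injection h2; lia|congruence].
  - exists N. unfold q. destruct excluded_middle_informative; congruence.
Qed.

(** Conditions are themselves elements of [U], so being decided is expressible in the language. This
    is what brings deciding conditions into the hull. *)
Lemma decides_def R : definable R ->
  definable (fun e => decides R (getP (at_ 0 e)) (getN (at_ 1 e))).
Proof.
  intros h. apply def_or.
  - exact (def_exN (def_allP (def_allN (def_imp
      (def_rearrange [1; 0; 3; 4] 0 (def_atom aExtends))
      (def_allP (def_imp (def_rearrange [0; 2] 0 (def_atom aSub))
        (def_not (def_rearrange [0; 3] 0 h)))))))).
  - exact (def_allN (def_exP (def_and (def_rearrange [0; 2] 0 (def_atom aSub))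
      (def_rearrange [0; 1] 0 h)))).
Qed.

Lemma hull_B u : hull u -> hull (uB (getB u)).
Proof.
  intros hu.
  destruct (elementaryB (R := fun e => getB (at_ 0 e) = getB (at_ 1 e)) (e := [u]))
    as (b & hb & E).
  - eapply def_ext; [exact (def_allN (def_exN (def_and
      (def_rearrange [2; 1; 0] 0 (def_atom aApp)) (def_rearrange [3; 1; 0] 0 (def_atom aApp)))))|].
    intros e. cbn. split.
    + intros H. apply functional_extensionality. intros n. destruct (H n) as (m & h1 & h2).
      congruence.
    + intros -> n. eauto.
  - repeat constructor; exact hu.
  - exists (getB u). reflexivity.
  - cbn in E. rewrite <- E. exact hb.
Qed.

(** The extension is built among all conditions, by a fusion that uses external choice, and is then
    reflected into the hull: what is required of it is definable from hull parameters. *)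
Lemma generic_step k p N : hull (uP p) -> finite_to_one p ->
  exists q M, hull (uP q) /\ extends q M p N /\ N < M /\
    decides (sat (fm_nth k)) q M /\ exists v, q (getB (hull_nth k)) = Some v.
Proof.
  intros hp fin.
  assert (hb : hull (uB (getB (hull_nth k)))).
  { apply hull_B. exists (sat (fm_nth k)). split; [|reflexivity].
    exists (fm_nth k). reflexivity. }
  set (b := getB (hull_nth k)) in *. set (R := sat (fm_nth k)).
  assert (dR : definable R) by (exists (fm_nth k); reflexivity).
  destruct (decides_dense R N fin) as (q1 & M1 & h1 & h2).
  destruct (@value_dense b q1 M1) as (q2 & M2 & h3 & v & h4); [apply h1|].
  (* The bound is raised to [S M2], beyond [N]: strictly increasing bounds make the limit of the
     construction finite-to-one. *)
  destruct (elementaryP (R := fun e => (extends (getP (at_ 0 e)) (getN (at_ 1 e))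
      (getP (at_ 2 e)) (getN (at_ 3 e)) /\ decides R (getP (at_ 0 e)) (getN (at_ 1 e))) /\
      exists v, getP (at_ 0 e) (getB (at_ 4 e)) = Some v)
      (e := [uN (S M2); uP p; uN N; uB b])) as (q & hq & (h5 & h6) & h7).
  - apply def_and; [apply def_and; [exact (def_atom aExtends)|apply decides_def, dR]|].
    exact (def_exN (def_rearrange [1; 5; 0] 0 (def_atom aVal))).
  - repeat constructor; auto using hull_N.
  - exists q2. cbn.
    assert (h5 : extends q2 M2 p N) by (eapply extends_trans; eassumption).
    repeat split; try apply h5; eauto.
    + destruct h5 as (_ & _ & ? & _). lia.
    + assert (h6 : extends q2 M2 q1 M1) by exact h3.
      destruct h2 as [[n h2]|h2].
      * left. exists n. intros q M hq. apply (h2 q M). eapply extends_trans; [|exact h6].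
        destruct hq as (a1 & a2 & a3 & a4). split; [exact a1|]. split; [exact a2|].
        split; [lia|]. intros b' v' e1 e2. specialize (a4 _ _ e1 e2). lia.
      * right. intros n. destruct (h2 n) as (q & hq & hq'). exists q. split; [|exact hq'].
        eapply sub_trans; [exact hq|apply h6].
  - exists q, (S M2). cbn in *. repeat split; auto; try apply h5.
    destruct h1 as (_ & _ & l1 & _), h3 as (_ & _ & l2 & _). lia.
Qed.

Lemma hull_empty : hull (uP (fun _ => None)).
Proof.
  destruct (elementaryP (R := fun e => forall b v, getP (at_ 0 e) b <> Some v) (e := []))
    as (p & hp & E).
  - exact (def_allB (def_allN (def_not (def_rearrange [2; 1; 0] 0 (def_atom aVal))))).
  - constructor.
  - exists (fun _ => None). discriminate.
  - cbn in E. replace (fun _ => None) with p; [exact hp|].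
    apply functional_extensionality. intros b. destruct (p b) as [v|] eqn:h; [|reflexivity].
    destruct (E b v h).
Qed.

(** Nothing else about the construction of [Y] is used later. The third clause is a collection
    principle and takes the place of a forcing theorem. *)
Definition generic (Y : cond) : Prop :=
  (forall b, hull (uB b) -> exists v, Y b = Some v) /\
  finite_to_one Y /\
  (forall R, definable R ->
     (forall n, exists q, hull (uP q) /\ sub q Y /\ R [uP q; uN n]) ->
     exists p, hull (uP p) /\ sub p Y /\ collects R p).

Lemma generic_exists : exists Y, generic Y.
Proof.
  pose (St := {s : cond * nat | hull (uP (fst s)) /\ finite_to_one (fst s)}).
  assert (step : forall k (s : St), exists t : St,
    extends (fst (proj1_sig t)) (snd (proj1_sig t)) (fst (proj1_sig s)) (snd (proj1_sig s)) /\
    snd (proj1_sig s) < snd (proj1_sig t) /\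
    decides (sat (fm_nth k)) (fst (proj1_sig t)) (snd (proj1_sig t)) /\
    exists v, fst (proj1_sig t) (getB (hull_nth k)) = Some v).
  { intros k [[p N] [hp fp]].
    destruct (generic_step k N hp fp) as (q & M & hq & hE & h).
    exists (exist _ (q, M) (conj hq (proj1 hE))). cbn. auto. }
  assert (ini : finite_to_one (fun _ => None)).
  { intros v. exists []. discriminate. }
  set (next := fun k s => proj1_sig (constructive_indefinite_description _ (step k s))).
  set (s := nat_rect (fun _ => St) (exist _ (fun _ => None, 0) (conj hull_empty ini)) next).
  set (P := fun n => fst (proj1_sig (s n))). set (N := fun n => snd (proj1_sig (s n))).
  assert (HS : forall k, extends (P (S k)) (N (S k)) (P k) (N k) /\ N k < N (S k) /\
    decides (sat (fm_nth k)) (P (S k)) (N (S k)) /\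
    exists v, P (S k) (getB (hull_nth k)) = Some v).
  { intros k. exact (proj2_sig (constructive_indefinite_description _ (step k (s k)))). }
  assert (HP : forall n, hull (uP (P n)) /\ finite_to_one (P n)).
  { intros n. exact (proj2_sig (s n)). }
  clearbody P N. clear s next.
  assert (HN : forall n, n <= N n).
  { induction n; [lia|]. destruct (HS n) as (_ & h & _). lia. }
  destruct (@chain_union P) as (Y & HY & fY).
  - apply HP.
  - intros n. apply HS.
  - intros n b v h1 h2. destruct (HS n) as ((_ & _ & _ & h3) & _).
    specialize (h3 _ _ h1 h2). specialize (HN n). lia.
  - assert (inc : forall n m, n <= m -> sub (P n) (P m)).
    { intros n m h. induction h; [apply sub_refl|eapply sub_trans; [exact IHh|apply HS]]. }
    assert (late : forall n b v, P n b = None -> Y b = Some v -> N n <= v).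
    { intros n b v h1 h2. apply HY in h2 as [m h2].
      destruct (le_lt_dec m n) as [h|h]; [apply (inc _ _ h) in h2; congruence|].
      assert (E : forall m, n <= m -> extends (P m) (N m) (P n) (N n)).
      { intros m' h'. induction h'; [apply extends_refl, HP|].
        eapply extends_trans; [apply HS|exact IHh']. }
      destruct (E m) as (_ & _ & _ & h3); [lia|]. eauto. }
    exists Y. split; [|split; [exact fY|]].
    + intros b hb. apply hull_nth_surj in hb as [k hk].
      destruct (HS k) as (_ & _ & _ & v & hv). rewrite <- hk in hv. cbn in hv.
      exists v. apply HY. eauto.
    + intros R [A hA] H. set (k := enc A).
      assert (E : sat (fm_nth k) = R).
      { unfold k. rewrite fm_nth_enc. apply functional_extensionality. intros e.
        apply propositional_extensionality, hA. }
      destruct (HS k) as (_ & _ & [[n h]|h] & _); rewrite E in h.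
      * exfalso. destruct (H n) as (q & _ & hq & hR).
        (* Joining [q] to [P (S k)] gives an extension that contains a witness for [n]: both lie
           below [Y], and by [late] the values of [Y] outside [P (S k)] are at least [N (S k)]. So
           [n] was not refuted. *)
        set (r := fun b => match P (S k) b with Some v => Some v | None => q b end).
        apply (h r (N (S k))) with (q' := q); [|..|exact hR].
        -- split; [|split; [|split; [lia|]]].
           ++ intros v. destruct (fY v) as [l hl]. exists l. intros b hb. apply hl.
              unfold r in hb. destruct (P (S k) b) eqn:Eb; [|auto].
              apply HY. exists (S k). congruence.
           ++ intros b v hb. unfold r. rewrite hb. reflexivity.
           ++ intros b v h1 h2. unfold r in h2. rewrite h1 in h2. eauto.
        -- intros b v hb. unfold r. destruct (P (S k) b) as [w|] eqn:Eb; [|exact hb].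
           assert (Y b = Some w) by (apply HY; eauto). apply hq in hb. congruence.
      * exists (P (S k)). split; [apply HP|]. split; [|exact h].
        intros b v hb. apply HY. eauto.
Qed.

(** * Semidecidable relations *)

Definition Y : cond := proj1_sig (constructive_indefinite_description _ generic_exists).

Lemma Y_generic : generic Y.
Proof. exact (proj2_sig (constructive_indefinite_description _ generic_exists)). Qed.

Lemma hull_at i e : hulls e -> hull (at_ i e).
Proof.
  intros h. revert i. induction h as [|u e hu he IH]; intros [|i]; cbn; auto using hull_N.
Qed.

Lemma hulls_skipn k e : hulls e -> hulls (skipn k e).
Proof.
  intros h. revert k. induction h as [|u e hu he IH]; intros [|k]; cbn; auto; constructor; auto.
Qed.

Lemma hulls_rearrange l k e : hulls e -> hulls (rearrange l k e).
Proof.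
  intros h. apply Forall_app. split.
  - apply Forall_map, Forall_forall. auto using hull_at.
  - destruct k; [constructor|]. apply hulls_skipn, h.
Qed.

(** The analogue of being recursively enumerable in [Y]: the finite part of an oracle used by a
    computation becomes a possibly infinite part of [Y] belonging to the hull. *)
Definition semi (R : list U -> Prop) : Prop :=
  exists G, definable G /\ forall e, hulls e ->
    (R e <-> exists p, hull (uP p) /\ sub p Y /\ G (uP p :: e)).

Lemma semi_ext R S : semi R -> (forall e, hulls e -> (R e <-> S e)) -> semi S.
Proof.
  intros (G & hG & H) E. exists G. split; [exact hG|]. intros e he.
  rewrite <- (E e he). auto.
Qed.

Lemma sub_empty q : sub (fun _ => None) q.
Proof. discriminate. Qed.

Lemma semi_def R : definable R -> semi R.
Proof.
  intros h. exists (fun e => R (skipn 1 e)). split; [exact (def_rearrange [] 2 h)|].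
  intros e he. split.
  - intros H. exists (fun _ => None). auto using hull_empty, sub_empty.
  - intros (p & _ & _ & H). exact H.
Qed.

Lemma semi_rearrange l k R : semi R -> semi (fun e => R (rearrange l k e)).
Proof.
  intros (G & hG & H).
  exists (fun e => G (rearrange (0 :: map S l) (match k with 0 => 0 | S k => S (S k) end) e)).
  split; [apply def_rearrange, hG|]. intros e he.
  rewrite (H _ (hulls_rearrange l k he)).
  assert (E : forall p, rearrange (0 :: map S l) (match k with 0 => 0 | S k => S (S k) end)
      (uP p :: e) = uP p :: rearrange l k e).
  { intros p. unfold rearrange. rewrite map_cons, map_map. destruct k; reflexivity. }
  split; intros (p & h1 & h2 & h3); exists p; rewrite E in *; auto.
Qed.

Lemma semi_shift R : semi R -> semi (fun e => R (skipn 1 e)).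
Proof. exact (@semi_rearrange [] 2 R). Qed.

Lemma hull_union p q : hull (uP p) -> hull (uP q) -> sub p Y -> sub q Y ->
  exists r, hull (uP r) /\ sub p r /\ sub q r /\ sub r Y.
Proof.
  intros hp hq sp sq.
  destruct (elementaryP (def_atom aUnion) (e := [uP p; uP q])) as (r & hr & H).
  - repeat constructor; assumption.
  - exists (fun b => match p b with Some v => Some v | None => q b end). cbn.
    intros b v. destruct (p b) as [w|] eqn:E1; [|intuition congruence].
    split; [auto|]. intros [h|h]; [exact h|].
    apply sp in E1. apply sq in h. congruence.
  - cbn in H. exists r. split; [exact hr|].
    split; [|split]; intros b v h; specialize (H b v); [tauto|tauto|].
    apply H in h as [h|h]; auto.
Qed.

(** As [G] and [G'] need not be monotone, the common condition contains the two witnesses as parts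
    and does not itself satisfy both. *)
Lemma semi_and R S : semi R -> semi S -> semi (fun e => R e /\ S e).
Proof.
  intros (G & hG & H) (G' & hG' & H').
  exists (fun e => (exists q, sub q (getP (at_ 0 e)) /\ G (uP q :: skipn 1 e)) /\
                   (exists q, sub q (getP (at_ 0 e)) /\ G' (uP q :: skipn 1 e))).
  split.
  - apply def_and; refine (def_exP (def_and (def_rearrange [0; 1] 0 (def_atom aSub))
      (def_rearrange [0] 3 _))); assumption.
  - intros e he. rewrite (H e he), (H' e he). cbn. split.
    + intros [(p & h1 & h2 & h3) (q & h4 & h5 & h6)].
      destruct (hull_union h1 h4 h2 h5) as (r & hr & h7 & h8 & h9). exists r. eauto 10.
    + intros (p & hp & sp & H1 & H2).
      split.
      * destruct (elementaryP (def_and (def_rearrange [0; 1] 0 (def_atom aSub))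
          (def_rearrange [0] 3 hG)) (e := uP p :: e)) as (q & hq & h1 & h2).
        -- constructor; assumption.
        -- exact H1.
        -- exists q. split; [exact hq|]. split; [eapply sub_trans; eassumption|exact h2].
      * destruct (elementaryP (def_and (def_rearrange [0; 1] 0 (def_atom aSub))
          (def_rearrange [0] 3 hG')) (e := uP p :: e)) as (q & hq & h1 & h2).
        -- constructor; assumption.
        -- exact H2.
        -- exists q. split; [exact hq|]. split; [eapply sub_trans; eassumption|exact h2].
Qed.

Lemma semi_or R S : semi R -> semi S -> semi (fun e => R e \/ S e).
Proof.
  intros (G & hG & H) (G' & hG' & H').
  exists (fun e => G e \/ G' e). split; [apply def_or; assumption|].
  intros e he. rewrite (H e he), (H' e he). split.
  - intros [(p & h)|(p & h)]; exists p; tauto.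
  - intros (p & h1 & h2 & [h|h]); [left|right]; eauto.
Qed.

Lemma semi_ex R : semi R -> semi (fun e => exists u, hull u /\ R (u :: e)).
Proof.
  intros (G & hG & H).
  pose proof (def_rearrange [1; 0] 3 hG) as D.
  exists (fun e => exists u, G (at_ 0 e :: u :: skipn 1 e)).
  split; [exact (def_ex D)|].
  intros e he. split.
  - intros (u & hu & h). apply H in h as (p & h1 & h2 & h3); [|constructor; assumption].
    exists p. eauto.
  - intros (p & h1 & h2 & h3).
    destruct (elementary D (e := uP p :: e)) as (u & hu & h).
    + constructor; assumption.
    + exact h3.
    + exists u. split; [exact hu|]. apply H; [constructor; assumption|]. eauto.
Qed.

Lemma semi_exB R : semi R -> semi (fun e => exists b, hull (uB b) /\ R (uB b :: e)).
Proof.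
  intros h. eapply semi_ext; [apply (semi_ex (semi_and (semi_def (def_atom aIsB)) h))|].
  intros e he. cbn. split.
  - intros (u & hu & E & h'). rewrite E in hu, h'. eauto.
  - intros (b & hb & h'). eauto.
Qed.

Lemma semi_exN R : semi R -> semi (fun e => exists n, R (uN n :: e)).
Proof.
  intros h. eapply semi_ext; [apply (semi_ex (semi_and (semi_def (def_atom aIsN)) h))|].
  intros e he. cbn. split.
  - intros (u & hu & E & h'). rewrite E in h'. eauto.
  - intros (n & h'). eauto using hull_N.
Qed.

(** This is the collection clause of [generic]. That clause concerns relations without parameters,
    so [e] is eliminated beforehand by [def_subst_hulls2]. *)
Lemma semi_allN R : semi R -> semi (fun e => forall n, R (uN n :: e)).
Proof.
  intros (G & hG & H).
  pose proof (def_and (def_rearrange [0; 2] 0 (def_atom aSub)) (def_rearrange [0; 1] 4 hG)) as D.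
  exists (fun e => forall n, exists q, sub q (getP (at_ 0 e)) /\ G (uP q :: uN n :: skipn 1 e)).
  split; [exact (def_allN (def_exP D))|].
  intros e he.
  assert (he' : forall n, hulls (uN n :: e)) by (constructor; auto using hull_N).
  split.
  - intros HR.
    destruct (proj2 (proj2 Y_generic) _ (def_subst_hulls2 hG he)) as (p & hp & sp & C).
    + intros n. destruct (proj1 (H _ (he' n)) (HR n)) as (q & h). exists q. exact h.
    + exists p. split; [exact hp|]. split; [exact sp|exact C].
  - intros (p & hp & sp & C) n. apply H; [apply he'|].
    destruct (elementaryP D (e := uN n :: uP p :: e)) as (q & hq & h1 & h2).
    + repeat constructor; auto using hull_N.
    + exact (C n).
    + exists q. split; [exact hq|]. split; [eapply sub_trans; eassumption|exact h2].
Qed.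

Lemma semi_subst u R : semi R -> hull u -> semi (fun e => R (u :: e)).
Proof.
  intros (G & hG & H) hu. exists (fun e => G (at_ 0 e :: u :: skipn 1 e)).
  split; [apply def_subst_hull; assumption|].
  intros e he. apply H. constructor; assumption.
Qed.

Lemma semi_Y : semi (fun e => Y (getB (at_ 0 e)) = Some (getN (at_ 1 e))).
Proof.
  exists (atom_holds aVal). split; [apply def_atom|]. intros e he. cbn. split.
  - intros h.
    destruct (elementaryP (def_atom aSingle) (e := e)) as (p & hp & H); [exact he| |].
    + exists (fun b => if excluded_middle_informative (b = getB (at_ 0 e))
                       then Some (getN (at_ 1 e)) else None).
      cbn. intros b v. destruct excluded_middle_informative; [|intuition congruence].
      split; [intros [= <-]; auto|intros [_ <-]; reflexivity].
    + cbn in H. exists p. split; [exact hp|]. split; [|apply H; auto].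
      intros b v hb. apply H in hb as [-> ->]. exact h.
  - intros (p & hp & sp & h). apply sp, h.
Qed.

(** A semidecidable graph suffices: as [F] is total, a wrong value is recognised by exhibiting the
    right one, so the complement of the graph is semidecidable too. *)
Definition natplot (F : list U -> nat) : Prop :=
  semi (fun e => getN (at_ 0 e) = F (skipn 1 e)).

Lemma natplot_ext F F' : natplot F -> (forall e, hulls e -> F e = F' e) -> natplot F'.
Proof.
  intros h E. eapply semi_ext; [exact h|]. intros e he. cbn beta.
  rewrite E; [reflexivity|]. apply hulls_skipn, he.
Qed.

Lemma semi_fun R F : semi R -> natplot F -> semi (fun e => R (uN (F e) :: e)).
Proof.
  intros hR hF. eapply semi_ext; [apply (semi_exN (semi_and hF hR))|].
  intros e he. cbn. split.
  - intros (n & -> & h). exact h.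
  - intros h. eauto.
Qed.

Lemma natplot_skipn k F : natplot F -> natplot (fun e => F (skipn k e)).
Proof.
  intros h. eapply semi_ext; [exact (semi_rearrange [0] (S (S k)) h)|].
  intros e he. unfold rearrange. cbn [map app skipn nth].
  destruct e; [rewrite skipn_nil|]; reflexivity.
Qed.

Lemma natplot_const n : natplot (fun _ => n).
Proof.
  eapply semi_ext; [exact (semi_subst (semi_def (def_atom aEqN)) (hull_N n))|].
  intros e he. cbn. split; auto.
Qed.

Lemma natplot_at i : natplot (fun e => getN (at_ i e)).
Proof.
  eapply semi_ext; [exact (semi_def (def_rearrange [0; S i] 0 (def_atom aEqN)))|].
  intros [|u e] he; cbn; destruct i; reflexivity.
Qed.

Lemma semi_fun2 R F G : semi R -> natplot F -> natplot G ->
  semi (fun e => R (uN (F e) :: uN (G e) :: e)).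
Proof.
  intros hR hF hG. exact (semi_fun (semi_fun hR (natplot_skipn 1 hF)) hG).
Qed.

Lemma semi_eq F G : natplot F -> natplot G -> semi (fun e => F e = G e).
Proof. exact (semi_fun2 (semi_def (def_atom aEqN))). Qed.

Lemma semi_neq F G : natplot F -> natplot G -> semi (fun e => F e <> G e).
Proof. exact (semi_fun2 (semi_def (def_not (def_atom aEqN)))). Qed.

Lemma natplot_app b F : hull (uB b) -> natplot F -> natplot (fun e => b (F e)).
Proof.
  intros hb hF.
  eapply semi_ext; [exact (semi_fun (semi_subst (semi_def (def_atom aApp)) hb)
    (natplot_skipn 1 hF))|].
  intros e he. cbn. split; auto.
Qed.

Lemma natplot_nth F G :
  natplot F -> natplot G -> natplot (fun e => nth (F e) (dec_list (G e)) 0).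
Proof.
  intros hF hG.
  eapply semi_ext; [exact (semi_fun2 (semi_def (def_rearrange [2; 1; 0] 0 (def_atom aNth)))
    (natplot_skipn 1 hF) (natplot_skipn 1 hG))|].
  intros e he. reflexivity.
Qed.

Definition bool_nat (P : Prop) : nat := if excluded_middle_informative P then 1 else 0.

Lemma natplot_bool R : semi R -> semi (fun e => ~ R e) -> natplot (fun e => bool_nat (R e)).
Proof.
  intros h h'.
  eapply semi_ext; [apply semi_or; apply semi_and;
    [exact (semi_shift h)|exact (semi_eq (natplot_at 0) (natplot_const 1))
    |exact (semi_shift h')|exact (semi_eq (natplot_at 0) (natplot_const 0))]|].
  intros e he. unfold bool_nat. cbn beta.
  destruct excluded_middle_informative; intuition congruence.
Qed.

Lemma semi_le F G : natplot F -> natplot G -> semi (fun e => F e <= G e).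
Proof. exact (semi_fun2 (semi_def (def_atom aLe))). Qed.

Lemma natplot_succ F : natplot F -> natplot (fun e => S (F e)).
Proof.
  intros hF. exact (semi_fun2 (semi_def (def_atom aSucc)) (natplot_at 0) (natplot_skipn 1 hF)).
Qed.

Lemma natplot_pair F G :
  natplot F -> natplot G -> natplot (fun e => Cantor.to_nat (F e, G e)).
Proof.
  intros hF hG.
  eapply semi_ext; [exact (semi_fun2 (semi_def (def_rearrange [2; 0; 1] 0 (def_atom aPair)))
    (natplot_skipn 1 hF) (natplot_skipn 1 hG))|].
  intros e he. reflexivity.
Qed.

Lemma natplot_getB i j : natplot (fun e => getB (at_ i e) (getN (at_ j e))).
Proof.
  eapply semi_ext; [exact (semi_def (def_rearrange [S i; S j; 0] 0 (def_atom aApp)))|].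
  intros [|u e] he; cbn; destruct i, j; split; auto.
Qed.

(** This is why adding [Y] adds no functions. Collection gives one [p] in the hull whose parts
    witness every value of [f]. By elementarity some [b] in the hull has all its values witnessed by
    parts of [p]; these are parts of [Y], so the values are correct and [b] equals [f]. *)
Lemma hull_of_natplot f : natplot (fun e => f (getN (at_ 0 e))) -> hull (uB f).
Proof.
  intros (G & hG & H).
  destruct (proj2 (proj2 Y_generic) (fun e => exists v, G [at_ 0 e; uN v; at_ 1 e]))
    as (p & hp & sp & C).
  - exact (def_exN (def_rearrange [1; 0; 2] 0 hG)).
  - intros n. destruct (H [uN (f n); uN n]) as [(q & h1 & h2 & h3) _].
    + repeat constructor; apply hull_N.
    + reflexivity.
    + exists q. eauto.
  - assert (D : definable (fun e => exists q, sub q (getP (at_ 3 e)) /\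
        G [uP q; at_ 0 e; at_ 1 e])).
    { exact (def_exP (def_and (def_rearrange [0; 4] 0 (def_atom aSub))
        (def_rearrange [0; 1; 2] 0 hG))). }
    destruct (elementaryB (R := fun e => forall n v, getB (at_ 0 e) n = v ->
        exists q, sub q (getP (at_ 1 e)) /\ G [uP q; uN v; uN n]) (e := [uP p]))
      as (b & hb & Hb).
    + exact (def_allN (def_allN (def_imp (def_rearrange [2; 1; 0] 0 (def_atom aApp)) D))).
    + repeat constructor; assumption.
    + cbn in *.
      assert (E : forall n, exists v q, sub q p /\ G [uP q; uN v; uN n]).
      { intros n. destruct (C n) as (q & h1 & v & h2). eauto. }
      exists (fun n => proj1_sig (constructive_indefinite_description _ (E n))).
      intros n v <-. apply (proj2_sig (constructive_indefinite_description _ (E n))).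
    + cbn in Hb. replace f with b; [exact hb|]. apply functional_extensionality. intros n.
      destruct (elementaryP (def_and (def_rearrange [0; 3] 0 (def_atom aSub))
        (def_rearrange [0; 1; 2] 0 hG)) (e := [uN (b n); uN n; uP p])) as (q & hq & h1 & h2).
      * repeat constructor; auto using hull_N.
      * exact (Hb n _ eq_refl).
      * apply (H [uN (b n); uN n]); [repeat constructor; apply hull_N|].
        exists q. split; [exact hq|]. split; [eapply sub_trans; eassumption|exact h2].
Qed.

Definition slice (g : real) (n : nat) : real := fun k => g (Cantor.to_nat (n, k)).

Lemma hull_slice g n : hull (uB g) -> hull (uB (slice g n)).
Proof.
  intros hg. destruct (elementaryB (def_atom aSlice) (e := [uB g; uN n])) as (b & hb & H).
  - repeat constructor; auto using hull_N.
  - exists (slice g n). intros k. reflexivity.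
  - cbn in H. replace (slice g n) with b; [exact hb|].
    apply functional_extensionality. exact H.
Qed.

(** The argument is that of [hull_of_natplot], with function witnesses that need not be unique. They
    are packed as the slices of one function, which elementarity can then find in the hull. *)
Lemma semi_choice R : semi R ->
  (forall n, exists b, hull (uB b) /\ R [uB b; uN n]) ->
  exists g, hull (uB g) /\ forall n, R [uB (slice g n); uN n].
Proof.
  intros (G & hG & H) HR.
  destruct (proj2 (proj2 Y_generic) (fun e => exists b, G [at_ 0 e; uB b; at_ 1 e]))
    as (p & hp & sp & C).
  - exact (def_exB (def_rearrange [1; 0; 2] 0 hG)).
  - intros n. destruct (HR n) as (b & hb & h). apply H in h as (q & h1 & h2 & h3).
    + exists q. eauto.
    + repeat constructor; auto using hull_N.
  - assert (D : definable (fun e => exists q, sub q (getP (at_ 3 e)) /\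
        G [uP q; at_ 0 e; at_ 1 e])).
    { exact (def_exP (def_and (def_rearrange [0; 4] 0 (def_atom aSub))
        (def_rearrange [0; 1; 2] 0 hG))). }
    destruct (elementaryB (R := fun e => forall n b,
        (forall k, b k = getB (at_ 0 e) (Cantor.to_nat (n, k))) ->
        exists q, sub q (getP (at_ 1 e)) /\ G [uP q; uB b; uN n]) (e := [uP p]))
      as (g & hg & Hg).
    + exact (def_allN (def_allB (def_imp (def_rearrange [0; 2; 1] 0 (def_atom aSlice)) D))).
    + repeat constructor; assumption.
    + cbn in *.
      assert (E : forall n, exists b q, sub q p /\ G [uP q; uB b; uN n]).
      { intros n. destruct (C n) as (q & h1 & b & h2). eauto. }
      set (c := fun n => proj1_sig (constructive_indefinite_description _ (E n))).
      exists (fun m => let (n, k) := Cantor.of_nat m in c n k).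
      intros n b hb. replace b with (c n).
      * apply (proj2_sig (constructive_indefinite_description _ (E n))).
      * apply functional_extensionality. intros k.
        specialize (hb k). change (b k = (let (n', k') := Cantor.of_nat (Cantor.to_nat (n, k)) in
          c n' k')) in hb. rewrite hb, Cantor.cancel_of_to. reflexivity.
    + cbn in Hg. exists g. split; [exact hg|]. intros n.
      assert (hs : hull (uB (slice g n))) by apply hull_slice, hg.
      destruct (elementaryP (def_and (def_rearrange [0; 3] 0 (def_atom aSub))
        (def_rearrange [0; 1; 2] 0 hG)) (e := [uB (slice g n); uN n; uP p])) as (q & hq & h1 & h2).
      * repeat constructor; auto using hull_N.
      * exact (Hg n _ (fun k => eq_refl)).
      * apply H; [repeat constructor; auto using hull_N|].
        exists q. split; [exact hq|]. split; [eapply sub_trans; eassumption|exact h2].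
Qed.

(** * The type structure *)

(** A type is interpreted by a set together with its admissible families
    ("plots"), indexed by the environments [list U]. *)
Fixpoint space (s : ty) : {X : Type & (list U -> X) -> Prop} :=
  match s with
  | T0 => existT (fun X : Type => (list U -> X) -> Prop) nat natplot
  | Arr s t =>
      let X := space s in
      let Z := space t in
      existT (fun X : Type => (list U -> X) -> Prop)
        {f : projT1 X -> projT1 Z | forall a, projT2 X a -> projT2 Z (fun e => f (a e))}
        (fun b => forall k a, projT2 X a ->
           projT2 Z (fun e => proj1_sig (b (skipn k e)) (a e)))
  end.

Definition ob (s : ty) : Type := projT1 (space s).
Definition plot (s : ty) : (list U -> ob s) -> Prop := projT2 (space s).
Arguments plot s _ : clear implicits.

Definition app s t (f : ob (s --> t)) (x : ob s) : ob t := proj1_sig f x.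

Definition arr s t (f : ob s -> ob t)
    (h : forall a, plot s a -> plot t (fun e => f (a e))) : ob (s --> t) :=
  exist _ f h.

Lemma arr_ext s t (f g : ob (s --> t)) : (forall x, app f x = app g x) -> f = g.
Proof.
  destruct f as [f hf], g as [g hg]. cbn. intros E.
  assert (f = g) as -> by (apply functional_extensionality; exact E).
  f_equal. apply proof_irrelevance.
Qed.

Lemma plot_const s (x : ob s) : plot s (fun _ => x).
Proof.
  revert x. induction s as [|s _ t IH]; intros x.
  - apply natplot_const.
  - intros k a ha. exact (proj2_sig x a ha).
Qed.

(** The quantifier over [k] in the arrow clause is needed here: quantifiers push entries in front of
    the environment, and a family must remain admissible when read in the longer one. *)
Lemma plot_skipn s k a : plot s a -> plot s (fun e => a (skipn k e)).
Proof.
  destruct s as [|s t]; [apply natplot_skipn|]. intros h j c hc.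
  replace (fun e => _) with (fun e => proj1_sig (a (skipn (k + j) e)) (c e)).
  - exact (h (k + j) c hc).
  - apply functional_extensionality; intros e. rewrite skipn_skipn. reflexivity.
Qed.

Lemma plot_app s t f a :
  plot (s --> t) f -> plot s a -> plot t (fun e => app (f e) (a e)).
Proof. intros hf ha. exact (hf 0 a ha). Qed.

Lemma plot_arr s t (f : list U -> ob (s --> t)) :
  (forall k a, plot s a -> plot t (fun e => app (f (skipn k e)) (a e))) ->
  plot (s --> t) f.
Proof. exact (fun h => h). Qed.

Definition ob_succ : ob (T0 --> T0) := arr (s := T0) (t := T0) natplot_succ.

Definition ob_pi1 s t (x : ob s) : ob (t --> s) :=
  arr (fun a _ => plot_const x).
Definition ob_pi s t : ob (s --> t --> s).
Proof.
  refine (arr (s := s) (t := t --> s) (f := @ob_pi1 s t) _).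
  intros a ha. apply plot_arr. intros k c hc. exact (plot_skipn k ha).
Defined.

Definition ob_sigma2 r s t (x : ob (r --> s --> t)) (y : ob (r --> s)) : ob (r --> t).
Proof.
  refine (arr (f := fun z => app (app x z) (app y z)) _).
  intros a ha. apply plot_app; apply plot_app; auto using plot_const.
Defined.

Definition ob_sigma1 r s t (x : ob (r --> s --> t)) : ob ((r --> s) --> r --> t).
Proof.
  refine (arr (s := r --> s) (t := r --> t) (f := ob_sigma2 x) _).
  intros a ha. apply plot_arr. intros k c hc.
  apply (plot_app (f := fun e => app x (c e)) (a := fun e => app (a (skipn k e)) (c e)));
    apply plot_app; auto using plot_const, plot_skipn.
Defined.

Definition ob_sigma r s t : ob ((r --> s --> t) --> (r --> s) --> r --> t).
Proof.
  refine (arr (s := r --> s --> t) (t := (r --> s) --> r --> t) (f := @ob_sigma1 r s t) _).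
  intros a ha. apply plot_arr. intros k b hb. apply plot_arr. intros j c hc.
  apply (plot_app (f := fun e => app (a (skipn k (skipn j e))) (c e))
                  (a := fun e => app (b (skipn j e)) (c e)));
    apply plot_app; auto using plot_const, plot_skipn.
  apply (plot_skipn j (a := fun e => a (skipn k e))), plot_skipn, ha.
Defined.

Definition rec_nat (x y : nat) (z : ob (T0 --> T0 --> T0)) : nat :=
  nat_rec (fun _ => nat) y (fun k r => app (app z r) k) x.

(** The usual arithmetization of primitive recursion: some number codes the sequence of intermediate
    values. That the sequence is correct at every step is a universal number quantifier, so
    [semi_allN] and hence genericity enter. *)
Lemma natplot_rec x y z : natplot x -> natplot y -> plot (T0 --> T0 --> T0) z ->
  natplot (fun e => rec_nat (x e) (y e) (z e)).
Proof.
  intros hx hy hz.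
  pose (seqn := fun c i => nth i (dec_list c) 0).
  assert (hs : forall f g, natplot f -> natplot g -> natplot (fun e => seqn (f e) (g e))).
  { intros f g hf hg. exact (natplot_nth hg hf). }
  assert (D : semi (fun e => x (skipn 3 e) <= getN (at_ 0 e) \/
      seqn (getN (at_ 1 e)) (S (getN (at_ 0 e))) =
      app (app (z (skipn 3 e)) (seqn (getN (at_ 1 e)) (getN (at_ 0 e)))) (getN (at_ 0 e)))).
  { apply semi_or.
    - apply semi_le; auto using natplot_skipn, natplot_at.
    - apply semi_eq; [apply hs; auto using natplot_at, natplot_succ|].
      apply (plot_app (s := T0) (t := T0) (f := fun e => app (z (skipn 3 e)) _)
              (a := fun e => getN (at_ 0 e))); [|apply natplot_at].
      apply (plot_app (s := T0) (t := T0 --> T0)); [apply plot_skipn, hz|].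
      apply hs; apply natplot_at. }
  assert (D' : semi (fun e => (seqn (getN (at_ 0 e)) 0 = y (skipn 2 e) /\
      forall i, x (skipn 2 e) <= i \/ seqn (getN (at_ 0 e)) (S i) =
        app (app (z (skipn 2 e)) (seqn (getN (at_ 0 e)) i)) i) /\
      getN (at_ 1 e) = seqn (getN (at_ 0 e)) (x (skipn 2 e)))).
  { apply semi_and; [apply semi_and|].
    - apply semi_eq; [apply hs|]; auto using natplot_at, natplot_const, natplot_skipn.
    - exact (semi_allN D).
    - apply semi_eq; [|apply hs]; auto using natplot_at, natplot_skipn. }
  eapply semi_ext; [exact (semi_exN D')|].
  intros e he. cbn [nth skipn getN]. set (d := skipn 1 e).
  replace (match e with [] => [] | _ :: l => l end) with d by (destruct e; reflexivity).
  split.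
  - intros (c & (h0 & hS) & hv). rewrite hv.
    assert (E : forall i, i <= x d -> seqn c i = rec_nat i (y d) (z d)).
    { induction i as [|i IH]; intros hi; [exact h0|].
      destruct (hS i) as [h|h]; [lia|]. rewrite h, IH by lia. reflexivity. }
    apply E. lia.
  - intros ->.
    exists (enc_list (map (fun i => rec_nat i (y d) (z d)) (seq 0 (S (x d))))).
    assert (E : forall i, i <= x d -> seqn (enc_list (map (fun i => rec_nat i (y d) (z d))
        (seq 0 (S (x d))))) i = rec_nat i (y d) (z d)).
    { intros i hi. unfold seqn. rewrite dec_enc_list.
      rewrite (nth_indep _ 0 (rec_nat 0 (y d) (z d))) by (rewrite length_map, length_seq; lia).
      rewrite (map_nth (fun i => rec_nat i (y d) (z d))), seq_nth by lia. reflexivity. }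
    split; [split|].
    + apply E. lia.
    + intros i. destruct (le_lt_dec (x d) i) as [h|h]; [left; exact h|right].
      rewrite !E by lia. reflexivity.
    + symmetry. apply E. lia.
Qed.

Definition ob_rec2 (x y : nat) : ob ((T0 --> T0 --> T0) --> T0).
Proof.
  refine (arr (s := T0 --> T0 --> T0) (t := T0) (f := rec_nat x y) _).
  intros a ha. apply natplot_rec; auto using natplot_const.
Defined.

Definition ob_rec1 (x : nat) : ob (T0 --> (T0 --> T0 --> T0) --> T0).
Proof.
  refine (arr (s := T0) (t := (T0 --> T0 --> T0) --> T0) (f := ob_rec2 x) _).
  intros a ha. apply plot_arr. intros k c hc.
  apply natplot_rec; [apply natplot_const|apply natplot_skipn, ha|exact hc].
Defined.

Definition ob_rec : ob (T0 --> T0 --> (T0 --> T0 --> T0) --> T0).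
Proof.
  refine (arr (s := T0) (t := T0 --> (T0 --> T0 --> T0) --> T0) (f := ob_rec1) _).
  intros a ha. apply plot_arr. intros k b hb. apply plot_arr. intros j c hc.
  apply natplot_rec; [|apply natplot_skipn, hb|exact hc].
  apply (natplot_skipn j (F := fun e => a (skipn k e))), natplot_skipn, ha.
Defined.

Definition fn (f : ob T1) : real := proj1_sig f.

(** Evaluated at the variable itself as a plot, the admissibility of [f] says that its graph is
    semidecidable. With [real_ob] as converse, the type 1 objects are exactly the functions of the
    hull. *)
Lemma hull_fn f : hull (uB (fn f)).
Proof. apply hull_of_natplot. exact (proj2_sig f _ (natplot_at 0)). Qed.

Definition real_ob (b : real) (h : hull (uB b)) : ob T1 :=
  arr (s := T0) (t := T0) (fun a ha => natplot_app h ha).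

Lemma fn_inj f g : fn f = fn g -> f = g.
Proof. intros E. apply arr_ext. intros x. exact (f_equal (fun b => b x) E). Qed.

(** The function [fn (a e)] is guessed in the hull and compared with the family at all arguments;
    existential function quantifiers and number quantifiers both preserve semidecidability. *)
Lemma semi_funB R a : semi R -> plot T1 a -> semi (fun e => R (uB (fn (a e)) :: e)).
Proof.
  intros hR ha.
  pose proof (natplot_getB 1 0) as hB.
  assert (hA : natplot (fun e => fn (a (skipn 2 e)) (getN (at_ 0 e)))).
  { exact (ha 2 _ (natplot_at 0)). }
  eapply semi_ext; [exact (semi_exB (semi_and (semi_allN (semi_eq hB hA)) hR))|].
  intros e he. cbn [nth skipn getN getB]. split.
  - intros (b & hb & E & h). assert (b = fn (a e)) as ->; [|exact h].
    apply functional_extensionality. exact E.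
  - intros h. exists (fn (a e)). auto using hull_fn.
Qed.

Lemma plot_T1 a : natplot (fun e => fn (a (skipn 1 e)) (getN (at_ 0 e))) -> plot T1 a.
Proof.
  intros h. apply plot_arr. intros k c hc.
  assert (h' : semi (fun e => getN (at_ 1 e) = fn (a (skipn k (skipn 2 e))) (getN (at_ 0 e)))).
  { eapply semi_ext; [exact (semi_rearrange [1; 0] (S (k + 2)) h)|].
    intros e he. rewrite skipn_skipn. reflexivity. }
  exact (semi_fun h' (natplot_skipn 1 hc)).
Qed.

(** * Soundness *)

Definition env (G : ctx) : Type := forall s, var G s -> ob s.

Definition econs G s (x : ob s) (r : env G) : env (s :: G) :=
  var_case (P := fun t _ => ob t) x r.

Fixpoint eval G s (a : tm G s) (r : env G) : ob s :=
  match a in tm _ s return ob s with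
  | Var x => r _ x
  | Zero => 0
  | Succ => ob_succ
  | Pi => ob_pi _ _
  | Sigma => ob_sigma _ _ _
  | Rec => ob_rec
  | App a b => app (eval a r) (eval b r)
  end.

Fixpoint holds G (A : form G) : env G -> Prop :=
  match A with
  | Eq a b => fun r => eval a r = eval b r
  | Bot => fun _ => False
  | And A B => fun r => holds A r /\ holds B r
  | Or A B => fun r => holds A r \/ holds B r
  | Imp A B => fun r => holds A r -> holds B r
  | All s A => fun r => forall x, holds A (econs x r)
  | Ex s A => fun r => exists x, holds A (econs x r)
  end.

Lemma env_ext G s (r r' : env (s :: G)) :
  r _ VZ = r' _ VZ -> (forall t (y : var G t), r _ (VS y) = r' _ (VS y)) -> r = r'.
Proof.
  intros E1 E2. apply functional_extensionality_dep; intros t.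
  apply functional_extensionality_dep; intros x. revert t x.
  apply var_case; auto.
Qed.

Lemma eval_tsub G D (f : subst G D) s (a : tm G s) (r : env D) :
  eval (tsub f a) r = eval a (fun _ x => eval (f _ x) r).
Proof. induction a; cbn [tsub eval]; congruence. Qed.

Lemma eval_up G s t (a : tm G t) (x : ob s) (r : env G) : eval (up a) (econs x r) = eval a r.
Proof. unfold up. rewrite eval_tsub. reflexivity. Qed.

Lemma eval_lift G D (f : subst G D) s (x : ob s) (r : env D) :
  (fun _ y => eval (lift f (s := s) y) (econs x r)) = econs x (fun _ y => eval (f _ y) r).
Proof. apply env_ext; [reflexivity|]. intros t y. apply eval_up. Qed.

Lemma holds_fsub G (A : form G) : forall D (f : subst G D) (r : env D),
  holds (fsub A f) r <-> holds A (fun _ x => eval (f _ x) r).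
Proof.
  induction A; intros D f r; cbn [fsub holds]; rewrite ?eval_tsub.
  1-2: reflexivity.
  1-3: rewrite IHA1, IHA2; reflexivity.
  - split; intros h x; specialize (h x); [rewrite IHA, eval_lift in h|rewrite IHA, eval_lift];
      exact h.
  - split; intros [x h]; exists x; [rewrite IHA, eval_lift in h|rewrite IHA, eval_lift];
      exact h.
Qed.

Lemma holds_inst G s (A : form (s :: G)) (a : tm G s) (r : env G) :
  holds (inst A a) r <-> holds A (econs (eval a r) r).
Proof.
  unfold inst. rewrite holds_fsub.
  replace (fun _ x => eval (scons a _ x) r) with (econs (eval a r) r); [reflexivity|].
  apply env_ext; reflexivity.
Qed.

Lemma holds_fup G s (A : form G) (x : ob s) (r : env G) :
  holds (fup A) (econs x r) <-> holds A r.
Proof. unfold fup. rewrite holds_fsub. reflexivity. Qed.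

Lemma holds_map_fup G s (H : list (form G)) (x : ob s) (r : env G) :
  (forall B, In B H -> holds B r) ->
  forall B, In B (map (fup (s := s)) H) -> holds B (econs x r).
Proof. intros h B hB. apply in_map_iff in hB as (C & <- & hC). apply holds_fup; auto. Qed.

Definition valid (T : theory) : Prop := forall G (A : form G), @T G A -> forall r, holds A r.

Lemma soundness T G (H : list (form G)) A : valid T -> derives T H A ->
  forall r, (forall B, In B H -> holds B r) -> holds A r.
Proof.
  intros V D. induction D; intros r h; cbn [holds] in *.
  - apply V; assumption.
  - auto.
  - intros hA. apply IHD. intros C [<-|hC]; auto.
  - auto.
  - auto.
  - apply (IHD r h).
  - apply (IHD r h).
  - auto.
  - auto.
  - destruct (IHD1 r h) as [h'|h']; [apply IHD2|apply IHD3]; intros C' [<-|hC]; auto.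
  - apply NNPP. intros hA. apply (IHD r). intros C [<-|hC]; [exact hA|auto].
  - intros x. apply IHD, holds_map_fup, h.
  - apply holds_inst, IHD, h.
  - exists (eval a r). apply holds_inst. auto.
  - destruct (IHD1 r h) as [x hx]. apply (holds_fup C x r), IHD2.
    intros B [<-|hB]; [exact hx|]. eapply holds_map_fup; eassumption.
Qed.

(** Objects of arrow type are determined by their values, by proof irrelevance, so extensional
    equality is identity. This validates the axiom of extensionality. *)
Lemma holds_eqt s : forall G (a b : tm G s) r, holds (eqt a b) r <-> eval a r = eval b r.
Proof.
  induction s as [|s _ t IH]; intros G a b r; [reflexivity|]. cbn [eqt holds]. split.
  - intros h. apply arr_ext. intros x. specialize (h x). apply IH in h.
    cbn [eval] in h. rewrite !eval_up in h. exact h.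
  - intros E x. apply IH. cbn [eval]. rewrite !eval_up, E. reflexivity.
Qed.

Lemma plot_eval G s (a : tm G s) (r : list U -> env G) :
  (forall t x, plot t (fun e => r e t x)) -> plot s (fun e => eval a (r e)).
Proof.
  intros h. induction a; cbn [eval]; try apply plot_const; [apply h|].
  apply (plot_app IHa1 IHa2).
Qed.

(** The negation is carried along since semidecidable relations are not closed under complement; for
    equations it is supplied by [semi_neq]. *)
Lemma semi_qf G (A : form G) : quantifier_free A = true ->
  forall r : list U -> env G, (forall t x, plot t (fun e => r e t x)) ->
  semi (fun e => holds A (r e)) /\ semi (fun e => ~ holds A (r e)).
Proof.
  induction A as [G a b|G|G A IHA B IHB|G A IHA B IHB|G A IHA B IHB|G s A IHA|G s A IHA];
    cbn [quantifier_free holds]; intros Q r hr; try discriminate;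
    try (apply andb_prop in Q as [Q1 Q2]; specialize (IHA Q1 r hr) as [A1 A2];
         specialize (IHB Q2 r hr) as [B1 B2]).
  - split; [apply semi_eq|apply semi_neq]; apply (plot_eval (s := T0)), hr.
  - assert (T : semi (fun e => 0 = 0)) by (apply semi_eq; apply natplot_const).
    assert (F : semi (fun e => 0 = 1)) by (apply semi_eq; apply natplot_const).
    split; [apply (semi_ext F)|apply (semi_ext T)]; intros e _; split; easy.
  - split; [apply semi_and; assumption|].
    apply (semi_ext (semi_or A2 B2)). intros e _. tauto.
  - split; [apply semi_or; assumption|].
    apply (semi_ext (semi_and A2 B2)). intros e _. tauto.
  - split; [apply (semi_ext (semi_or A2 B1))|apply (semi_ext (semi_and A1 B2))];
      intros e _; tauto.
Qed.

Lemma plot_econs G s (a : list U -> ob s) (r : list U -> env G) :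
  plot s a -> (forall t x, plot t (fun e => r e t x)) ->
  forall t x, plot t (fun e => econs (a e) (r e) x).
Proof. intros ha hr. apply var_case; [exact ha|exact hr]. Qed.

(** Minimality is stated as a disjunction so that each disjunct becomes a semidecidable relation. *)
Lemma least (P : nat -> Prop) : (exists n, P n) ->
  exists n, P n /\ forall m, n <= m \/ ~ P m.
Proof.
  intros [n h]. induction n as [n IH] using lt_wf_ind.
  destruct (classic (exists m, m < n /\ P m)) as [(m & hm & hP)|h']; [eauto|].
  exists n. split; [exact h|]. intros m.
  destruct (le_lt_dec n m); [left; assumption|]. right. eauto.
Qed.

(** A choice functional must preserve plots, which an arbitrary one need not do. The least witness
    is determined by a semidecidable relation, since both the matrix and its negation are
    semidecidable. *)
Lemma QF_AC10_holds G (A : form (T0 :: T1 :: G)) (r : env G) :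
  quantifier_free A = true ->
  (forall f : ob T1, exists n : ob T0, holds A (econs n (econs f r))) ->
  exists F : ob T2, forall f : ob T1, holds A (econs (app F f) (econs f r)).
Proof.
  intros Q h.
  pose (P := fun f n => holds A (econs (n : ob T0) (econs (f : ob T1) r)) /\
                        forall m, n <= m \/ ~ holds A (econs (m : ob T0) (econs f r))).
  assert (EF : exists F : ob T1 -> nat, forall f, P f (F f)).
  { exists (fun f => proj1_sig (constructive_indefinite_description _ (least (h f)))).
    intros f. exact (proj2_sig (constructive_indefinite_description _ (least (h f)))). }
  destruct EF as [F HF].
  assert (uniq : forall f n m, P f n -> P f m -> n = m).
  { intros f n m [h1 h2] [h3 h4]. destruct (h2 m), (h4 n); try tauto. lia. }
  assert (plotF : forall a, plot T1 a -> plot T0 (fun e => F (a e))).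
  { intros a ha.
    assert (hr : forall k t x, plot t (fun e =>
        econs (getN (at_ 0 e) : ob T0) (econs (a (skipn k e)) r) x)).
    { intros k. apply plot_econs; [apply natplot_at|].
      apply plot_econs; [apply plot_skipn, ha|]. intros; apply plot_const. }
    assert (D : semi (fun e => forall m, getN (at_ 0 e) <= m \/
        ~ holds A (econs (m : ob T0) (econs (a (skipn 1 e)) r)))).
    { exact (semi_allN (semi_or (semi_le (natplot_at 1) (natplot_at 0))
        (proj2 (semi_qf Q (hr 2))))). }
    eapply semi_ext; [exact (semi_and (proj1 (semi_qf Q (hr 1))) D)|].
    intros e he. fold (P (a (skipn 1 e)) (getN (at_ 0 e))). split.
    - intros hP. eapply uniq; [exact hP|apply HF].
    - intros ->. apply HF. }
  exists (arr plotF). intros f. apply (HF f).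
Qed.

Lemma RCA0w_valid : valid RCA0w.
Proof.
  intros G A D. destruct D; intros rho; try (apply holds_eqt; reflexivity);
    cbn [holds Not]; try congruence.
  - intros E. discriminate (E : S _ = 0).
  - intros E. injection (E : S _ = S _). auto.
  - rewrite !holds_eqt. cbn [eval]. congruence.
  - rewrite holds_inst. intros [h0 hS] n. induction n as [|n IH]; [exact h0|].
    specialize (hS n IH). apply holds_fsub in hS.
    match type of hS with holds A ?r1 => replace r1 with (econs (S n : ob T0) rho) in hS end;
      [exact hS|]. apply env_ext; reflexivity.
  - intros h. destruct (QF_AC10_holds H h) as [F hF]. exists F. intros f.
    apply holds_fsub.
    match goal with |- holds A ?r1 => replace r1 with (econs (app F f) (econs f rho)) end;
      [apply hF|]. apply env_ext; [reflexivity|]. apply var_case; reflexivity.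
Qed.

(** * Arithmetic in the model *)

Lemma eval_lam G s t (a : tm (s :: G) t) (r : env G) x :
  app (eval (lam a) r) x = eval a (econs x r).
Proof.
  induction a as [t y| | | | | |t u a IHa b IHb]; try reflexivity.
  - revert t y. apply var_case; reflexivity.
  - cbn [lam eval]. rewrite <- IHa, <- IHb. reflexivity.
Qed.

Lemma eval_rec G (n y : tm G T0) b (r : env G) :
  eval (rec n y b) r =
  nat_rec (fun _ => nat) (eval y r)
    (fun k p => eval b (econs (k : ob T0) (econs (p : ob T0) r))) (eval n r).
Proof.
  change (eval (rec n y b) r) with (rec_nat (eval n r) (eval y r) (eval (lam (lam b)) r)).
  unfold rec_nat. generalize (eval n r : nat) as m. induction m as [|m IH]; [reflexivity|].
  cbn [nat_rec nat_rect]. rewrite <- IH, eval_lam.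
  exact (eval_lam b _ _).
Qed.

Lemma eval_addN G (a b : tm G T0) r : eval (addN a b) r = eval a r + eval b r.
Proof.
  unfold addN. rewrite eval_rec. generalize (eval b r : nat) as m.
  induction m as [|m IH]; [symmetry; apply Nat.add_0_r|].
  rewrite Nat.add_succ_r, <- IH. reflexivity.
Qed.

Lemma eval_predN G (a : tm G T0) r : eval (predN a) r = pred (eval a r).
Proof. unfold predN. rewrite eval_rec. destruct (eval a r); reflexivity. Qed.

Lemma eval_mulN G (a b : tm G T0) r : eval (mulN a b) r = eval a r * eval b r.
Proof.
  unfold mulN. rewrite eval_rec. generalize (eval b r : nat) as m.
  induction m as [|m IH]; [symmetry; apply Nat.mul_0_r|].
  cbn [nat_rec nat_rect]. rewrite eval_addN, !eval_up.
  rewrite Nat.mul_succ_r, <- IH. reflexivity.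
Qed.

Lemma eval_monus G (a b : tm G T0) r : eval (monus a b) r = eval a r - eval b r.
Proof.
  unfold monus. rewrite eval_rec. generalize (eval b r : nat) as m.
  induction m as [|m IH]; [symmetry; apply Nat.sub_0_r|].
  cbn [nat_rec nat_rect]. rewrite eval_predN. rewrite Nat.sub_succ_r, <- IH. reflexivity.
Qed.

Lemma eval_pow2 G (a : tm G T0) r : eval (pow2 a) r = 2 ^ eval a r.
Proof.
  unfold pow2. rewrite eval_rec. generalize (eval a r : nat) as m.
  induction m as [|m IH]; [reflexivity|].
  cbn [nat_rec nat_rect]. rewrite eval_addN. rewrite Nat.pow_succ_r', <- IH.
  cbn [Nat.mul]. rewrite Nat.add_0_r. reflexivity.
Qed.

Lemma eval_tri G (a : tm G T0) r : eval (tri a) r = tri_nat (eval a r).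
Proof.
  unfold tri, tri_nat. rewrite eval_rec. generalize (eval a r : nat) as m.
  induction m as [|m IH]; [reflexivity|].
  cbn [nat_rec nat_rect]. rewrite eval_addN, <- IH. reflexivity.
Qed.

Lemma eval_pairN G (a b : tm G T0) r : eval (pairN a b) r = pair_nat (eval a r) (eval b r).
Proof. unfold pairN. rewrite eval_addN, eval_tri, eval_addN. reflexivity. Qed.

Lemma eval_troot G (a : tm G T0) r : eval (troot a) r = troot_nat (eval a r).
Proof.
  unfold troot, troot_nat. rewrite eval_rec. generalize (eval a r : nat) as m.
  induction m as [|m IH]; [reflexivity|].
  cbn [nat_rec nat_rect]. rewrite eval_addN, !eval_monus, eval_tri, <- IH. reflexivity.
Qed.

Lemma eval_sndN G (a : tm G T0) r : eval (sndN a) r = snd_nat (eval a r).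
Proof. unfold sndN. rewrite eval_monus, eval_tri, eval_troot. reflexivity. Qed.

Lemma eval_fstN G (a : tm G T0) r : eval (fstN a) r = fst_nat (eval a r).
Proof. unfold fstN. rewrite eval_monus, eval_sndN, eval_troot. reflexivity. Qed.

Lemma eval_bar G (g : tm G T1) n r :
  eval (bar g n) r = bar_nat (fn (eval g r)) (eval n r).
Proof.
  unfold bar, bar_nat. rewrite eval_rec. generalize (eval n r : nat) as m.
  induction m as [|m IH]; [reflexivity|].
  cbn [nat_rec nat_rect]. rewrite <- IH. cbn [eval].
  change (S (eval (pairN v1 (up (up g) $ v0)) (econs (m : ob T0) (econs
    (nat_rec (fun _ => nat) 0 (fun k p => eval (Succ $ pairN v1 (up (up g) $ v0))
       (econs (k : ob T0) (econs (p : ob T0) r))) m : ob T0) r))) =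
    S (pair_nat (nat_rec (fun _ => nat) 0 (fun k p => eval (Succ $ pairN v1 (up (up g) $ v0))
       (econs (k : ob T0) (econs (p : ob T0) r))) m) (fn (eval g r) m))).
  rewrite eval_pairN. cbn [eval]. rewrite !eval_up. reflexivity.
Qed.

Lemma eval_bar_tuple G (gs : list (tm G T1)) n r :
  eval (bar_tuple gs n) r = bar_tuple_nat (map (fun g => fn (eval g r)) gs) (eval n r).
Proof.
  induction gs as [|g [|h gs] IH]; [reflexivity|apply eval_bar|].
  change (bar_tuple (g :: h :: gs) n) with (pairN (bar g n) (bar_tuple (h :: gs) n)).
  rewrite eval_pairN, IH, eval_bar. reflexivity.
Qed.

(** * Kleene normal forms and the functionals deciding them *)

Fixpoint kleene_sem (u : bool) (k : nat) (f : real) (gs : list real) : Prop :=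
  match k with
  | 0 => kleene_matrix u f gs
  | S k =>
      if u then forall g, hull (uB g) -> kleene_sem (negb u) k f (gs ++ [g])
      else exists g, hull (uB g) /\ kleene_sem (negb u) k f (gs ++ [g])
  end.

Lemma map_fn_up G s (x : ob s) (gs : list (tm G T1)) r :
  map (fun g => fn (eval g (econs x r))) (map (fun g => up g) gs) = map (fun g => fn (eval g r)) gs.
Proof. rewrite map_map. apply map_ext. intros g. rewrite eval_up. reflexivity. Qed.

Lemma holds_kleene_nf k : forall u G (f : tm G T1) gs r,
  holds (kleene_nf u k f gs) r <->
  kleene_sem u k (fn (eval f r)) (map (fun g => fn (eval g r)) gs).
Proof.
  induction k as [|k IH]; intros u G f gs r.
  - assert (E : forall n : ob T0, holds (up f $ bar_tuple (map (fun g => up g) gs) v0 == Zero)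
        (econs n r) <-> fn (eval f r) (bar_tuple_nat (map (fun g => fn (eval g r)) gs) n) = 0).
    { intros n. cbn [holds eval]. rewrite eval_bar_tuple, eval_up, map_fn_up. reflexivity. }
    destruct u; cbn [kleene_nf quant holds kleene_sem kleene_matrix].
    + split; intros h n; apply E, h.
    + split; intros [n h]; exists n; apply E, h.
  - assert (E : forall x : ob T1, holds (kleene_nf (negb u) k (up f)
        (map (fun g => up g) gs ++ [v0])) (econs x r) <->
        kleene_sem (negb u) k (fn (eval f r)) (map (fun g => fn (eval g r)) gs ++ [fn x])).
    { intros x. rewrite IH, map_app, map_fn_up, eval_up. reflexivity. }
    destruct u; cbn [kleene_nf quant holds kleene_sem].
    + split.
      * intros h g hg. apply (E (real_ob hg)), h.
      * intros h x. apply E, h, hull_fn.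
    + split.
      * intros [x h]. exists (fn x). split; [apply hull_fn|apply E, h].
      * intros (g & hg & h). exists (real_ob hg). apply E, h.
Qed.

Lemma kleene_sem_definable k : forall u, exists D, definable D /\
  forall f gs, hull (uB f) -> hulls (map uB gs) ->
  (D (map uB (rev gs) ++ [uB f]) <-> kleene_sem u k f gs).
Proof.
  induction k as [|k IH]; intros u.
  - exists (atom_holds (aKleene u)). split; [apply def_atom|]. intros f gs _ _.
    cbn [atom_holds]. rewrite map_app, map_map, rev_app_distr, map_rev, rev_involutive.
    cbn [getB map rev app]. rewrite map_id. reflexivity.
  - destruct (IH (negb u)) as (D & hD & E).
    assert (E' : forall f gs g, hull (uB f) -> hulls (map uB gs) -> hull (uB g) ->
      (D (uB g :: map uB (rev gs) ++ [uB f]) <-> kleene_sem (negb u) k f (gs ++ [g]))).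
    { intros f gs g hf hgs hg. rewrite <- E; [|exact hf|].
      - rewrite rev_app_distr. reflexivity.
      - rewrite map_app. apply Forall_app. repeat constructor; assumption. }
    assert (he : forall f gs, hull (uB f) -> hulls (map uB gs) -> hulls (map uB (rev gs) ++ [uB f])).
    { intros f gs hf hgs. apply Forall_app. split; [|repeat constructor; exact hf].
      rewrite map_rev. apply Forall_rev, hgs. }
    destruct u; cbn [kleene_sem].
    + exists (fun e => forall b, D (uB b :: e)). split; [apply def_allB, hD|].
      intros f gs hf hgs. split.
      * intros h g hg. apply E'; auto.
      * intros h b. apply NNPP. intros h'.
        destruct (elementaryB (def_not hD) (he f gs hf hgs)) as (g & hg & h''); [eauto|].
        apply h''. apply E'; auto.
    + exists (fun e => exists b, D (uB b :: e)). split; [apply def_exB, hD|].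
      intros f gs hf hgs. split.
      * intros h. destruct (elementaryB hD (he f gs hf hgs) h) as (g & hg & h').
        exists g. split; [exact hg|]. apply E'; auto.
      * intros (g & hg & h). exists g. apply E'; auto.
Qed.

Lemma S2_holds k G (r : env G) : holds (S2 k G) r.
Proof.
  destruct (kleene_sem_definable k true) as (D & hD & E).
  assert (E' : forall f : ob T1, D [uB (fn f)] <-> kleene_sem true k (fn f) []).
  { intros f. apply (E (fn f) []); [apply hull_fn|constructor]. }
  (* [S2] marks truth by the value 0, hence the negation. The relation and its complement are
     definable without [Y], so the functional is a plot. *)
  assert (P : forall a, plot T1 a -> plot T0 (fun e => bool_nat (~ D [uB (fn (a e))]))).
  { intros a ha. apply natplot_bool.
    - exact (semi_funB (semi_def (def_not (def_rearrange [0] 0 hD))) ha).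
    - exact (semi_funB (semi_def (def_not (def_not (def_rearrange [0] 0 hD)))) ha). }
  set (F := arr (s := T1) (t := T0) (f := fun f => bool_nat (~ D [uB (fn f)])) P).
  exists F. intros f.
  assert (E0 : bool_nat (~ D [uB (fn f)]) = 0 <-> D [uB (fn f)]).
  { unfold bool_nat. destruct excluded_middle_informative; split; try tauto; easy. }
  assert (EF : holds (Pi1 k v0) (econs f (econs (F : ob T2) r))
               <-> D [uB (fn f)]).
  { unfold Pi1. rewrite holds_kleene_nf, E'. reflexivity. }
  cbn [Iff holds]. rewrite EF. exact (conj (proj1 E0) (proj2 E0)).
Qed.

(** * Choice of functions for numbers *)

Definition real_of (b : real) : ob T1 :=
  match excluded_middle_informative (hull (uB b)) with
  | left h => real_ob h
  | right _ => ob_pi1 T0 (0 : ob T0)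
  end.

Lemma fn_real_of b : hull (uB b) -> fn (real_of b) = b.
Proof.
  intros h. unfold real_of. destruct excluded_middle_informative; [reflexivity|tauto].
Qed.

Lemma plot_real_of i : plot T1 (fun e => real_of (getB (at_ i e))).
Proof.
  apply plot_T1. refine (natplot_ext (natplot_getB (S i) 0) _).
  intros e he. rewrite fn_real_of.
  - destruct e; [destruct i|]; reflexivity.
  - apply hull_B, hull_at, hulls_skipn, he.
Qed.

(** The matrix compares the values of two plots and is therefore semidecidable. [semi_choice] then
    provides a single [g] in the hull, and taking its slices is an admissible function of [n]. *)
Lemma QF_AC01_holds G (r : env G) : holds (QF_AC01 G) r.
Proof.
  intros F h. cbn [holds eval] in *.
  assert (R : semi (fun e => app (app F (real_of (getB (at_ 0 e)))) (getN (at_ 1 e)) = 0)).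
  { apply semi_eq; [|apply natplot_const].
    apply (plot_app (s := T0) (t := T0) (a := fun e => getN (at_ 1 e))); [|apply natplot_at].
    apply (plot_app (s := T1) (t := T0 --> T0)); [apply plot_const|apply plot_real_of]. }
  destruct (semi_choice R) as (g & hg & H).
  - intros n. destruct (h n) as [f hf]. exists (fn f). split; [apply hull_fn|].
    cbn [nth getB getN]. replace (real_of (fn f)) with f; [exact hf|].
    apply fn_inj. rewrite fn_real_of; [reflexivity|apply hull_fn].
  - assert (P : forall c, plot T0 c -> plot T1 (fun e => real_of (slice g (c e)))).
    { intros c hc. apply plot_T1.
      refine (natplot_ext (natplot_app hg (natplot_pair (natplot_skipn 1 hc) (natplot_at 0))) _).
      intros e he. rewrite fn_real_of; [reflexivity|apply hull_slice, hg]. }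
    exists (arr (s := T0) (t := T1) (f := fun n => real_of (slice g n)) P).
    intros n. exact (H n).
Qed.

Lemma Z2w_QF_AC01_valid : valid Z2w_QF_AC01.
Proof.
  intros G A D r. destruct D as [G A []|].
  - apply RCA0w_valid. assumption.
  - apply S2_holds.
  - apply QF_AC01_holds.
Qed.

(** * The reals of the model *)

Definition pos_nat (c : nat) : nat := fst_nat (fst_nat c).
Definition neg_nat (c : nat) : nat := snd_nat (fst_nat c).
Definition den_nat (c : nat) : nat := S (snd_nat c).

Lemma eval_posQ G (q : tm G T0) r : eval (posQ q) r = pos_nat (eval q r).
Proof. unfold posQ. rewrite !eval_fstN. reflexivity. Qed.

Lemma eval_negpartQ G (q : tm G T0) r : eval (negpartQ q) r = neg_nat (eval q r).
Proof. unfold negpartQ. rewrite eval_sndN, eval_fstN. reflexivity. Qed.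

Lemma eval_denQ G (q : tm G T0) r : eval (denQ q) r = den_nat (eval q r).
Proof.
  change (eval (denQ q) r) with (S (eval (sndN q) r)). rewrite eval_sndN. reflexivity.
Qed.

Lemma INR_den_pos c : (0 < INR (den_nat c))%R.
Proof. apply lt_0_INR. unfold den_nat. lia. Qed.

Lemma frac_eq c : frac c = ((INR (pos_nat c) - INR (neg_nat c)) / INR (den_nat c))%R.
Proof. reflexivity. Qed.

Lemma frac_le c d :
  pos_nat c * den_nat d + neg_nat d * den_nat c <= pos_nat d * den_nat c + neg_nat c * den_nat d
  <-> (frac c <= frac d)%R.
Proof.
  assert (E : (frac d - frac c = (INR (pos_nat d * den_nat c + neg_nat c * den_nat d) -
     INR (pos_nat c * den_nat d + neg_nat d * den_nat c)) / (INR (den_nat c) * INR (den_nat d)))%R).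
  { rewrite !frac_eq, !plus_INR, !mult_INR. pose proof (INR_den_pos c). pose proof (INR_den_pos d).
    field. split; lra. }
  assert (P : (0 < / (INR (den_nat c) * INR (den_nat d)))%R).
  { apply Rinv_0_lt_compat, Rmult_lt_0_compat; apply INR_den_pos. }
  unfold Rdiv in E. split; intros h.
  - apply le_INR in h. nra.
  - apply INR_le. nra.
Qed.

Lemma frac_lt c d :
  pos_nat c * den_nat d + neg_nat d * den_nat c < pos_nat d * den_nat c + neg_nat c * den_nat d
  <-> (frac c < frac d)%R.
Proof.
  pose proof (frac_le d c) as h. split; intros h'.
  - apply Rnot_le_lt. intros h''. apply h in h''. lia.
  - apply Nat.nle_gt. intros h''. apply (Rlt_not_le _ _ h'), h. lia.
Qed.

Lemma holds_leN G (a b : tm G T0) r : holds (leN a b) r <-> eval a r <= eval b r.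
Proof.
  unfold leN. cbn [holds eval]. rewrite eval_monus. apply Nat.sub_0_le.
Qed.

Lemma holds_ltN G (a b : tm G T0) r : holds (ltN a b) r <-> eval a r < eval b r.
Proof. apply holds_leN. Qed.

Lemma holds_leQ G (p q : tm G T0) r :
  holds (leQ p q) r <-> (frac (eval p r) <= frac (eval q r))%R.
Proof.
  unfold leQ. rewrite holds_leN, !eval_addN, !eval_mulN, !eval_posQ, !eval_negpartQ, !eval_denQ.
  apply frac_le.
Qed.

Lemma holds_ltQ G (p q : tm G T0) r :
  holds (ltQ p q) r <-> (frac (eval p r) < frac (eval q r))%R.
Proof.
  unfold ltQ. rewrite holds_ltN, !eval_addN, !eval_mulN, !eval_posQ, !eval_negpartQ, !eval_denQ.
  apply frac_lt.
Qed.

Lemma frac_natQ G (n : tm G T0) r : frac (eval (natQ n) r) = INR (eval n r).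
Proof.
  unfold natQ. rewrite !eval_pairN, frac_pair. cbn [eval]. simpl (INR 0). simpl (INR 1). lra.
Qed.

Lemma frac_dyadicQ G (a n : tm G T0) r :
  frac (eval (dyadicQ a n) r) = (INR (eval a r) * (/ 2) ^ eval n r)%R.
Proof.
  unfold dyadicQ. rewrite !eval_pairN, frac_pair, eval_predN, eval_pow2.
  rewrite Nat.succ_pred by (apply Nat.pow_nonzero; lia).
  rewrite pow_INR, pow_inv. cbn [eval]. simpl (INR 0).
  replace (INR 2) with 2%R by (simpl; lra). unfold Rdiv. ring.
Qed.

Lemma frac_oppQ G (q : tm G T0) r : frac (eval (oppQ q) r) = (- frac (eval q r))%R.
Proof.
  unfold oppQ. rewrite !eval_pairN, frac_pair, eval_negpartQ, eval_posQ, eval_sndN.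
  rewrite frac_eq. fold (den_nat (eval q r)). pose proof (INR_den_pos (eval q r)). field. lra.
Qed.

Lemma frac_addQ G (p q : tm G T0) r :
  frac (eval (addQ p q) r) = (frac (eval p r) + frac (eval q r))%R.
Proof.
  unfold addQ. rewrite !eval_pairN, frac_pair, eval_predN, !eval_addN, !eval_mulN,
    !eval_negpartQ, !eval_posQ, !eval_denQ.
  rewrite Nat.succ_pred by (unfold den_nat; lia).
  rewrite !frac_eq, !plus_INR, !mult_INR.
  pose proof (INR_den_pos (eval p r)). pose proof (INR_den_pos (eval q r)). field. lra.
Qed.

Lemma frac_subQ G (p q : tm G T0) r :
  frac (eval (subQ p q) r) = (frac (eval p r) - frac (eval q r))%R.
Proof. unfold subQ. rewrite frac_addQ, frac_oppQ. reflexivity. Qed.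

Lemma frac_absQ G (q : tm G T0) r : frac (eval (absQ q) r) = Rabs (frac (eval q r)).
Proof.
  unfold absQ. rewrite !eval_pairN, frac_pair, eval_addN, !eval_monus, eval_sndN,
    eval_posQ, eval_negpartQ.
  rewrite frac_eq. unfold Rdiv. rewrite Rabs_mult. fold (den_nat (eval q r)).
  pose proof (INR_den_pos (eval q r)) as h.
  rewrite (Rabs_pos_eq (/ _)) by (apply Rlt_le, Rinv_0_lt_compat, h).
  f_equal. cbn [eval]. simpl (INR 0). rewrite Rminus_0_r, plus_INR.
  set (a := pos_nat _). set (b := neg_nat _).
  destruct (le_lt_dec a b) as [hab|hab].
  - replace (a - b) with 0 by lia. rewrite minus_INR by exact hab. apply le_INR in hab.
    rewrite Rabs_left1; simpl (INR 0); lra.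
  - replace (b - a) with 0 by lia. rewrite minus_INR by lia. apply lt_INR in hab.
    rewrite Rabs_pos_eq; simpl (INR 0); lra.
Qed.

Lemma INR_one G (r : env G) : INR (eval one r) = 1%R.
Proof. reflexivity. Qed.

Lemma INR_two G (r : env G) : INR (eval (Succ $ one) r) = 2%R.
Proof. change (INR 2 = 2%R). simpl. lra. Qed.

Definition realval G (x : tm G T1) (r : env G) : R := val (fn (eval x r)).

Lemma holds_isReal G (x : tm G T1) r : holds (isReal x) r <-> cauchy (fn (eval x r)).
Proof.
  unfold isReal, cauchy. cbn [holds].
  assert (E : forall k i : ob T0, holds (ltQ (absQ (subQ (up (up x) $ v1) (up (up x) $ addN v1 v0)))
      (dyadicQ one v1)) (econs i (econs k r)) <->
      (Rabs (frac (fn (eval x r) k) - frac (fn (eval x r) (k + i)%nat)) < (/ 2) ^ k)%R).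
  { intros k i. rewrite holds_ltQ, frac_absQ, frac_subQ, frac_dyadicQ, INR_one, Rmult_1_l. cbn [eval].
    rewrite eval_addN, !eval_up. reflexivity. }
  split; intros h k i; apply E, h.
Qed.

Lemma holds_eqR G (x y : tm G T1) r :
  cauchy (fn (eval x r)) -> cauchy (fn (eval y r)) ->
  (holds (eqR x y) r <-> realval x r = realval y r).
Proof.
  intros hx hy. unfold realval. rewrite <- val_eq by assumption. unfold eqR. cbn [holds].
  assert (E : forall k : ob T0, holds (leQ (absQ (subQ (up x $ v0) (up y $ v0)))
      (dyadicQ (Succ $ one) v0)) (econs k r) <->
      (Rabs (frac (fn (eval x r) k) - frac (fn (eval y r) k)) <= 2 * (/ 2) ^ k)%R).
  { intros k. rewrite holds_leQ, frac_absQ, frac_subQ, frac_dyadicQ, INR_two. cbn [eval].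
    rewrite !eval_up. reflexivity. }
  split; intros h k; apply E, h.
Qed.

Lemma holds_ltR G (x y : tm G T1) r :
  cauchy (fn (eval x r)) -> cauchy (fn (eval y r)) ->
  (holds (ltR x y) r <-> (realval x r < realval y r)%R).
Proof.
  intros hx hy. unfold realval. rewrite <- val_lt by assumption. unfold ltR. cbn [holds].
  assert (E : forall k : ob T0, holds (ltQ (addQ (up x $ v0) (dyadicQ (Succ $ one) v0)) (up y $ v0))
      (econs k r) <->
      (frac (fn (eval x r) k) + 2 * (/ 2) ^ k < frac (fn (eval y r) k))%R).
  { intros k. rewrite holds_ltQ, frac_addQ, frac_dyadicQ, INR_two. cbn [eval].
    rewrite !eval_up. reflexivity. }
  split; intros [k h]; exists k; apply E, h.
Qed.

Lemma holds_leR G (x y : tm G T1) r :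
  cauchy (fn (eval x r)) -> cauchy (fn (eval y r)) ->
  (holds (leR x y) r <-> (realval x r <= realval y r)%R).
Proof.
  intros hx hy. unfold leR. cbn [holds Not]. rewrite holds_ltR by assumption.
  split; [apply Rnot_lt_le|apply Rle_not_lt].
Qed.

Lemma cauchy_ratR G (q : tm G T0) r : cauchy (fn (eval (ratR q) r)).
Proof. exact (cauchy_const (eval q r)). Qed.

Lemma realval_ratR G (q : tm G T0) r : realval (ratR q) r = frac (eval q r).
Proof. exact (val_const (eval q r)). Qed.

Lemma fn_lam G (a : tm (T0 :: G) T0) (r : env G) k :
  fn (eval (lam a) r) k = eval a (econs (k : ob T0) r).
Proof. exact (eval_lam a r _). Qed.

Lemma cauchy_subR G (x y : tm G T1) r :
  cauchy (fn (eval x r)) -> cauchy (fn (eval y r)) ->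
  cauchy (fn (eval (subR x y) r)) /\ realval (subR x y) r = (realval x r - realval y r)%R.
Proof.
  intros hx hy.
  assert (E : forall k, frac (fn (eval (subR x y) r) k) =
      (frac (fn (eval x r) (S k)) - frac (fn (eval y r) (S k)))%R).
  { intros k. unfold subR.
    rewrite fn_lam.
    rewrite frac_subQ. cbn [eval]. rewrite !eval_up. reflexivity. }
  assert (C : cauchy (fn (eval (subR x y) r))).
  (* [subR] reads its arguments one index further, so two errors of half the size add up to the
     permitted one. *)
  { intros k i. rewrite !E. specialize (hx (S k) i). specialize (hy (S k) i).
    cbn [Nat.add] in hx, hy. rewrite half_pow_S in hx, hy. split_Rabs; lra. }
  split; [exact C|]. apply val_unique; [exact C|]. intros k. rewrite E.
  pose proof (val_spec hx (S k)) as h1. pose proof (val_spec hy (S k)) as h2.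
  rewrite half_pow_S in h1, h2. unfold realval. split_Rabs; lra.
Qed.

Lemma cauchy_absR G (x : tm G T1) r : cauchy (fn (eval x r)) ->
  cauchy (fn (eval (absR x) r)) /\ realval (absR x) r = Rabs (realval x r).
Proof.
  intros hx.
  assert (E : forall k, frac (fn (eval (absR x) r) k) = Rabs (frac (fn (eval x r) k))).
  { intros k. unfold absR.
    rewrite fn_lam.
    rewrite frac_absQ. cbn [eval]. rewrite !eval_up. reflexivity. }
  assert (C : cauchy (fn (eval (absR x) r))).
  { intros k i. rewrite !E. specialize (hx k i). split_Rabs; lra. }
  split; [exact C|]. apply val_unique; [exact C|]. intros k. rewrite E.
  pose proof (val_spec hx k) as h1. unfold realval. split_Rabs; lra.
Qed.

Lemma holds_inBall G (z y : tm G T1) n r :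
  cauchy (fn (eval z r)) -> cauchy (fn (eval y r)) ->
  (holds (inBall z y n) r <-> (Rabs (realval z r - realval y r) < (/ 2) ^ eval n r)%R).
Proof.
  intros hz hy. destruct (cauchy_subR hz hy) as [h1 h2]. destruct (cauchy_absR h1) as [h3 h4].
  unfold inBall. rewrite holds_ltR by auto using cauchy_ratR.
  rewrite h4, h2, realval_ratR, frac_dyadicQ, INR_one, Rmult_1_l. reflexivity.
Qed.

Lemma holds_AllR G (A : form (T1 :: G)) r :
  holds (AllR A) r <-> forall x : ob T1, cauchy (fn x) -> holds A (econs x r).
Proof.
  unfold AllR. split.
  - intros H x hx. apply (H x), holds_isReal, hx.
  - intros H x hx. apply H. apply holds_isReal in hx. exact hx.
Qed.

Definition covers_sem (h : ob (T1 --> T1)) (n : nat) : Prop :=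
  forall x : ob T1, cauchy (fn x) -> (- INR n <= val (fn x) <= INR n)%R ->
  (0 < val (fn (app h x)))%R.

Lemma holds_covers G (h : tm G (T1 --> T1)) n r :
  (forall x, cauchy (fn x) -> cauchy (fn (app (eval h r) x))) ->
  (holds (covers h n) r <-> covers_sem (eval h r) (eval n r)).
Proof.
  intros hh.
  assert (E : forall x : ob T1, cauchy (fn x) ->
    (holds (leR (ratR (oppQ (natQ (up n)))) v0 ∧ leR v0 (ratR (natQ (up n))) ⊃
        mem v0 (up h)) (econs x r) <->
     ((- INR (eval n r) <= val (fn x) <= INR (eval n r))%R ->
      (0 < val (fn (app (eval h r) x)))%R))).
  { intros x hx. unfold mem. cbn [holds].
    rewrite !holds_leR, holds_ltR, !realval_ratR, frac_oppQ, !frac_natQ, eval_up;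
      auto using cauchy_ratR.
    - unfold realval. cbn [eval]. rewrite eval_up. reflexivity.
    - cbn [eval]. rewrite eval_up. apply hh, hx. }
  unfold covers. rewrite holds_AllR.
  split; intros H x hx; apply (E x hx), H, hx.
Qed.

Lemma holds_isFunR G (h : tm G (T1 --> T1)) r :
  (forall x, cauchy (fn x) -> cauchy (fn (app (eval h r) x))) ->
  (forall x y, cauchy (fn x) -> cauchy (fn y) -> val (fn x) = val (fn y) ->
     val (fn (app (eval h r) x)) = val (fn (app (eval h r) y))) ->
  holds (isFunR h) r.
Proof.
  intros hc he. split.
  - apply holds_AllR. intros x hx. apply holds_isReal. cbn [eval]. rewrite eval_up.
    apply hc, hx.
  - apply holds_AllR. intros x hx. apply holds_AllR. intros y hy.
    cbn [holds]. rewrite !holds_eqR; unfold realval; cbn [eval]; rewrite ?eval_up; auto.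
Qed.

Lemma holds_mem G x (h : tm G (T1 --> T1)) r :
  cauchy (fn (app (eval h r) (eval x r))) ->
  (holds (mem x h) r <-> (0 < val (fn (app (eval h r) (eval x r))))%R).
Proof.
  intros hc. unfold mem. rewrite holds_ltR; [|apply cauchy_ratR|exact hc].
  rewrite realval_ratR, frac_natQ. reflexivity.
Qed.

Lemma holds_isOpen G (h : tm G (T1 --> T1)) r :
  (forall x, cauchy (fn x) -> cauchy (fn (app (eval h r) x))) ->
  (forall x y, cauchy (fn x) -> cauchy (fn y) -> val (fn x) = val (fn y) ->
     val (fn (app (eval h r) x)) = val (fn (app (eval h r) y))) ->
  (forall y, cauchy (fn y) -> (0 < val (fn (app (eval h r) y)))%R ->
     exists N, forall z, cauchy (fn z) -> (Rabs (val (fn z) - val (fn y)) < (/ 2) ^ N)%R ->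
     (0 < val (fn (app (eval h r) z)))%R) ->
  holds (isOpen h) r.
Proof.
  intros hc he ho. split; [apply holds_isFunR; assumption|].
  apply holds_AllR. intros y hy hm.
  apply holds_mem in hm; cbn [eval] in *; rewrite ?eval_up in *; [|apply hc, hy].
  destruct (ho y hy hm) as [N hN]. exists N. apply holds_AllR. intros z hz hb.
  apply holds_inBall in hb; [|assumption..].
  apply holds_mem; cbn [eval]; rewrite !eval_up; [apply hc, hz|].
  apply hN; [exact hz|exact hb].
Qed.

(** * The counterexample *)

Definition removed (m : nat) (x : real) : Prop :=
  exists n b, hull (uB b) /\ is_point x n b /\
    (exists v, Y b = Some v /\ v <= n) /\ above b n m.

Lemma is_point_unique x n b n' b' : is_point x n b -> is_point x n' b' -> n = n' /\ b = b'.
Proof.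
  intros (_ & hb & E) (_ & hb' & E'). apply point_inj; [exact hb|exact hb'|congruence].
Qed.

(** A real codes at most one pair, so not being removed can be expressed positively: either the real
    codes no pair, or the pair it codes violates a condition. With [removed] and its complement both
    semidecidable, the characteristic functional is an object of the model. *)
Lemma not_removed m x : hull (uB x) ->
  (~ removed m x <->
   ~ (exists n b, is_point x n b) \/
   exists n b, hull (uB b) /\ is_point x n b /\
     ((exists v, Y b = Some v /\ n < v) \/ ~ above b n m)).
Proof.
  intros hx. split.
  - intros H. destruct (classic (exists n b, is_point x n b)) as [[n hb]|h]; [right|left; exact h].
    (* The sequence coded by a real of the hull can be taken in the hull, where [Y] is defined. *)
    destruct (elementaryB (R := fun e => is_point (getB (at_ 1 e)) (getN (at_ 2 e)) (getB (at_ 0 e)))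
      (e := [uB x; uN n])) as (b & hhb & hp).
    + exact (def_rearrange [1; 2; 0] 0 (def_atom aIsPoint)).
    + repeat constructor; auto using hull_N.
    + exact hb.
    + exists n, b. split; [exact hhb|]. split; [exact hp|].
      destruct (proj1 Y_generic b hhb) as [v hv].
      destruct (le_lt_dec v n) as [h|h]; [right|left; eauto].
      intros ha. apply H. exists n, b. eauto 6.
  - intros [h|(n & b & _ & hp & h)] (n' & b' & hb' & hp' & (v & hv & hle) & ha);
      [eauto|].
    destruct (is_point_unique hp hp') as [<- <-].
    destruct h as [(v' & hv' & hlt)|h]; [|tauto].
    rewrite hv in hv'. injection hv' as <-. lia.
Qed.

Lemma semi_removed : semi (fun e => removed (getN (at_ 0 e)) (getB (at_ 1 e))) /\
  semi (fun e => ~ removed (getN (at_ 0 e)) (getB (at_ 1 e))).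
Proof.
  assert (P : semi (fun e => is_point (getB (at_ 3 e)) (getN (at_ 1 e)) (getB (at_ 0 e))))
    by exact (semi_def (def_rearrange [3; 1; 0] 0 (def_atom aIsPoint))).
  assert (A : semi (fun e => above (getB (at_ 0 e)) (getN (at_ 1 e)) (getN (at_ 2 e))))
    by exact (semi_def (def_atom aAbove)).
  assert (A' : semi (fun e => ~ above (getB (at_ 0 e)) (getN (at_ 1 e)) (getN (at_ 2 e))))
    by exact (semi_def (def_not (def_atom aAbove))).
  assert (V : semi (fun e => Y (getB (at_ 1 e)) = Some (getN (at_ 0 e))))
    by exact (semi_rearrange [1; 0] 0 semi_Y).
  split.
  - exact (semi_exN (semi_exB (semi_and P (semi_and (semi_exN (semi_and V
      (semi_le (natplot_at 0) (natplot_at 2)))) A)))).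
  - eapply semi_ext; [apply semi_or|].
    + exact (semi_def (def_not (def_exN (def_exB
        (def_rearrange [3; 1; 0] 0 (def_atom aIsPoint)))))).
    + exact (semi_exN (semi_exB (semi_and P (semi_or (semi_exN (semi_and V
        (semi_le (natplot_succ (natplot_at 2)) (natplot_at 0)))) A')))).
    + intros e he. rewrite not_removed by apply hull_B, hull_at, he. reflexivity.
Qed.

Lemma natplot_removed c a : natplot c -> plot T1 a ->
  natplot (fun e => bool_nat (~ removed (c e) (fn (a e)))).
Proof.
  intros hc ha.
  assert (H : forall R, semi R -> semi (fun e => R (uN (c e) :: uB (fn (a e)) :: e))).
  { intros R hR. exact (semi_funB (semi_fun hR (natplot_skipn 1 hc)) ha). }
  apply natplot_bool; [exact (H _ (proj2 semi_removed))|].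
  apply (semi_ext (H _ (proj1 semi_removed))). intros e _. cbn. split; [tauto|apply NNPP].
Qed.

Definition opens : ob (T0 --> T1 --> T1).
Proof.
  assert (P : forall c a, plot T0 c -> plot T1 a -> plot T1 (fun e =>
      ob_pi1 T0 (bool_nat (~ removed (c e) (fn (a e))) : ob T0))).
  { intros c a hc ha. apply plot_T1.
    exact (natplot_removed (natplot_skipn 1 hc) (plot_skipn 1 ha)). }
  refine (arr (s := T0) (t := T1 --> T1) (f := fun m =>
    arr (s := T1) (t := T1) (f := fun x => ob_pi1 T0 (bool_nat (~ removed m (fn x)) : ob T0)) _) _).
  Unshelve.
  - intros c hc. apply plot_arr. intros k a ha. exact (P _ _ (plot_skipn k hc) ha).
  - intros a ha. exact (P _ _ (plot_const (m : ob T0)) ha).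
Defined.

Lemma fn_opens m x : fn (app (app opens m) x) = fun _ => bool_nat (~ removed m (fn x)).
Proof. reflexivity. Qed.

(** As codes of rationals, the numbers 0 and 1 denote 0 and 1. The constant sequence in [opens] is
    thus the characteristic value as a real. *)
Lemma frac_bool P : frac (bool_nat P) = INR (bool_nat P).
Proof.
  unfold bool_nat. destruct excluded_middle_informative.
  - change 1 with (pair_nat (pair_nat 1 0) 0) at 1. rewrite frac_pair. simpl. lra.
  - change 0 with (pair_nat (pair_nat 0 0) 0) at 1. rewrite frac_pair. simpl. lra.
Qed.

Lemma cauchy_opens m x : cauchy (fn (app (app opens m) x)).
Proof. rewrite fn_opens. apply cauchy_const. Qed.

Lemma opens_pos m x : (0 < val (fn (app (app opens m) x)))%R <-> ~ removed m (fn x).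
Proof.
  rewrite fn_opens, val_const, frac_bool. unfold bool_nat.
  destruct excluded_middle_informative as [h|h]; simpl; split; intros h'; try tauto; lra.
Qed.

Lemma removed_ext m x y : cauchy y -> val x = val y -> removed m x -> removed m y.
Proof.
  intros hy E (n & b & hb & (_ & h1 & h2) & h3). exists n, b. split; [exact hb|].
  split; [|exact h3]. split; [exact hy|]. split; [exact h1|congruence].
Qed.

Lemma opens_ext m x y : cauchy (fn x) -> cauchy (fn y) -> val (fn x) = val (fn y) ->
  val (fn (app (app opens m) x)) = val (fn (app (app opens m) y)).
Proof.
  intros hx hy E. rewrite !fn_opens.
  replace (~ removed m (fn x)) with (~ removed m (fn y)); [reflexivity|].
  apply propositional_extensionality. split; intros h h'; apply h; revert h';
    apply removed_ext; auto.
Qed.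

Lemma finitely_many_points K : exists l : list (nat * real),
  forall n b v, n <= K -> Y b = Some v -> v <= n -> In (n, b) l.
Proof.
  assert (H : forall k, exists l : list real, forall b v, v < k -> Y b = Some v -> In b l).
  { induction k as [|k [l hl]]; [exists []; lia|].
    destruct (proj1 (proj2 Y_generic) k) as [l' hl']. exists (l' ++ l).
    intros b v hv hb. apply in_or_app.
    destruct (Nat.eq_dec v k) as [->|hne]; [left; auto|right]. apply (hl b v); [lia|exact hb]. }
  destruct (H (S K)) as [l hl]. exists (list_prod (seq 0 (S K)) l).
  intros n b v h1 h2 h3. apply in_prod; [apply in_seq; lia|]. apply (hl b v); [lia|exact h2].
Qed.

Lemma isolated (l : list R) (y : R) :
  exists N, forall p, In p l -> p <> y -> ((/ 2) ^ N <= Rabs (p - y))%R.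
Proof.
  induction l as [|p l [N hN]]; [exists 0; intros p []|].
  destruct (Req_dec p y) as [->|hne].
  - exists N. intros q [<-|hq]; [congruence|auto].
  - destruct (half_pow_small (e := Rabs (p - y))) as [M hM]; [apply Rabs_pos_lt; lra|].
    exists (Nat.max N M). intros q [<-|hq] hqy.
    + pose proof (half_pow_le (k := M) (m := Nat.max N M) ltac:(lia)). lra.
    + specialize (hN q hq hqy).
      pose proof (half_pow_le (k := N) (m := Nat.max N M) ltac:(lia)). lra.
Qed.

Lemma opens_open m y : cauchy (fn y) -> (0 < val (fn (app (app opens m) y)))%R ->
  exists N, forall z, cauchy (fn z) -> (Rabs (val (fn z) - val (fn y)) < (/ 2) ^ N)%R ->
  (0 < val (fn (app (app opens m) z)))%R.
Proof.
  intros hy hpos. apply opens_pos in hpos.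
  (* The ball will have radius at most 1, so every point in it that codes a pair [(n, b)] has
     [n <= K]. *)
  destruct (INR_unbounded (val (fn y) + 1)) as [K hK].
  destruct (finitely_many_points K) as [l hl].
  destruct (isolated (map (fun p => val (point (fst p) (snd p))) l) (val (fn y))) as [N hN].
  exists N. intros z hz hball. apply opens_pos.
  intros (n & b & hb & hp & (v & hv & hle) & ha).
  assert (hz' : val (fn z) = val (point n b)) by apply hp.
  assert (h1 : ((/ 2) ^ N <= 1)%R) by (exact (half_pow_le (Nat.le_0_l N))).
  assert (hn : n <= K).
  { apply INR_le. pose proof (val_point_bounds n b). split_Rabs; lra. }
  assert (hin : ((/ 2) ^ N <= Rabs (val (point n b) - val (fn y)))%R).
  { apply hN.
    - exact (in_map (fun p => val (point (fst p) (snd p))) _ _ (hl n b v hn hv hle)).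
    - intros E. apply hpos. apply (removed_ext (x := fn z)); [exact hy|congruence|].
      exists n, b. eauto 6. }
  rewrite <- hz' in hin. lra.
Qed.

(** Finitely many pairs can code removed points of the interval, and [above_bounded] restores each
    of them from some [m] on. *)
Lemma opens_cover n : exists m, covers_sem (app opens m) n.
Proof.
  destruct (finitely_many_points n) as [l hl].
  assert (H : exists M, forall n b m, In (n, b) l -> M <= m -> ~ above b n m).
  { clear hl. induction l as [|[k c] l [M hM]]; [exists 0; intros ? ? ? []|].
    destruct (above_bounded c k) as [M' hM']. exists (Nat.max M M').
    intros k' c' m [[= <- <-]|hin] hm; [apply hM'; lia|]. apply hM; [exact hin|lia]. }
  destruct H as [M hM]. exists M. intros x hx hbound. apply opens_pos.
  intros (k & b & hb & (_ & _ & hp) & (v & hv & hle) & ha).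
  apply (hM k b M); [|lia|exact ha]. apply (hl k b v); [|exact hv|exact hle].
  apply INR_le. pose proof (val_point_bounds k b). lra.
Qed.

(** The sequence coding [g], or rather [n => g (n + 1) + 1], gives a point that
    every choice function bounded by [g] misses. *)
Lemma opens_no_choice (g : ob T1) : exists n, ~ covers_sem (app opens (fn g n)) n.
Proof.
  destruct (elementaryB (R := fun e => graph (getB (at_ 0 e)) (fun n => S (getB (at_ 1 e) (S n))))
    (e := [uB (fn g)])) as (b & hb & hG).
  - exact (def_atom aGraph).
  - repeat constructor. apply hull_fn.
  - exists (fun c => let (n, j) := Cantor.of_nat c in if j =? S (fn g (S n)) then 1 else 0).
    intros n j. cbn [nth getB]. rewrite Cantor.cancel_of_to. reflexivity.
  - cbn [nth getB] in hG.
    (* With [v] the value of [Y] at [b], the point coding [(v, b)] lies between [v] and [v + 1],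
       hence in the interval for [S v]. The shift in the coded function makes its value at [v]
       exceed [g (S v)], so the point is still missing from the chosen set. *)
    destruct (proj1 Y_generic b hb) as [v hv]. exists (S v).
    destruct (elementaryB (def_atom aPoint) (e := [uN v; uB b])) as (x & hx & E).
    + repeat constructor; auto using hull_N.
    + exists (point v b). reflexivity.
    + cbn in E. subst x. intros hc.
      pose proof (val_point_bounds v b) as hval. pose proof (pos_INR v) as hv0.
      specialize (hc (real_ob hx) (cauchy_point v b)).
      apply opens_pos in hc.
      * apply hc. exists v, b. split; [exact hb|]. split; [|split].
        -- split; [apply cauchy_point|]. split; [|reflexivity].
           intros k. rewrite <- (Cantor.cancel_to_of k). destruct (Cantor.of_nat k) as [n j].
           rewrite (hG n j). destruct (_ =? _); lia.
        -- exists v. split; [exact hv|lia].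
        -- exists (S (fn g (S v))). split; [lia|]. split.
           ++ rewrite hG, Nat.eqb_refl. reflexivity.
           ++ intros i hi. rewrite hG. destruct (Nat.eqb_spec i (S (fn g (S v)))); lia.
      * change (fn (real_ob hx)) with (point v b). rewrite S_INR. lra.
Qed.

Lemma OC00_fails (r : env []) : ~ holds OC00 r.
Proof.
  intros H. specialize (H opens).
  assert (CO : forall (m : nat) x, cauchy (fn x) -> cauchy (fn (app (app opens m) x)))
    by (intros; apply cauchy_opens).
  destruct H as [g hg].
  - split; [|split].
    + intros m. apply holds_isOpen.
      * exact (CO m).
      * exact (@opens_ext m).
      * exact (@opens_open m).
    + intros m. apply holds_AllR. intros x hx h. apply holds_mem in h; [|apply cauchy_opens].
      apply holds_mem; [apply cauchy_opens|].
      apply opens_pos in h. apply opens_pos.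
      intros (n & b & hb & hp & hv & ha). apply h. exists n, b.
      split; [exact hb|]. split; [exact hp|]. split; [exact hv|].
      exact (above_mono (Nat.le_succ_diag_r m) ha).
    + intros n. destruct (opens_cover n) as [m hm]. exists m.
      apply holds_covers; [exact (CO m)|exact hm].
  - destruct (opens_no_choice g) as [n hn]. apply hn.
    specialize (hg n). apply holds_covers in hg; [exact hg|]. exact (CO (fn g n)).
Qed.

Theorem theorem2p13 :
  ~ proves Z2w_QF_AC01 OC00 /\ proves Z2W OC00.
Proof.
  split; [|apply Z2W_proves_OC00].
  intros D.
  pose (r := fun s (x : var [] s) => match x in var G' t
               return match G' with [] => ob t | _ => unit end with VZ => tt | VS _ => tt end).
  apply (OC00_fails (r := r)).
  apply (soundness Z2w_QF_AC01_valid D). intros B [].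
Qed.
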